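(* Let $n$ be a positive integer and $m$ an integer with $\lceil n/2\rceil\le m\le n$. \begin{enumerate} \item[(a)] The set $$\Big\{\tbinom{n}{k}\big(a^{\otimes k}\otimes(a^c)^{\otimes(n-k)}\big)^\vee e^{(n)}_{\ell,\mathbb{H}}e^{(n)}_{m,\mathbb{O}}\ :\ k\in\{n-\ell,\ldots,\ell\},\ \ell\in\{\lceil n/2\rceil,\ldots,m\}\Big\}$$ is a complete set of $\frac14(2m-n+1)(2m-n+3)$ (resp. $\frac14(2m-n+2)^2$) primitive orthogonal idempotents in $(\mathrm{Sym}^n\mathbb{H}\otimes_\mathbb{R}\mathbb{C})\cdot e^{(n)}_{m,\mathbb{O}}$ if $n$ is odd (resp. even). \item[(b)] If $n$ is odd, then the elements $$\binom{n}{k}\frac{n-2k}{2^k}\sum_{i=0}^{\frac{n-1}{2}-k}\Big(-\frac12\Big)^i\frac{\binom{n-2k-i}{i}}{n-2k-i}\big(1^{\otimes(n-2k-2i)}\otimes\square^{\otimes(k+i)}\big)^\vee\cdot e^{(n)}_{\ell,\mathbb{H}}e^{(n)}_{m,\mathbb{O}},$$ for $k\in\{n-\ell,\ldots,\frac{n-1}{2}\}$, $\ell\in\{\frac{n+1}{2},\ldots,m\}$, form a complete set of $\frac18(2m-n+1)(2m-n+3)$ primitive orthogonal idempotents in $\mathrm{Sym}^n\mathbb{H}\cdot e^{(n)}_{m,\mathbb{O}}$. \item[(c)] If $n$ is even, then the elements $\big(\tfrac12\big)^{n/2}\binom{n}{n/2}\big(\square^{\otimes\frac n2}\big)^\vee\cdot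 e^{(n)}_{\ell,\mathbb{H}}e^{(n)}_{m,\mathbb{O}}$ together with $$\binom{n}{k}\frac{\frac n2-k}{2^k}\sum_{i=0}^{\lfloor \frac n4-\frac k2\rfloor}\Big(-\frac14\Big)^i\frac{\binom{\frac n2-k-i}{i}}{\frac n2-k-i}\big(\square^{\otimes(k+2i)}\otimes(1\otimes1-\square)^{\otimes(\frac n2-k-2i)}\big)^\vee\cdot\frac12\big(1^{\otimes n}+\delta\, e_2^{\otimes n}\big)\cdot e^{(n)}_{\ell,\mathbb{H}}e^{(n)}_{m,\mathbb{O}},$$ for $k\in\{n-\ell,\ldots,\frac n2-1\}$, $\delta\in\{-1,1\}$, $\ell\in\{\frac n2,\ldots,m\}$, form a complete set of $\frac14(2m-n+2)^2$ primitive orthogonal idempotents in $\mathrm{Sym}^n\mathbb{H}\cdot e^{(n)}_{m,\mathbb{O}}$. \end{enumerate}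
   Context: $\mathbb{O}$ is the Cayley octonion algebra over $\mathbb{R}$ with basis $e_0=1,e_1,\dots,e_7$, where $e_1,e_2,e_3$ span with $1$ the quaternion subalgebra $\mathbb{H}$ ($e_i^2=-1$, $e_1e_2=-e_2e_1=e_3$, $e_2e_3=-e_3e_2=e_1$, $e_3e_1=-e_1e_3=e_2$), and $\mathbb{O}=\mathbb{H}\oplus\mathbb{H}e_4$ is the Cayley–Dickson double with $e_4^2=-1$, $e_{i+4}=e_ie_4$ ($i=1,2,3$), and product $(x+ye_4)(z+we_4)=(xz-\bar w y)+(wx+y\bar z)e_4$ for $x,y,z,w\in\mathbb{H}$. For $\mathcal C\in\{\mathbb{H},\mathbb{O}\}$ and $F\in\{\mathbb{R},\mathbb{C}\}$ let $\mathcal C_F=\mathcal C\otimes_\mathbb{R}F$ and $\mathcal C_F^{\otimes n}$ the $n$-fold tensor power over $F$ with componentwise multiplication; $\mathfrak S_n$ acts by permuting factors, $\sigma(x_1\otimes\cdots\otimes x_n)=x_{\sigma^{-1}(1)}\otimes\cdots\otimes x_{\sigma^{-1}(n)}$; $x^\vee=\frac1{n!}\sum_{\sigma}\sigma(x)$; $\mathrm{Sym}^n\mathcal C_F$ is the (possibly non-associative) algebra of $\mathfrak S_n$-fixed tensors; $\mathrm{Sym}^n\mathbb{H}_F\subset\mathrm{Sym}^n\mathbb{O}_F$ and $\mathrm{Sym}^n\mathcal C\otimes_\mathbb{R}\mathbb{C}=\mathrm{Sym}^n\mathcal C_\mathbb{C}$. With $d=\dim_\mathbb{R}\mathcal C$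 ($4$ or $8$), $\triangle_{\mathcal C}=\frac1d\sum_{i=0}^{d-1}e_i\otimes e_i$, and for $n\ge2$, $\triangle^{(n)}_{\mathcal C}=(\triangle_{\mathcal C}\otimes1^{\otimes(n-2)})^\vee$, which commutes and associates with every element of $\mathrm{Sym}^n\mathcal C_F$. For $\lceil n/2\rceil\le m\le n$ let $\beta^{(n)}_{m,\mathcal C}=\frac{2(n-m)(2m+d-2)}{dn(n-1)}$ and $e^{(n)}_{m,\mathcal C}=\prod_{\lceil n/2\rceil\le m'\le n,\ m'\neq m}\frac{\triangle^{(n)}_{\mathcal C}-\beta^{(n)}_{m',\mathcal C}1^{\otimes n}}{\beta^{(n)}_{m,\mathcal C}-\beta^{(n)}_{m',\mathcal C}}$ for $n\ge2$, $e^{(1)}_{1,\mathcal C}=1$. These are orthogonal idempotents summing to $1^{\otimes n}$ that commute and associate with all of $\mathrm{Sym}^n\mathcal C_F$; in particular $\mathrm{Sym}^n\mathbb{H}_F\cdot e^{(n)}_{m,\mathbb{O}}=\{r e^{(n)}_{m,\mathbb{O}}: r\in\mathrm{Sym}^n\mathbb{H}_F\}$ is an associative algebra with unit $e^{(n)}_{m,\mathbb{O}}$. Let $a=\frac12(1+\sqrt{-1}e_1)$, $a^c=\frac12(1-\sqrt{-1}e_1)$, $\square=\frac12(1\otimes1+e_1\otimes e_1)$. In a unital associative ring: idempotent $x^2=x$; orthogonal means pairwise products zero; a nonzero idempotent is primitive if not a sum of two nonzero orthogonal idempotents; a set of orthogonal idempotents is complete if it sums to the unit. *)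

(* Defs.v *)
From HB Require Import structures.
From mathcomp Require Import all_boot all_order all_algebra all_fingroup.
From mathcomp Require Import Rstruct complex.
Set Implicit Arguments. Unset Strict Implicit. Unset Printing Implicit Defensive.
Import Order.TTheory GRing.Theory Num.Theory.
Local Open Scope ring_scope.

Notation RR := Rdefinitions.R.
Notation CC := (complex Rdefinitions.R).

Section Octonions.
Variable F : fieldType.

(** Quaternions over F, coordinates (x0,x1,x2,x3) w.r.t. 1,e1,e2,e3. *)
Definition quat := (F * F * F * F)%type.
Definition qmk (a0 a1 a2 a3 : F) : quat := (a0, a1, a2, a3).
Definition q0 (q : quat) : F := q.1.1.1.
Definition q1 (q : quat) : F := q.1.1.2.
Definition q2 (q : quat) : F := q.1.2.
Definition q3 (q : quat) : F := q.2.
Definition qadd (a b : quat) : quat :=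
  qmk (q0 a + q0 b) (q1 a + q1 b) (q2 a + q2 b) (q3 a + q3 b).
Definition qopp (a : quat) : quat := qmk (- q0 a) (- q1 a) (- q2 a) (- q3 a).
Definition qconj (a : quat) : quat := qmk (q0 a) (- q1 a) (- q2 a) (- q3 a).
(** Hamilton product: e_i^2=-1, e1e2=-e2e1=e3, e2e3=-e3e2=e1, e3e1=-e1e3=e2 *)
Definition qmul (a b : quat) : quat :=
  qmk (q0 a * q0 b - q1 a * q1 b - q2 a * q2 b - q3 a * q3 b)
      (q0 a * q1 b + q1 a * q0 b + q2 a * q3 b - q3 a * q2 b)
      (q0 a * q2 b - q1 a * q3 b + q2 a * q0 b + q3 a * q1 b)
      (q0 a * q3 b + q1 a * q2 b - q2 a * q1 b + q3 a * q0 b).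
Definition qcoord (q : quat) (i : nat) : F :=
  match i with 0 => q0 q | 1 => q1 q | 2 => q2 q | 3 => q3 q | _ => 0 end.
Definition qbasis (i : nat) : quat :=
  qmk (i == 0%N)%:R (i == 1%N)%:R (i == 2%N)%:R (i == 3%N)%:R.

(** Octonions O = H + H e4 (Cayley--Dickson double):
    (x + y e4)(z + w e4) = (xz - conj(w) y) + (w x + y conj(z)) e4. *)
Definition oct := (quat * quat)%type.
Definition omul (a b : oct) : oct :=
  (qadd (qmul a.1 b.1) (qopp (qmul (qconj b.2) a.2)),
   qadd (qmul b.2 a.1) (qmul a.2 (qconj b.1))).
(** basis: e_i = (e_i,0) for i<4, e_4 = (0,1), e_{i+4} = e_i e_4 = (0,e_i). *)
Definition obasis (i : 'I_8) : oct :=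
  if (i < 4)%N then (qbasis i, qmk 0 0 0 0) else (qmk 0 0 0 0, qbasis (i - 4)).
Definition ocoord (x : oct) (k : 'I_8) : F :=
  if (k < 4)%N then qcoord x.1 k else qcoord x.2 (k - 4).
Definition gam (i j k : 'I_8) : F := ocoord (omul (obasis i) (obasis j)) k.

Definition ovec := 'I_8 -> F.
Definition ebasis (i : nat) : ovec := fun k => (val k == i)%:R.

(** The n-fold tensor power O_F^{(x)n}: coordinates w.r.t. the basis
    e_{I 0} (x) ... (x) e_{I (n-1)}, I : 'I_n -> 'I_8. *)
Definition tens (n : nat) := {ffun {ffun 'I_n -> 'I_8} -> F}.

(** componentwise multiplication, extended bilinearly *)
Definition tmul n (x y : tens n) : tens n :=
  [ffun K : {ffun 'I_n -> 'I_8} => \sum_(I : {ffun 'I_n -> 'I_8}) \sum_(J : {ffun 'I_n -> 'I_8})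
              x I * y J * \prod_(p < n) gam (I p) (J p) (K p)].

Definition tsc n (c : F) (x : tens n) : tens n := [ffun I => c * x I].

Definition tbasis n (I : {ffun 'I_n -> 'I_8}) : tens n := [ffun J => (J == I)%:R].

(** Building tensors from blocks: a block is a tensor of some arity r,
    read on a list of r indices.  The tensor product of a list of blocks
    (of total arity n) is computed by [tens_of n]. *)
Definition blk := (nat * (seq 'I_8 -> F))%type.
Fixpoint btens (bs : seq blk) (s : seq 'I_8) : F :=
  match bs with
  | [::] => 1
  | b :: bs' => b.2 (take b.1 s) * btens bs' (drop b.1 s)
  end.
Definition tens_of n (bs : seq blk) : tens n :=
  [ffun t : {ffun 'I_n -> 'I_8} => btens bs [seq t i | i <- enum 'I_n]].
Definition vblk (v : ovec) : blk := (1%N, fun s => v (head ord0 s)).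
Definition blk_of r (x : tens r) : blk := (r, fun s => x [ffun i : 'I_r => nth ord0 s i]).

Definition tone n : tens n := tens_of n (nseq n (vblk (ebasis 0))).

(** action of S_n: sigma(x_1 (x) ... (x) x_n) = x_{sigma^-1(1)} (x) ... *)
Definition tperm n (s : 'S_n) (x : tens n) : tens n :=
  [ffun I : {ffun 'I_n -> 'I_8} => x [ffun q => I (s q)]].
Definition sym n (x : tens n) : tens n :=
  tsc (n`!%:R)^-1 (\sum_(s : 'S_n) tperm s x).

(** Sym^n H_F inside O_F^{(x)n}: S_n-fixed tensors supported on H^{(x)n} *)
Definition symH n (x : tens n) : Prop :=
  (forall s : 'S_n, tperm s x = x) /\
  (forall I, x I != 0 -> forall p, (I p < 4)%N).

(** Triangle_C for d = dim C in {4,8} *)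
Definition tri (d : nat) : tens 2 :=
  tsc (d%:R)^-1 (\sum_(i < 8 | (i < d)%N) tbasis [ffun _ : 'I_2 => i]).
Definition triN n d : tens n :=
  sym (tens_of n (blk_of (tri d) :: nseq (n - 2) (vblk (ebasis 0)))).
Definition beta n d m : F :=
  (2 * (n - m) * (2 * m + d - 2))%N%:R / (d * n * (n - 1))%N%:R.
Definition eidem n d m : tens n :=
  if (n <= 1)%N then tone n else
  foldr (fun m' acc => tmul acc
          (tsc (beta n d m - beta n d m')^-1 (triN n d - tsc (beta n d m') (tone n))))
        (tone n) [seq m' <- iota (uphalf n) (n - uphalf n).+1 | m' != m].
Definition eH n m := eidem n 4 m.
Definition eO n m := eidem n 8 m.

Definition algA n m (x : tens n) : Prop := exists r, symH r /\ x = tmul r (eO n m).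

Definition idem n (x : tens n) := tmul x x = x.
Definition orth n (x y : tens n) := tmul x y = 0 /\ tmul y x = 0.
Definition primitive_in n (A : tens n -> Prop) (x : tens n) : Prop :=
  idem x /\ x <> 0 /\
  ~ (exists y z, [/\ A y, A z, idem y & idem z] /\
       [/\ y <> 0, z <> 0, orth y z & x = y + z]).
Definition complete_poi n (A : tens n -> Prop) (u : tens n) (N : nat)
  (s : seq (tens n)) : Prop :=
  [/\ uniq s, size s = N,
      forall x, x \in s -> A x /\ primitive_in A x,
      forall i j, (i < size s)%N -> (j < size s)%N -> i <> j ->
        orth (nth 0 s i) (nth 0 s j)
    & \sum_(x <- s) x = u].

Definition sqr : tens 2 :=
  tsc (2%:R)^-1 (tbasis [ffun _ : 'I_2 => 0] + tbasis [ffun _ : 'I_2 => 1]).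
End Octonions.

Definition aC : ovec CC := fun k =>
  if val k == 0%N then 2%:R^-1 else if val k == 1%N then 2%:R^-1 * 'i%C else 0.
Definition acC : ovec CC := fun k =>
  if val k == 0%N then 2%:R^-1 else if val k == 1%N then - (2%:R^-1 * 'i%C) else 0.

Definition famA n m (k l : nat) : tens CC n :=
  tmul (tmul (tsc 'C(n, k)%:R
                (sym (tens_of n (nseq k (vblk aC) ++ nseq (n - k) (vblk acC)))))
             (eH CC n l)) (eO CC n m).

Definition famB n m (k l : nat) : tens RR n :=
  tmul (tmul (tsc (('C(n, k) * (n - 2 * k))%N%:R / (2 ^ k)%N%:R)
     (\sum_(0 <= i < ((n.-1)./2 - k).+1)
        tsc ((- 2%:R^-1) ^+ i * 'C(n - 2 * k - i, i)%:R / (n - 2 * k - i)%N%:R)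
        (sym (tens_of n (nseq (n - 2 * k - 2 * i) (vblk (ebasis RR 0))
                        ++ nseq (k + i) (blk_of (sqr RR)))))))
     (eH RR n l)) (eO RR n m).

Definition famC0 n m (l : nat) : tens RR n :=
  tmul (tmul (tsc ((2%:R^-1) ^+ (n./2) * 'C(n, n./2)%:R)
                (sym (tens_of n (nseq n./2 (blk_of (sqr RR))))))
             (eH RR n l)) (eO RR n m).
Definition famC n m (k l : nat) (dlt : RR) : tens RR n :=
  tmul (tmul (tmul (tsc (('C(n, k) * (n./2 - k))%N%:R / (2 ^ k)%N%:R)
     (\sum_(0 <= i < ((n./2 - k)./2).+1)
        tsc ((- 4%:R^-1) ^+ i * 'C(n./2 - k - i, i)%:R / (n./2 - k - i)%N%:R)
        (sym (tens_of n (nseq (k + 2 * i) (blk_of (sqr RR))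
                  ++ nseq (n./2 - k - 2 * i)
                       (blk_of (tbasis RR [ffun _ : 'I_2 => 0] - sqr RR)))))))
     (tsc 2%:R^-1 (tone RR n + tsc dlt (tens_of n (nseq n (vblk (ebasis RR 2)))))))
     (eH RR n l)) (eO RR n m).

(* Main.v *)
(** Symmetric tensors of degree n are identified with homogeneous polynomials of degree n
    in eight variables.  Multiplication by [triN n d] becomes the operator
    [N * Delta / (d n (n - 1))], where N is the norm form and Delta the Laplacian in the first
    d variables; checking on powers of vectors, which span by polarization, shows that it is
    central and nuclear.  The eigenvalues of [N * Delta] are read off from
    [Delta N - N Delta = 4 deg + 2 d], so the [eidem] are the Lagrange idempotents of this operator.

    Over C, H is the algebra of 2 x 2 matrices, and the tensors [bk k] built from a and a^c are
    the weight idempotents.  The polynomial of [bk k * x * bk k] lies in the span of the monomials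
    A^(k-s) C^(n-k-s) (U W)^s, which [N * Delta] generates from A^k C^(n-k); hence each corner
    cut out by [bk k * eH l] is one-dimensional, which is primitivity.  Applying [Delta] repeatedly
    decides which products [bk k * eH l * eO m] vanish.

    Over R, Girard-Waring identifies the families (b) and (c) with [bk k + bk (n - k)], on which
    e_2^(tensor n) exchanges the two summands.  Its square is (-1)^n: for n odd the real corner
    embeds into a division algebra of quaternions, for n even it splits into two lines. *)
Require Import Defs.
From HB Require Import structures.
From mathcomp Require Import all_boot all_order all_algebra all_fingroup.
From mathcomp Require Import Rstruct complex.
From mathcomp Require Import mpoly ring zify.
Import Defs.
Set Implicit Arguments. Unset Strict Implicit. Unset Printing Implicit Defensive.
Import Order.TTheory GRing.Theory Num.Theory.
Local Open Scope ring_scope.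


(** * Tensor powers of the octonions *)

(** Sym^n O is not associative and the octonionic idempotents do not lie in Sym^n H. The work is
    therefore done upstairs: symmetric quaternionic tensors form an associative ring [symT], and
    multiplication by [eO m] is a ring map [piO] onto the algebra of the theorem. Its kernel is
    never described; it is enough to know which products of a weight idempotent with [eH l] survive.
    The harmonic decomposition is not constructed either. The label m stands for the component
    N^(n-m) times harmonics of degree 2m - n, but the facts used are that Delta^a turns N * Delta
    into a scalar modulo multiples of N, and that a fixed power of Delta kills every symbol.
    Remainders modulo N are removed by specializing at zeros of the norm form. Primitivity is
    reduced to the absence of zero divisors in a corner ([domain_at]). This covers lines and
    quaternion division algebras at once, and it can be checked on real elements after passing to
    C. *)

Section TensorAlgebra.
Variables (F : fieldType) (n : nat).
Local Notation ix := {ffun 'I_n -> 'I_8}.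
Implicit Types (x y z : tens F n) (v w : 'I_n -> ovec F) (s : 'S_n).

Lemma tscDr c x y : tsc c (x + y) = tsc c x + tsc c y.
Proof. by apply/ffunP => I; rewrite !ffunE mulrDr. Qed.
Lemma tscDl c c' x : tsc (c + c') x = tsc c x + tsc c' x.
Proof. by apply/ffunP => I; rewrite !ffunE mulrDl. Qed.
Lemma tscA c c' x : tsc c (tsc c' x) = tsc (c * c') x.
Proof. by apply/ffunP => I; rewrite !ffunE mulrA. Qed.
Lemma tsc1 x : tsc 1 x = x.
Proof. by apply/ffunP => I; rewrite !ffunE mul1r. Qed.
Lemma tsc0 x : tsc 0 x = 0.
Proof. by apply/ffunP => I; rewrite !ffunE mul0r. Qed.
Lemma tscr0 c : tsc c 0 = 0 :> tens F n.
Proof. by apply/ffunP => I; rewrite !ffunE mulr0. Qed.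
Lemma tscN1 x : tsc (-1) x = - x.
Proof. by apply/ffunP => I; rewrite !ffunE mulN1r. Qed.
Lemma tsc_sumr (T : Type) (r : seq T) (P : pred T) c (f : T -> tens F n) :
  tsc c (\sum_(i <- r | P i) f i) = \sum_(i <- r | P i) tsc c (f i).
Proof.
exact: (big_morph (tsc c) (tscDr c) (tscr0 c)).
Qed.

Lemma tmulDl x y z : tmul (x + y) z = tmul x z + tmul y z.
Proof.
apply/ffunP => K; rewrite !ffunE -big_split; apply: eq_bigr => I _ /=.
by rewrite -big_split; apply: eq_bigr => J _ /=; rewrite !ffunE !mulrDl.
Qed.
Lemma tmulDr x y z : tmul z (x + y) = tmul z x + tmul z y.
Proof.
apply/ffunP => K; rewrite !ffunE -big_split; apply: eq_bigr => I _ /=.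
by rewrite -big_split; apply: eq_bigr => J _ /=; rewrite !ffunE mulrDr mulrDl.
Qed.
Lemma tmul_tscl c x y : tmul (tsc c x) y = tsc c (tmul x y).
Proof.
apply/ffunP => K; rewrite !ffunE big_distrr; apply: eq_bigr => I _ /=.
by rewrite big_distrr; apply: eq_bigr => J _ /=; rewrite !ffunE !mulrA.
Qed.
Lemma tmul_tscr c x y : tmul x (tsc c y) = tsc c (tmul x y).
Proof.
apply/ffunP => K; rewrite !ffunE big_distrr; apply: eq_bigr => I _ /=.
rewrite big_distrr; apply: eq_bigr => J _ /=; rewrite !ffunE.
by rewrite [x I * _]mulrCA !mulrA.
Qed.
Lemma tmul0r x : tmul 0 x = 0.
Proof. by have := tmul_tscl 0 0 x; rewrite !tsc0. Qed.
Lemma tmulr0 x : tmul x 0 = 0.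
Proof. by have := tmul_tscr 0 x 0; rewrite !tsc0. Qed.
Lemma tmulNl x y : tmul (- x) y = - tmul x y.
Proof. by rewrite -!tscN1 tmul_tscl. Qed.
Lemma tmul_suml (T : Type) (r : seq T) (P : pred T) (f : T -> tens F n) y :
  tmul (\sum_(i <- r | P i) f i) y = \sum_(i <- r | P i) tmul (f i) y.
Proof.
by apply: (big_morph (fun a => tmul a y)) => [a b|]; rewrite ?tmulDl ?tmul0r.
Qed.
Lemma tmul_sumr (T : Type) (r : seq T) (P : pred T) (f : T -> tens F n) y :
  tmul y (\sum_(i <- r | P i) f i) = \sum_(i <- r | P i) tmul y (f i).
Proof.
by apply: (big_morph (tmul y)) => [a b|]; rewrite ?tmulDr ?tmulr0.
Qed.

Definition vmul (a b : ovec F) : ovec F :=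
  fun k => \sum_i \sum_j a i * b j * gam F i j k.

Definition pure v : tens F n := [ffun I : ix => \prod_p v p (I p)].

Lemma eq_pure v w : (forall p, v p =1 w p) -> pure v = pure w.
Proof. by move=> e; apply/ffunP => I; rewrite !ffunE; apply: eq_bigr => p _; rewrite e. Qed.

Lemma tmul_pure v w : tmul (pure v) (pure w) = pure (fun p => vmul (v p) (w p)).
Proof.
apply/ffunP => K; rewrite !ffunE.
rewrite (bigA_distr_bigA (fun p i => \sum_j v p i * w p j * gam F i j (K p))).
apply: eq_bigr => I _.
rewrite (bigA_distr_bigA (fun p j => v p (I p) * w p j * gam F (I p) j (K p))).
by apply: eq_bigr => J _; rewrite !ffunE !big_split.
Qed.

Lemma pure_ebasis (I : ix) : tbasis F I = pure (fun p => ebasis F (I p)).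
Proof.
apply/ffunP => J; rewrite !ffunE /ebasis.
case: eqP => [->|/eqP ne]; first by rewrite big1 // => p _; rewrite eqxx.
have [p np] : exists p, J p != I p.
  apply/existsP; apply: contraR ne; rewrite negb_exists => /forallP e.
  by apply/eqP/ffunP => p; apply/eqP; have := e p; rewrite negbK.
by rewrite (bigD1 p) //= (negbTE (np : val (J p) != val (I p))) mul0r.
Qed.

Lemma tens_tbasis x : x = \sum_I tsc (x I) (tbasis F I).
Proof.
apply/ffunP => J; rewrite sum_ffunE (bigD1 J) //= !ffunE eqxx mulr1.
rewrite big1 ?addr0 // => I nI; rewrite !ffunE eq_sym (negbTE nI) mulr0 //.
Qed.

Lemma tpermE s x I : tperm s x I = x [ffun q => I (s q)].
Proof. by rewrite ffunE. Qed.

Lemma tpermD s x y : tperm s (x + y) = tperm s x + tperm s y.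
Proof. by apply/ffunP => I; rewrite !ffunE. Qed.
Lemma tperm0 s : tperm s 0 = 0 :> tens F n.
Proof. by apply/ffunP => I; rewrite !ffunE. Qed.
Lemma tperm_tsc s c x : tperm s (tsc c x) = tsc c (tperm s x).
Proof. by apply/ffunP => I; rewrite !ffunE. Qed.
Lemma tperm_sum (T : Type) (r : seq T) (P : pred T) s (f : T -> tens F n) :
  tperm s (\sum_(i <- r | P i) f i) = \sum_(i <- r | P i) tperm s (f i).
Proof. exact: (big_morph (tperm s) (tpermD s) (tperm0 s)). Qed.

Lemma tperm_pure s v : tperm s (pure v) = pure (fun p => v (s^-1%g p)).
Proof.
apply/ffunP => I; rewrite !ffunE [RHS](reindex_inj (@perm_inj _ s)) /=.
by apply: eq_bigr => p _; rewrite ffunE permK.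
Qed.

Lemma tperm_tmul s x y : tperm s (tmul x y) = tmul (tperm s x) (tperm s y).
Proof.
rewrite [x]tens_tbasis [y]tens_tbasis !(tmul_suml, tperm_sum).
apply: eq_bigr => I _; rewrite !tmul_sumr !tperm_sum.
apply: eq_bigr => J _.
by rewrite !(tperm_tsc, tmul_tscl, tmul_tscr, pure_ebasis, tmul_pure, tperm_pure).
Qed.

Lemma tperm_comp s s' x : tperm s (tperm s' x) = tperm (s' * s)%g x.
Proof.
by apply/ffunP => I; rewrite !ffunE; congr (x _); apply/ffunP => q; rewrite !ffunE permM.
Qed.

End TensorAlgebra.

(** * Octonion multiplication and the norm form *)

Section OctonionProduct.
Variable F : fieldType.
Implicit Types a b : ovec F.

Local Notation "# i" := (@Ordinal 8 i isT) (at level 0, i at level 0, format "# i").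

Lemma big_ord8 (V : nmodType) (f : 'I_8 -> V) :
  \sum_i f i = f #0 + f #1 + f #2 + f #3 + f #4 + f #5 + f #6 + f #7.
Proof.
rewrite !big_ord_recl big_ord0 addr0 !addrA.
by do ![congr (_ + _)]; congr f; apply/val_inj.
Qed.

Lemma forall_ord8 (P : 'I_8 -> Prop) :
  P #0 -> P #1 -> P #2 -> P #3 -> P #4 -> P #5 -> P #6 -> P #7 -> forall i, P i.
Proof.
move=> h0 h1 h2 h3 h4 h5 h6 h7 [i hi].
by do 8?[case: i hi => [|i] hi; first by rewrite (bool_irrelevance hi isT)].
Qed.

Definition oct_of a : oct F :=
  (qmk (a #0) (a #1) (a #2) (a #3), qmk (a #4) (a #5) (a #6) (a #7)).

(** The doubled product multiplied out once, so that later identities go to [ring] coordinate by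
    coordinate. *)
Definition otab (x0 x1 x2 x3 x4 x5 x6 x7 y0 y1 y2 y3 y4 y5 y6 y7 : F) : oct F :=
  (qmk (x0*y0 - x1*y1 - x2*y2 - x3*y3 - (y4*x4 + y5*x5 + y6*x6 + y7*x7))
       (x0*y1 + x1*y0 + x2*y3 - x3*y2 - (y4*x5 - y5*x4 - y6*x7 + y7*x6))
       (x0*y2 - x1*y3 + x2*y0 + x3*y1 - (y4*x6 + y5*x7 - y6*x4 - y7*x5))
       (x0*y3 + x1*y2 - x2*y1 + x3*y0 - (y4*x7 - y5*x6 + y6*x5 - y7*x4)),
   qmk (y4*x0 - y5*x1 - y6*x2 - y7*x3 + (x4*y0 + x5*y1 + x6*y2 + x7*y3))
       (y4*x1 + y5*x0 + y6*x3 - y7*x2 + (x5*y0 - x4*y1 - x6*y3 + x7*y2))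
       (y4*x2 - y5*x3 + y6*x0 + y7*x1 + (x6*y0 - x4*y2 + x5*y3 - x7*y1))
       (y4*x3 + y5*x2 - y6*x1 + y7*x0 + (x7*y0 - x4*y3 - x5*y2 + x6*y1))).

Lemma omulE x0 x1 x2 x3 x4 x5 x6 x7 y0 y1 y2 y3 y4 y5 y6 y7 :
  omul (qmk x0 x1 x2 x3, qmk x4 x5 x6 x7) (qmk y0 y1 y2 y3, qmk y4 y5 y6 y7) =
  otab x0 x1 x2 x3 x4 x5 x6 x7 y0 y1 y2 y3 y4 y5 y6 y7.
Proof.
cbv beta iota delta [omul qmul qconj qopp qadd otab qmk q0 q1 q2 q3 fst snd].
by do ![congr (_, _)]; ring.
Qed.

Lemma ocoordE p0 p1 p2 p3 p4 p5 p6 p7 k :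
  ocoord (qmk p0 p1 p2 p3, qmk p4 p5 p6 p7 : quat F) k =
  nth 0 [:: p0; p1; p2; p3; p4; p5; p6; p7] k.
Proof. by move: k; apply: forall_ord8. Qed.

(** [vmul] knows the product only through the structure constants [gam], which are read off from
    basis vectors; bilinearity identifies it with [omul]. *)
Lemma omul_suml (y : oct F) a k :
  \sum_i a i * ocoord (omul (obasis F i) y) k = ocoord (omul (oct_of a) y) k.
Proof.
case: y => [[[[y0 y1] y2] y3] [[[y4 y5] y6] y7]].
rewrite big_ord8 /obasis /oct_of !(omulE _ _ _ _ _ _ _ _ y0 y1 y2 y3 y4 y5 y6 y7) /=.
move: k; apply: forall_ord8;
  rewrite /otab !ocoordE; cbv beta iota delta [nth nat_of_ord]; ring.
Qed.

Lemma omul_sumr (x : oct F) b k :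
  \sum_j b j * ocoord (omul x (obasis F j)) k = ocoord (omul x (oct_of b)) k.
Proof.
case: x => [[[[x0 x1] x2] x3] [[[x4 x5] x6] x7]].
rewrite big_ord8 /obasis /oct_of !(omulE x0 x1 x2 x3 x4 x5 x6 x7) /=.
move: k; apply: forall_ord8;
  rewrite /otab !ocoordE; cbv beta iota delta [nth nat_of_ord]; ring.
Qed.

Lemma vmul_omul a b k : vmul a b k = ocoord (omul (oct_of a) (oct_of b)) k.
Proof.
rewrite -omul_suml; apply: eq_bigr => i _; rewrite -omul_sumr mulr_sumr.
by apply: eq_bigr => j _; rewrite mulrA.
Qed.

Lemma vmulE a b : (
  (vmul a b #0 = (a #0 * b #0 - a #1 * b #1 - a #2 * b #2 - a #3 * b #3 - a #4 * b #4 - a #5 * b #5 - a #6 * b #6 - a #7 * b #7)%R) *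
  (vmul a b #1 = (a #0 * b #1 + a #1 * b #0 + a #2 * b #3 - a #3 * b #2 + a #4 * b #5 - a #5 * b #4 - a #6 * b #7 + a #7 * b #6)%R) *
  (vmul a b #2 = (a #0 * b #2 - a #1 * b #3 + a #2 * b #0 + a #3 * b #1 + a #4 * b #6 + a #5 * b #7 - a #6 * b #4 - a #7 * b #5)%R) *
  (vmul a b #3 = (a #0 * b #3 + a #1 * b #2 - a #2 * b #1 + a #3 * b #0 + a #4 * b #7 - a #5 * b #6 + a #6 * b #5 - a #7 * b #4)%R) *
  (vmul a b #4 = (a #0 * b #4 - a #1 * b #5 - a #2 * b #6 - a #3 * b #7 + a #4 * b #0 + a #5 * b #1 + a #6 * b #2 + a #7 * b #3)%R) *
  (vmul a b #5 = (a #0 * b #5 + a #1 * b #4 - a #2 * b #7 + a #3 * b #6 - a #4 * b #1 + a #5 * b #0 - a #6 * b #3 + a #7 * b #2)%R) *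
  (vmul a b #6 = (a #0 * b #6 + a #1 * b #7 + a #2 * b #4 - a #3 * b #5 - a #4 * b #2 + a #5 * b #3 + a #6 * b #0 - a #7 * b #1)%R) *
  (vmul a b #7 = (a #0 * b #7 - a #1 * b #6 + a #2 * b #5 + a #3 * b #4 - a #4 * b #3 - a #5 * b #2 + a #6 * b #1 + a #7 * b #0)%R))%type.
Proof.
do !split; rewrite vmul_omul /oct_of omulE /otab ocoordE;
  cbv beta iota delta [nth nat_of_ord]; ring.
Qed.

Lemma vmul_e0l a : vmul (ebasis F 0) a =1 a.
Proof. by apply: forall_ord8; rewrite vmulE /ebasis /=; ring. Qed.
Lemma vmul_e0r a : vmul a (ebasis F 0) =1 a.
Proof. by apply: forall_ord8; rewrite vmulE /ebasis /=; ring. Qed.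

(** For d = 4 this cuts out H inside O and for d = 8 it is vacuous, so that both algebras can share
    their statements. *)
Definition suppv d a := forall k : 'I_8, (d <= k)%N -> a k = 0.

Lemma suppv4 a : suppv 4 a -> [/\ a #4 = 0, a #5 = 0, a #6 = 0 & a #7 = 0].
Proof. by move=> h; rewrite !h. Qed.

Lemma suppv8 a : suppv 8 a.
Proof. by move=> k; rewrite leqNgt ltn_ord. Qed.

Lemma vmul4E a b : suppv 4 a -> suppv 4 b -> (
  (vmul a b #0 = (a #0 * b #0 - a #1 * b #1 - a #2 * b #2 - a #3 * b #3)%R) *
  (vmul a b #1 = (a #0 * b #1 + a #1 * b #0 + a #2 * b #3 - a #3 * b #2)%R) *
  (vmul a b #2 = (a #0 * b #2 - a #1 * b #3 + a #2 * b #0 + a #3 * b #1)%R) *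
  (vmul a b #3 = (a #0 * b #3 + a #1 * b #2 - a #2 * b #1 + a #3 * b #0)%R) *
  (vmul a b #4 = 0%R) *
  (vmul a b #5 = 0%R) *
  (vmul a b #6 = 0%R) *
  (vmul a b #7 = 0%R))%type.
Proof.
move=> /suppv4[h1 h2 h3 h4] /suppv4[h5 h6 h7 h8].
by do !split; rewrite vmulE h1 h2 h3 h4 h5 h6 h7 h8; ring.
Qed.

Lemma suppv4_vmul a b : suppv 4 a -> suppv 4 b -> suppv 4 (vmul a b).
Proof. by move=> ha hb; apply: forall_ord8 => // _; rewrite (vmul4E ha hb). Qed.

Lemma vmul_assoc4 a b c : suppv 4 a -> suppv 4 b -> suppv 4 c ->
  vmul a (vmul b c) =1 vmul (vmul a b) c.
Proof.
move=> ha hb hc; have hab := suppv4_vmul ha hb; have hbc := suppv4_vmul hb hc.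
by apply: forall_ord8;
  rewrite (vmul4E ha hbc) (vmul4E hab hc) ?(vmul4E ha hb) ?(vmul4E hb hc); ring.
Qed.

Definition normv d a : F := \sum_(i < 8 | (i < d)%N) a i ^+ 2.
Definition lin a : {mpoly F[8]} := \sum_i a i *: 'X_i.
Definition normX d : {mpoly F[8]} := \sum_(i < 8 | (i < d)%N) 'X_i ^+ 2.

Lemma linE a : lin a = (a #0)%:MP * 'X_#0 + (a #1)%:MP * 'X_#1 + (a #2)%:MP * 'X_#2
  + (a #3)%:MP * 'X_#3 + (a #4)%:MP * 'X_#4 + (a #5)%:MP * 'X_#5
  + (a #6)%:MP * 'X_#6 + (a #7)%:MP * 'X_#7.
Proof. by rewrite /lin big_ord8 !mul_mpolyC. Qed.

Lemma normv8E a : normv 8 a = a #0 ^+ 2 + a #1 ^+ 2 + a #2 ^+ 2 + a #3 ^+ 2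
  + a #4 ^+ 2 + a #5 ^+ 2 + a #6 ^+ 2 + a #7 ^+ 2.
Proof. by rewrite /normv big_mkcond big_ord8. Qed.
Lemma normv4E a : normv 4 a = a #0 ^+ 2 + a #1 ^+ 2 + a #2 ^+ 2 + a #3 ^+ 2.
Proof. by rewrite /normv big_mkcond big_ord8 /= !addr0. Qed.
Lemma normX8E : normX 8 = 'X_#0 ^+ 2 + 'X_#1 ^+ 2 + 'X_#2 ^+ 2 + 'X_#3 ^+ 2
  + 'X_#4 ^+ 2 + 'X_#5 ^+ 2 + 'X_#6 ^+ 2 + 'X_#7 ^+ 2.
Proof. by rewrite /normX big_mkcond big_ord8. Qed.
Lemma normX4E : normX 4 = 'X_#0 ^+ 2 + 'X_#1 ^+ 2 + 'X_#2 ^+ 2 + 'X_#3 ^+ 2.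
Proof. by rewrite /normX big_mkcond big_ord8 /= !addr0. Qed.

Lemma normv8M a b : normv 8 (vmul a b) = normv 8 a * normv 8 b.
Proof. by rewrite !normv8E !vmulE /=; ring. Qed.

Lemma lin_rmul a : (
  (lin (vmul (ebasis F 0) a) = ((a #0)%:MP * 'X_#0 + (a #1)%:MP * 'X_#1 + (a #2)%:MP * 'X_#2 + (a #3)%:MP * 'X_#3 + (a #4)%:MP * 'X_#4 + (a #5)%:MP * 'X_#5 + (a #6)%:MP * 'X_#6 + (a #7)%:MP * 'X_#7)%R) *
  (lin (vmul (ebasis F 1) a) = ((a #0)%:MP * 'X_#1 - (a #1)%:MP * 'X_#0 + (a #2)%:MP * 'X_#3 - (a #3)%:MP * 'X_#2 + (a #4)%:MP * 'X_#5 - (a #5)%:MP * 'X_#4 - (a #6)%:MP * 'X_#7 + (a #7)%:MP * 'X_#6)%R) *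
  (lin (vmul (ebasis F 2) a) = ((a #0)%:MP * 'X_#2 - (a #1)%:MP * 'X_#3 - (a #2)%:MP * 'X_#0 + (a #3)%:MP * 'X_#1 + (a #4)%:MP * 'X_#6 + (a #5)%:MP * 'X_#7 - (a #6)%:MP * 'X_#4 - (a #7)%:MP * 'X_#5)%R) *
  (lin (vmul (ebasis F 3) a) = ((a #0)%:MP * 'X_#3 + (a #1)%:MP * 'X_#2 - (a #2)%:MP * 'X_#1 - (a #3)%:MP * 'X_#0 + (a #4)%:MP * 'X_#7 - (a #5)%:MP * 'X_#6 + (a #6)%:MP * 'X_#5 - (a #7)%:MP * 'X_#4)%R) *
  (lin (vmul (ebasis F 4) a) = ((a #0)%:MP * 'X_#4 - (a #1)%:MP * 'X_#5 - (a #2)%:MP * 'X_#6 - (a #3)%:MP * 'X_#7 - (a #4)%:MP * 'X_#0 + (a #5)%:MP * 'X_#1 + (a #6)%:MP * 'X_#2 + (a #7)%:MP * 'X_#3)%R) *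
  (lin (vmul (ebasis F 5) a) = ((a #0)%:MP * 'X_#5 + (a #1)%:MP * 'X_#4 - (a #2)%:MP * 'X_#7 + (a #3)%:MP * 'X_#6 - (a #4)%:MP * 'X_#1 - (a #5)%:MP * 'X_#0 - (a #6)%:MP * 'X_#3 + (a #7)%:MP * 'X_#2)%R) *
  (lin (vmul (ebasis F 6) a) = ((a #0)%:MP * 'X_#6 + (a #1)%:MP * 'X_#7 + (a #2)%:MP * 'X_#4 - (a #3)%:MP * 'X_#5 - (a #4)%:MP * 'X_#2 + (a #5)%:MP * 'X_#3 - (a #6)%:MP * 'X_#0 - (a #7)%:MP * 'X_#1)%R) *
  (lin (vmul (ebasis F 7) a) = ((a #0)%:MP * 'X_#7 - (a #1)%:MP * 'X_#6 + (a #2)%:MP * 'X_#5 + (a #3)%:MP * 'X_#4 - (a #4)%:MP * 'X_#3 - (a #5)%:MP * 'X_#2 + (a #6)%:MP * 'X_#1 - (a #7)%:MP * 'X_#0)%R))%type.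
Proof. by do !split; rewrite linE !vmulE /ebasis /=; ring. Qed.

Lemma lin_lmul a : (
  (lin (vmul a (ebasis F 0)) = ((a #0)%:MP * 'X_#0 + (a #1)%:MP * 'X_#1 + (a #2)%:MP * 'X_#2 + (a #3)%:MP * 'X_#3 + (a #4)%:MP * 'X_#4 + (a #5)%:MP * 'X_#5 + (a #6)%:MP * 'X_#6 + (a #7)%:MP * 'X_#7)%R) *
  (lin (vmul a (ebasis F 1)) = ((a #0)%:MP * 'X_#1 - (a #1)%:MP * 'X_#0 - (a #2)%:MP * 'X_#3 + (a #3)%:MP * 'X_#2 - (a #4)%:MP * 'X_#5 + (a #5)%:MP * 'X_#4 + (a #6)%:MP * 'X_#7 - (a #7)%:MP * 'X_#6)%R) *
  (lin (vmul a (ebasis F 2)) = ((a #0)%:MP * 'X_#2 + (a #1)%:MP * 'X_#3 - (a #2)%:MP * 'X_#0 - (a #3)%:MP * 'X_#1 - (a #4)%:MP * 'X_#6 - (a #5)%:MP * 'X_#7 + (a #6)%:MP * 'X_#4 + (a #7)%:MP * 'X_#5)%R) *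
  (lin (vmul a (ebasis F 3)) = ((a #0)%:MP * 'X_#3 - (a #1)%:MP * 'X_#2 + (a #2)%:MP * 'X_#1 - (a #3)%:MP * 'X_#0 - (a #4)%:MP * 'X_#7 + (a #5)%:MP * 'X_#6 - (a #6)%:MP * 'X_#5 + (a #7)%:MP * 'X_#4)%R) *
  (lin (vmul a (ebasis F 4)) = ((a #0)%:MP * 'X_#4 + (a #1)%:MP * 'X_#5 + (a #2)%:MP * 'X_#6 + (a #3)%:MP * 'X_#7 - (a #4)%:MP * 'X_#0 - (a #5)%:MP * 'X_#1 - (a #6)%:MP * 'X_#2 - (a #7)%:MP * 'X_#3)%R) *
  (lin (vmul a (ebasis F 5)) = ((a #0)%:MP * 'X_#5 - (a #1)%:MP * 'X_#4 + (a #2)%:MP * 'X_#7 - (a #3)%:MP * 'X_#6 + (a #4)%:MP * 'X_#1 - (a #5)%:MP * 'X_#0 + (a #6)%:MP * 'X_#3 - (a #7)%:MP * 'X_#2)%R) *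
  (lin (vmul a (ebasis F 6)) = ((a #0)%:MP * 'X_#6 - (a #1)%:MP * 'X_#7 - (a #2)%:MP * 'X_#4 + (a #3)%:MP * 'X_#5 + (a #4)%:MP * 'X_#2 - (a #5)%:MP * 'X_#3 - (a #6)%:MP * 'X_#0 + (a #7)%:MP * 'X_#1)%R) *
  (lin (vmul a (ebasis F 7)) = ((a #0)%:MP * 'X_#7 + (a #1)%:MP * 'X_#6 - (a #2)%:MP * 'X_#5 - (a #3)%:MP * 'X_#4 + (a #4)%:MP * 'X_#3 + (a #5)%:MP * 'X_#2 - (a #6)%:MP * 'X_#1 - (a #7)%:MP * 'X_#0)%R))%type.
Proof. by do !split; rewrite linE !vmulE /ebasis /=; ring. Qed.

(** Right multiplication by a is a similitude of ratio [normv 8 a], hence so is its transpose; this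
    is multiplicativity of the norm in dual form. The linear forms on the left are the images of the
    variables when a symbol is multiplied by a power of a. *)
Lemma norm_rmul8 a :
  \sum_(i < 8 | (i < 8)%N) lin (vmul (ebasis F i) a) ^+ 2 = (normv 8 a)%:MP * normX 8.
Proof.
by rewrite normv8E normX8E big_mkcond big_ord8 /= !lin_rmul; ring.
Qed.

Lemma norm_lmul8 a :
  \sum_(i < 8 | (i < 8)%N) lin (vmul a (ebasis F i)) ^+ 2 = (normv 8 a)%:MP * normX 8.
Proof.
by rewrite normv8E normX8E big_mkcond big_ord8 /= !lin_lmul; ring.
Qed.

Lemma normv4M a b : suppv 4 a -> suppv 4 b -> normv 4 (vmul a b) = normv 4 a * normv 4 b.
Proof. by move=> ha hb; rewrite !normv4E !(vmul4E ha hb); ring. Qed.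

Lemma lin_rmul4 a : suppv 4 a -> (
  (lin (vmul (ebasis F 0) a) = ((a #0)%:MP * 'X_#0 + (a #1)%:MP * 'X_#1 + (a #2)%:MP * 'X_#2 + (a #3)%:MP * 'X_#3)%R) *
  (lin (vmul (ebasis F 1) a) = ((a #0)%:MP * 'X_#1 - (a #1)%:MP * 'X_#0 + (a #2)%:MP * 'X_#3 - (a #3)%:MP * 'X_#2)%R) *
  (lin (vmul (ebasis F 2) a) = ((a #0)%:MP * 'X_#2 - (a #1)%:MP * 'X_#3 - (a #2)%:MP * 'X_#0 + (a #3)%:MP * 'X_#1)%R) *
  (lin (vmul (ebasis F 3) a) = ((a #0)%:MP * 'X_#3 + (a #1)%:MP * 'X_#2 - (a #2)%:MP * 'X_#1 - (a #3)%:MP * 'X_#0)%R))%type.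
Proof.
move=> /suppv4[h1 h2 h3 h4].
by do !split; rewrite linE !vmulE /ebasis /= h1 h2 h3 h4; ring.
Qed.

Lemma lin_lmul4 a : suppv 4 a -> (
  (lin (vmul a (ebasis F 0)) = ((a #0)%:MP * 'X_#0 + (a #1)%:MP * 'X_#1 + (a #2)%:MP * 'X_#2 + (a #3)%:MP * 'X_#3)%R) *
  (lin (vmul a (ebasis F 1)) = ((a #0)%:MP * 'X_#1 - (a #1)%:MP * 'X_#0 - (a #2)%:MP * 'X_#3 + (a #3)%:MP * 'X_#2)%R) *
  (lin (vmul a (ebasis F 2)) = ((a #0)%:MP * 'X_#2 + (a #1)%:MP * 'X_#3 - (a #2)%:MP * 'X_#0 - (a #3)%:MP * 'X_#1)%R) *
  (lin (vmul a (ebasis F 3)) = ((a #0)%:MP * 'X_#3 - (a #1)%:MP * 'X_#2 + (a #2)%:MP * 'X_#1 - (a #3)%:MP * 'X_#0)%R))%type.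
Proof.
move=> /suppv4[h1 h2 h3 h4].
by do !split; rewrite linE !vmulE /ebasis /= h1 h2 h3 h4; ring.
Qed.

Lemma norm_rmul4 a : suppv 4 a ->
  \sum_(i < 8 | (i < 4)%N) lin (vmul (ebasis F i) a) ^+ 2 = (normv 4 a)%:MP * normX 4.
Proof.
by move=> ha; rewrite normv4E normX4E big_mkcond big_ord8 /= !addr0 !(lin_rmul4 ha); ring.
Qed.

Lemma norm_lmul4 a : suppv 4 a ->
  \sum_(i < 8 | (i < 4)%N) lin (vmul a (ebasis F i)) ^+ 2 = (normv 4 a)%:MP * normX 4.
Proof.
by move=> ha; rewrite normv4E normX4E big_mkcond big_ord8 /= !addr0 !(lin_lmul4 ha); ring.
Qed.

End OctonionProduct.

(** * Symmetric tensors as polynomials *)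

Section SymbolMap.
Variable F : numFieldType.
Local Notation MP := {mpoly F[8]}.
Local Notation ix n := {ffun 'I_n -> 'I_8}.

Definition phi n (x : tens F n) : MP := \sum_I x I *: \prod_p 'X_(I p).

Lemma phiD n (x y : tens F n) : phi (x + y) = phi x + phi y.
Proof. by rewrite /phi -big_split; apply: eq_bigr => I _ /=; rewrite ffunE scalerDl. Qed.
Lemma phi_tsc n c (x : tens F n) : phi (tsc c x) = c *: phi x.
Proof. by rewrite /phi scaler_sumr; apply: eq_bigr => I _ /=; rewrite ffunE scalerA. Qed.
Lemma phi0 n : phi (0 : tens F n) = 0.
Proof. by rewrite /phi big1 // => I _; rewrite ffunE scale0r. Qed.
Lemma phiN n (x : tens F n) : phi (- x) = - phi x.
Proof. by rewrite -tscN1 phi_tsc scaleN1r. Qed.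
Lemma phi_sum n (T : Type) (r : seq T) (P : pred T) (f : T -> tens F n) :
  phi (\sum_(i <- r | P i) f i) = \sum_(i <- r | P i) phi (f i).
Proof. by apply: (big_morph (@phi n)) => [a b|]; rewrite ?phiD ?phi0. Qed.

Lemma lin_ebasis (i : 'I_8) : lin (ebasis F i) = 'X_i :> MP.
Proof.
rewrite /lin (bigD1 i) //= big1 => [|j ne]; rewrite /ebasis ?eqxx ?scale1r ?addr0 //.
by rewrite (negbTE (ne : val j != val i)) scale0r.
Qed.

Lemma phi_pure n (v : 'I_n -> ovec F) : phi (pure v) = \prod_p lin (v p).
Proof.
rewrite /lin bigA_distr_bigA; apply: eq_bigr => I _.
by rewrite scaler_prod ffunE.
Qed.

Lemma phi_tperm n s (x : tens F n) : phi (tperm s x) = phi x.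
Proof.
rewrite [x]tens_tbasis tperm_sum !phi_sum; apply: eq_bigr => I _.
rewrite tperm_tsc !phi_tsc pure_ebasis tperm_pure !phi_pure; congr (_ *: _).
by rewrite [LHS](reindex_inj (@perm_inj _ s)) /=; apply: eq_bigr => p _; rewrite permK.
Qed.

Lemma phi_sym n (x : tens F n) : phi (sym x) = phi x.
Proof.
rewrite /sym phi_tsc phi_sum (eq_bigr (fun=> phi x)) => [|s _]; last exact: phi_tperm.
rewrite sumr_const card_Sn -scaler_nat scalerA mulVf ?scale1r //.
by rewrite pnatr_eq0 -lt0n fact_gt0.
Qed.

Definition pw n (a : ovec F) : tens F n := pure (fun=> a).

(** A power applies the same linear map in every factor, so on symbols it acts by a substitution of
    variables. This is why identities for the central element are tested on powers. *)
Lemma phi_mulr n (x : tens F n) a :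
  phi (tmul x (pw n a)) = phi x \mPo [tuple lin (vmul (ebasis F i) a) | i < 8].
Proof.
rewrite {1}[x]tens_tbasis tmul_suml phi_sum [in RHS]/phi raddf_sum; apply: eq_bigr => I _.
rewrite tmul_tscl phi_tsc pure_ebasis tmul_pure phi_pure /= comp_mpolyZ rmorph_prod.
congr (_ *: _); apply: eq_bigr => p _.
by rewrite /= comp_mpolyXU -tnth_nth tnth_mktuple.
Qed.

Lemma phi_mull n (x : tens F n) a :
  phi (tmul (pw n a) x) = phi x \mPo [tuple lin (vmul a (ebasis F i)) | i < 8].
Proof.
rewrite {1}[x]tens_tbasis tmul_sumr phi_sum [in RHS]/phi raddf_sum; apply: eq_bigr => I _.
rewrite tmul_tscr phi_tsc pure_ebasis tmul_pure phi_pure /= comp_mpolyZ rmorph_prod.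
congr (_ *: _); apply: eq_bigr => p _.
by rewrite /= comp_mpolyXU -tnth_nth tnth_mktuple.
Qed.

Definition tsym n (x : tens F n) := forall s, tperm s x = x.

Lemma multinom_perm n (I J : ix n) :
  (\sum_p U_(I p) = \sum_p U_(J p) :> 'X_{1..8})%MM -> exists s : 'S_n, I = [ffun q => J (s q)].
Proof.
move=> e; have /tuple_permP[s es] : perm_eq [tuple I i | i < n] [tuple J i | i < n].
  have h (K : ix n) i : (count_mem i [tuple K j | j < n] = \sum_p (K p == i))%N.
    rewrite /= !count_map -sum1_count -enumT big_enum_cond big_mkcond /=.
    by apply: eq_bigr => p _; case: (K p == i).
  apply/allP => i _; rewrite /= h h; apply/eqP.
  have := congr1 (fun m : 'X_{1..8} => m i) e; rewrite /= !mnm_sumE.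
  by under eq_bigr do rewrite mnm1E; under [in RHS]eq_bigr do rewrite mnm1E.
exists s; apply/ffunP => q; rewrite ffunE.
have := congr1 (fun t => tnth t q) (val_inj es).
by rewrite !tnth_mktuple.
Qed.

(** A coefficient of [phi x] sums x over one orbit of index functions ([multinom_perm]). For
    symmetric x it is the orbit size times a single value, and the orbit size is invertible in
    characteristic 0. *)
Lemma phi_inj0 n (x : tens F n) : tsym x -> phi x = 0 -> x = 0.
Proof.
move=> sx e; apply/ffunP => I; rewrite ffunE.
have := congr1 (mcoeff (\sum_p U_(I p))%MM) e; rewrite mcoeff0 /phi raddf_sum /=.
rewrite (eq_bigr (fun J : ix n => if (\sum_p U_(J p) == \sum_p U_(I p))%MM then x I else 0)).
  rewrite -big_mkcond sumr_const => /eqP; rewrite mulrn_eq0 => /orP[/eqP c0|/eqP //].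
  have : I \in [pred J : ix n | (\sum_p U_(J p) == \sum_p U_(I p))%MM] by rewrite inE.
  by move: c0 => /card0_eq ->.
move=> J _; rewrite mcoeffZ.
rewrite -(big_morph (fun m => 'X_[m] : MP) (@mpolyXD 8 F) (mpolyX0 8 F)) mcoeffX.
case: eqP => [/multinom_perm[s ->]|_]; rewrite ?mulr0 // mulr1.
by rewrite -[in RHS](sx s) tpermE.
Qed.

Lemma phi_inj n (x y : tens F n) : tsym x -> tsym y -> phi x = phi y -> x = y.
Proof.
move=> sx sy e; apply/eqP; rewrite -subr_eq0; apply/eqP/phi_inj0.
  by move=> s; rewrite tpermD -tscN1 tperm_tsc sx sy.
by rewrite phiD phiN e subrr.
Qed.

End SymbolMap.

Section SymmetricTensors.
Variable F : numFieldType.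
Local Notation MP := {mpoly F[8]}.
Local Notation ix n := {ffun 'I_n -> 'I_8}.

Definition supp d n (x : tens F n) := forall (I : ix n) p, (d <= I p)%N -> x I = 0.
(** Sym^n H for d = 4 and Sym^n O for d = 8. *)
Definition Sd d n (x : tens F n) := tsym x /\ supp d x.

Lemma symH_Sd n (x : tens F n) : symH x <-> Sd 4 x.
Proof.
split=> -[sx hx]; split=> // I.
  by move=> p hp; apply/eqP; apply/negPn/negP => /hx/(_ p); rewrite ltnNge hp.
by move=> nz p; rewrite ltnNge; apply/negP => /hx e; rewrite e eqxx in nz.
Qed.

Lemma sym_id n (x : tens F n) : tsym x -> sym x = x.
Proof.
move=> sx; rewrite /sym (eq_bigr (fun=> x)) => [|s _]; last exact: sx.
rewrite sumr_const card_Sn; apply/ffunP => I; rewrite ffunE ffunMnE -[x I *+ _]mulr_natl mulrA.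
by rewrite mulVf ?mul1r // pnatr_eq0 -lt0n fact_gt0.
Qed.

Section Closure.
Variables (d n : nat).
Implicit Types x y : tens F n.

Lemma Sd0 : Sd d (0 : tens F n).
Proof. by split=> [s|I p _]; rewrite ?tperm0 ?ffunE. Qed.
Lemma SdD x y : Sd d x -> Sd d y -> Sd d (x + y).
Proof.
move=> [sx hx] [sy hy]; split=> [s|I p h]; first by rewrite tpermD sx sy.
by rewrite ffunE (hx _ _ h) (hy _ _ h) addr0.
Qed.
Lemma SdZ c x : Sd d x -> Sd d (tsc c x).
Proof.
move=> [sx hx]; split=> [s|I p h]; first by rewrite tperm_tsc sx.
by rewrite ffunE (hx _ _ h) mulr0.
Qed.
Lemma SdN x : Sd d x -> Sd d (- x).
Proof. by rewrite -tscN1; apply: SdZ. Qed.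
Lemma Sd_sum (T : Type) (r : seq T) (P : pred T) (f : T -> tens F n) :
  (forall i, P i -> Sd d (f i)) -> Sd d (\sum_(i <- r | P i) f i).
Proof. by move=> h; elim/big_rec: _ => [|i x Pi]; [apply: Sd0 | apply/SdD/h]. Qed.

Lemma supp_sym x : supp d x -> Sd d (sym x).
Proof.
move=> hx; split=> [s|I p h].
  rewrite /sym tperm_tsc tperm_sum; congr (tsc _ _).
  rewrite [RHS](reindex_inj (mulIg s)) /=.
  by apply: eq_bigr => s' _; rewrite tperm_comp.
rewrite ffunE sum_ffunE big1 ?mulr0 // => s _.
by rewrite ffunE (hx _ (s^-1%g p)) // ffunE permKV.
Qed.

Lemma pw_Sd a : suppv d a -> Sd d (pw n a).
Proof.
move=> ha; split=> [s|I p h]; first by rewrite /pw tperm_pure.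
by rewrite ffunE (bigD1 p) //= ha // mul0r.
Qed.

End Closure.

Lemma Sd_mono d d' n (x : tens F n) : (d <= d')%N -> Sd d x -> Sd d' x.
Proof. by move=> le [sx hx]; split=> // I p h; apply: (hx _ p); apply: leq_trans h. Qed.

Lemma suppv_ebasis d i : (i < d)%N -> suppv d (ebasis F i).
Proof. by move=> h k dk; rewrite /ebasis; case: eqP => // e; move: dk; rewrite e leqNgt h. Qed.

Lemma gam_vmul i j k : gam F i j k = vmul (ebasis F i) (ebasis F j) k.
Proof.
rewrite /vmul (bigD1 i) //= [X in _ + X]big1 => [|i' ne].
  rewrite (bigD1 j) //= big1 => [|j' ne]; last by rewrite /ebasis (negbTE (ne : val j' != j)) mulr0 mul0r.
  by rewrite /ebasis !eqxx !mul1r !addr0.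
by rewrite big1 // => j' _; rewrite /ebasis (negbTE (ne : val i' != i)) !mul0r.
Qed.

Lemma tsym_tmul n (x y : tens F n) : tsym x -> tsym y -> tsym (tmul x y).
Proof. by move=> sx sy s; rewrite tperm_tmul sx sy. Qed.

Lemma suppv_vmul d a b : d = 4%N \/ d = 8%N -> suppv d a -> suppv d b -> suppv d (@vmul F a b).
Proof. by case=> ->; [apply: suppv4_vmul | move=> _ _; apply: suppv8]. Qed.

Lemma Sd_tmul d n (x y : tens F n) : d = 4%N \/ d = 8%N -> Sd d x -> Sd d y -> Sd d (tmul x y).
Proof.
move=> hd [sx hx] [sy hy]; split=> [|K p hK]; first exact: tsym_tmul.
rewrite ffunE big1 // => I _; rewrite big1 // => J _.
case: (leqP d (I p)) => hI; first by rewrite (hx _ _ hI) !mul0r.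
case: (leqP d (J p)) => hJ; first by rewrite (hy _ _ hJ) mulr0 mul0r.
rewrite (bigD1 p) //= gam_vmul (suppv_vmul hd) ?mul0r ?mulr0 //; exact: suppv_ebasis.
Qed.

Lemma tmul_pw n a b : tmul (pw n a) (pw n b) = pw n (@vmul F a b).
Proof. by rewrite /pw tmul_pure. Qed.

Lemma eq_pw n a b : a =1 b -> pw n a = pw n b :> tens F n.
Proof. by move=> e; apply: eq_pure => p. Qed.

Lemma btens_vec (a : ovec F) (s : seq 'I_8) :
  btens (nseq (size s) (vblk a)) s = \prod_(i <- s) a i.
Proof. by elim: s => [|i s ih]; rewrite ?big_nil // big_cons -ih /= drop0. Qed.

Lemma tens_of_pw n (a : ovec F) : tens_of n (nseq n (vblk a)) = pw n a.
Proof.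
apply/ffunP => I; rewrite !ffunE.
transitivity (\prod_(i <- [seq I i | i <- enum 'I_n]) a i); last by rewrite big_map big_enum.
by rewrite -btens_vec size_map size_enum_ord.
Qed.

Lemma toneE n : tone F n = pw n (ebasis F 0).
Proof. exact: tens_of_pw. Qed.

(** Inclusion-exclusion. Expanding the powers gives a sum over all maps f from positions to
    positions; the product of the factors 1 - [p not in codom f] retains the bijective f, and its
    expansion over subsets S supplies the signs. *)
Lemma polarization n (v : 'I_n -> ovec F) :
  \sum_s tperm s (pure v) =
  \sum_(S : {set 'I_n}) tsc (\prod_p (if p \in S then 1 else -1))
     (pw n (fun k => \sum_(p in S) v p k)).
Proof.
apply/ffunP => J; rewrite !sum_ffunE.
transitivity (\sum_(f : {ffun 'I_n -> 'I_n})
   (\prod_p (1 - (p \notin codom f)%:R)) * \prod_q v (f q) (J q)).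
  rewrite (bigID (fun f : {ffun 'I_n -> 'I_n} => injectiveb f)) /= [X in _ = _ + X]big1; last first.
    move=> f /injectivePn[x [y ne e]].
    have [p hp] : exists p, p \notin codom f.
      apply/existsP; apply: contraT; rewrite negb_exists => /forallP h.
      have u : uniq (codom f).
        apply/card_uniqP; rewrite size_codom; apply: eq_card => p.
        by have := h p; rewrite negbK inE => ->.
      have /injectiveP fi : injectiveb f by exact: u.
      by rewrite (fi _ _ e) eqxx in ne.
    by rewrite (bigD1 p) //= hp subrr !mul0r.
  rewrite addr0 (reindex_onto (fun s : 'S_n => pval s) (fun f => insubd (1%g : 'S_n) f)) /=; last first.
    by move=> f hf; rewrite val_insubd hf.
  rewrite (reindex_inj invg_inj) /=; apply: eq_big => [s|s _].
    by rewrite (valP s) valKd eqxx.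
  rewrite tperm_pure ffunE invgK [X in _ = X * _]big1 ?mul1r.
    by apply: eq_bigr => q _; rewrite pvalE.
  move=> p _; suff -> : p \in codom (pval s) by rewrite subr0.
  by apply/codomP; exists (s^-1%g p); rewrite pvalE permKV.
transitivity (\sum_(S : {set 'I_n}) \sum_(f : {ffun 'I_n -> 'I_n})
   (\prod_p (if p \in S then 1 else - (p \notin codom f)%:R)) * \prod_q v (f q) (J q)).
  rewrite exchange_big; apply: eq_bigr => f _; rewrite -mulr_suml; congr (_ * _).
  by rewrite bigA_distr; apply: eq_bigl => S.
apply: eq_bigr => S _; rewrite !ffunE.
under [X in _ = _ * X]eq_bigr do rewrite big_mkcond.
rewrite bigA_distr_bigA mulr_sumr; apply: eq_bigr => f _.
case: (boolP [forall q, f q \in S]) => [/forallP h|].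
  congr (_ * _); apply: eq_bigr => p _; last by rewrite h.
  case: ifP => // pS; case: (boolP (p \in codom f)) => // /codomP[q e].
  by rewrite e h in pS.
rewrite negb_forall => /existsP[q hq].
rewrite (bigD1 (f q)) //= (negbTE hq) codom_f oppr0 !mul0r.
by rewrite [X in _ = _ * X](bigD1 q) //= (negbTE hq) mul0r mulr0.
Qed.

(* Polarization: x_1 ... x_n is an alternating sum of powers of sums of the x_i. *)
Lemma Sd_ind d n (P : tens F n -> Prop) :
  P 0 -> (forall x y, P x -> P y -> P (x + y)) -> (forall c x, P x -> P (tsc c x)) ->
  (forall a, suppv d a -> P (pw n a)) -> forall x, Sd d x -> P x.
Proof.
move=> P0 PD PZ Pw x [sx hx]; rewrite -(sym_id sx) {1}[x]tens_tbasis /sym.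
under eq_bigr do rewrite tperm_sum.
rewrite exchange_big; apply: (PZ); elim/big_rec: _ => [|I y _ Py] //; apply: (PD) => //.
under eq_bigr do rewrite tperm_tsc.
rewrite -tsc_sumr; case: (eqVneq (x I) 0) => [->|nz]; first by rewrite tsc0.
apply: (PZ); rewrite pure_ebasis polarization.
elim/big_rec: _ => [|S z _ Pz] //; apply: (PD) => //; apply: (PZ); apply: Pw => k dk.
rewrite big1 // => p _; apply: suppv_ebasis dk.
by rewrite ltnNge; apply: contra nz => h; rewrite (hx _ _ h).
Qed.

End SymmetricTensors.

(** * Tensors assembled from blocks and their symbols *)

Section Blocks.
Variable F : numFieldType.
Local Notation MP := {mpoly F[8]}.
Local Notation ix n := {ffun 'I_n -> 'I_8}.

(** [tens_of] reads its indices as one list. Summing over lists of length r by recursion lets the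
    sum split along concatenation, hence along the blocks ([sumseq_cat]). *)
Fixpoint sumseq (V : nmodType) r (G : seq 'I_8 -> V) : V :=
  if r is r'.+1 then \sum_i sumseq r' (fun s => G (i :: s)) else G [::].

Lemma eq_sumseq (V : nmodType) r (G H : seq 'I_8 -> V) :
  (forall s, size s = r -> G s = H s) -> sumseq r G = sumseq r H.
Proof.
elim: r G H => [|r ih] G H e /=; first exact: e.
by apply: eq_bigr => i _; apply: ih => s es; rewrite e //= es.
Qed.

Lemma sumseq_cat (V : nmodType) r r' (G : seq 'I_8 -> V) :
  sumseq (r + r') G = sumseq r (fun s => sumseq r' (fun s' => G (s ++ s'))).
Proof. by elim: r G => [|r ih] G //=; apply: eq_bigr => i _; rewrite ih. Qed.

Lemma sum_ffun_seq (V : nmodType) n (G : seq 'I_8 -> V) :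
  \sum_(I : ix n) G [seq I i | i <- enum 'I_n] = sumseq n G.
Proof.
elim: n G => [|n ih] G.
  have e (I : ix 0) : G [seq I i | i <- enum 'I_0] = G [::] by rewrite -enum0 (eq_enum (_ : 'I_0 =i pred0)) ?enum0 // => -[].
  by under eq_bigr do rewrite e; rewrite sumr_const card_ffun !card_ord expn0.
rewrite /= -(eq_bigr _ (fun i _ => ih (fun s => G (i :: s)))) pair_big /=.
pose mk (q : 'I_8 * ix n) : ix n.+1 := [ffun p => if unlift ord0 p is Some p' then q.2 p' else q.1].
rewrite (reindex mk) /=; last first.
  exists (fun I : ix n.+1 => (I ord0, [ffun p => I (lift ord0 p)])) => [[i I] _|I _] /=.
    by congr (_, _); rewrite ?ffunE ?unlift_none //; apply/ffunP => p; rewrite !ffunE liftK.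
  by apply/ffunP => p; rewrite ffunE; case: unliftP => [p' ->|->]; rewrite ?ffunE.
apply: eq_bigr => -[i I] _; congr G; rewrite enum_ordSl /= ffunE unlift_none; congr (_ :: _).
by rewrite -map_comp; apply: eq_map => p /=; rewrite ffunE liftK.
Qed.

Definition phib (b : blk F) : MP := sumseq b.1 (fun s => b.2 s *: \prod_(i <- s) 'X_i).

Lemma phi_seq n (x : tens F n) (f : seq 'I_8 -> F) :
  (forall I, x I = f [seq I i | i <- enum 'I_n]) ->
  phi x = sumseq n (fun s => f s *: \prod_(i <- s) 'X_i).
Proof.
move=> e; rewrite -sum_ffun_seq; apply: eq_bigr => I _.
by rewrite e big_map big_enum.
Qed.

Lemma sumseqM r (G : seq 'I_8 -> MP) (h : MP) :
  sumseq r (fun s => G s * h) = sumseq r G * h.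
Proof. by elim: r G => [|r ih] G //=; rewrite mulr_suml; apply: eq_bigr => i _; rewrite ih. Qed.
Lemma sumseqMl r (G : seq 'I_8 -> MP) (h : MP) :
  sumseq r (fun s => h * G s) = h * sumseq r G.
Proof. by elim: r G => [|r ih] G //=; rewrite mulr_sumr; apply: eq_bigr => i _; rewrite ih. Qed.

Lemma phi_tens_of n (bs : seq (blk F)) :
  sumn [seq b.1 | b <- bs] = n -> phi (tens_of n bs) = \prod_(b <- bs) phib b.
Proof.
move=> <-; rewrite (@phi_seq _ _ (btens bs)) => [|I]; last by rewrite ffunE.
elim: bs => [|b bs ih]; first by rewrite big_nil /= scale1r big_nil.
rewrite big_cons /= sumseq_cat -ih -sumseqM; apply: eq_sumseq => s es.
rewrite -sumseqMl; apply: eq_sumseq => s' _.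
by rewrite -es take_size_cat // drop_size_cat // big_cat /= -scalerAl -scalerAr scalerA mulrC.
Qed.

Lemma phib_vblk a : phib (vblk a) = lin a.
Proof. by rewrite /phib /=; apply: eq_bigr => i _; rewrite big_seq1. Qed.

Lemma phib_blk_of r (x : tens F r) : phib (blk_of x) = phi x.
Proof.
rewrite (@phi_seq _ x (fun s => x [ffun i : 'I_r => nth ord0 s i])) // => I.
congr (x _); apply/ffunP => i; rewrite ffunE (nth_map i) ?size_enum_ord //.
by rewrite nth_ord_enum.
Qed.

Lemma phi_pw n a : phi (pw n a) = lin a ^+ n :> MP.
Proof. by rewrite phi_pure prodr_const card_ord. Qed.

Lemma phi_tone n : phi (tone F n) = 'X_ord0 ^+ n.
Proof. by rewrite toneE phi_pw (lin_ebasis F ord0). Qed.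

Lemma phi_tbasis2 i : phi (tbasis F [ffun _ : 'I_2 => i]) = 'X_i ^+ 2.
Proof.
rewrite pure_ebasis phi_pure (eq_bigr (fun=> 'X_i)) => [|p _]; last by rewrite ffunE lin_ebasis.
by rewrite prodr_const card_ord.
Qed.

Lemma phi_tri d : phi (tri F d) = d%:R^-1 *: normX F d.
Proof.
by rewrite phi_tsc phi_sum; congr (_ *: _); apply: eq_bigr => i _; rewrite phi_tbasis2.
Qed.

Lemma phi_triN n d : (1 < n)%N ->
  phi (triN F n d) = d%:R^-1 *: (normX F d * 'X_ord0 ^+ (n - 2)).
Proof.
move=> n1; rewrite /triN phi_sym phi_tens_of; last first.
  by rewrite /= map_nseq sumn_nseq mul1n subnKC.
rewrite big_cons phib_blk_of phi_tri big_nseq phib_vblk (lin_ebasis F ord0) -scalerAl.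
by congr (_ *: (_ * _)); elim: (n - 2)%N => // k ih; rewrite exprS -ih.
Qed.

Definition bsupp d (b : blk F) :=
  forall s : seq 'I_8, size s = b.1 -> has (fun i => d <= val i)%N s -> b.2 s = 0.
Fixpoint bsupps d (bs : seq (blk F)) :=
  if bs is b :: bs' then bsupp d b /\ bsupps d bs' else True.

Lemma bsupps_cat d bs bs' : bsupps d bs -> bsupps d bs' -> bsupps d (bs ++ bs').
Proof. by elim: bs => //= b bs ih [hb /ih h] /h. Qed.
Lemma bsupps_nseq d k b : bsupp d b -> bsupps d (nseq k b).
Proof. by move=> hb; elim: k. Qed.

Lemma supp_tens_of d n (bs : seq (blk F)) :
  sumn [seq b.1 | b <- bs] = n -> bsupps d bs -> supp d (tens_of n bs).
Proof.
move=> en hb I p hp; rewrite ffunE.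
have : has (fun i => d <= val i)%N [seq I i | i <- enum 'I_n].
  by rewrite has_map; apply/hasP; exists p; rewrite ?mem_enum.
have : size [seq I i | i <- enum 'I_n] = sumn [seq b.1 | b <- bs].
  by rewrite size_map size_enum_ord en.
elim: bs {en I p hp} hb [seq I i | i <- _] => [_ [|//]|b bs ih [hb hbs] s] //= es.
rewrite -{1}(cat_take_drop b.1 s) has_cat => /orP[hs|hs].
  by rewrite hb ?mul0r // size_takel // es leq_addr.
by rewrite ih ?mulr0 // size_drop es addKn.
Qed.

Lemma bsupp_vblk d (a : ovec F) : suppv d a -> bsupp d (vblk a).
Proof. by move=> ha [|i [|? ?]] //= _; rewrite orbF => /ha. Qed.

Lemma bsupp_blk_of d r (x : tens F r) : supp d x -> bsupp d (blk_of x).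
Proof.
move=> hx s es /(has_nthP ord0)[i hi di]; rewrite /= in es *.
by rewrite -es in x hx *; apply: (hx _ (Ordinal hi)); rewrite ffunE.
Qed.

Lemma supp_tbasis2 d (i : 'I_8) : (i < d)%N -> supp d (tbasis F [ffun _ : 'I_2 => i]).
Proof.
move=> hi I p hp; rewrite ffunE; case: eqP => // e.
by move: hp; rewrite e ffunE leqNgt hi.
Qed.

Lemma supp_tri d : supp d (tri F d).
Proof.
move=> I p hp; rewrite ffunE sum_ffunE big1 ?mulr0 // => i hi.
exact: (supp_tbasis2 hi hp).
Qed.

Lemma Sd_triN n d : (1 < n)%N -> (0 < d)%N -> Sd d (triN F n d).
Proof.
move=> n1 d0; apply/supp_sym/supp_tens_of.
  by rewrite /= map_nseq sumn_nseq mul1n subnKC.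
split; first exact/bsupp_blk_of/supp_tri.
exact/bsupps_nseq/bsupp_vblk/suppv_ebasis.
Qed.

End Blocks.

(** * Elements that commute and associate with everything *)

Section Nuclear.
Variable F : numFieldType.
Variables (d n : nat) (hd : d = 4%N \/ d = 8%N).
Local Notation MP := {mpoly F[8]}.
Implicit Types x y z : tens F n.

Lemma norm_rmul (a : ovec F) : suppv d a ->
  \sum_(i < 8 | (i < d)%N) lin (vmul (ebasis F i) a) ^+ 2 = (normv d a)%:MP * normX F d.
Proof. by case: hd => -> ha; [apply: norm_rmul4 | apply: norm_rmul8]. Qed.
Lemma norm_lmul (a : ovec F) : suppv d a ->
  \sum_(i < 8 | (i < d)%N) lin (vmul a (ebasis F i)) ^+ 2 = (normv d a)%:MP * normX F d.
Proof. by case: hd => -> ha; [apply: norm_lmul4 | apply: norm_lmul8]. Qed.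
Lemma normvM (a b : ovec F) : suppv d a -> suppv d b ->
  normv d (vmul a b) = normv d a * normv d b.
Proof. by case: hd => -> ha hb; [apply: normv4M | apply: normv8M]. Qed.

Lemma eq_lin (a b : ovec F) : a =1 b -> lin a = lin b.
Proof. by move=> e; apply: eq_bigr => i _; rewrite e. Qed.

Definition rsub (b : ovec F) (f : MP) : MP := f \mPo [tuple lin (vmul (ebasis F i) b) | i < 8].
Definition lsub (a : ovec F) (f : MP) : MP := f \mPo [tuple lin (vmul a (ebasis F i)) | i < 8].

Lemma lin_rsub (a b : ovec F) : rsub b (lin a) = lin (vmul a b).
Proof. by have := phi_mulr (pw 1 a) b; rewrite tmul_pw !phi_pw !expr1. Qed.
Lemma lin_lsub (a b : ovec F) : lsub a (lin b) = lin (vmul a b).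
Proof. by have := phi_mull (pw 1 b) a; rewrite tmul_pw !phi_pw !expr1. Qed.

Lemma normX_rsub (a : ovec F) : suppv d a -> rsub a (normX F d) = (normv d a)%:MP * normX F d.
Proof.
move=> ha; rewrite -norm_rmul // /rsub raddf_sum; apply: eq_bigr => i _ /=.
by rewrite rmorphXn /= comp_mpolyXU -tnth_nth tnth_mktuple.
Qed.
Lemma normX_lsub (a : ovec F) : suppv d a -> lsub a (normX F d) = (normv d a)%:MP * normX F d.
Proof.
move=> ha; rewrite -norm_lmul // /lsub raddf_sum; apply: eq_bigr => i _ /=.
by rewrite rmorphXn /= comp_mpolyXU -tnth_nth tnth_mktuple.
Qed.

Lemma rsub_term a c e (f g : MP) k :
  rsub a (c *: (e%:MP * f * g ^+ k)) = c *: (e%:MP * rsub a f * rsub a g ^+ k).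
Proof. by rewrite /rsub comp_mpolyZ 2!rmorphM rmorphXn /= comp_mpolyC. Qed.
Lemma lsub_term a c e (f g : MP) k :
  lsub a (c *: (e%:MP * f * g ^+ k)) = c *: (e%:MP * lsub a f * lsub a g ^+ k).
Proof. by rewrite /lsub comp_mpolyZ 2!rmorphM rmorphXn /= comp_mpolyC. Qed.

Lemma phi_triN_pw a : (1 < n)%N -> suppv d a ->
  phi (tmul (triN F n d) (pw n a)) =
  d%:R^-1 *: ((normv d a)%:MP * normX F d * lin a ^+ (n - 2)).
Proof.
move=> n1 ha; rewrite phi_mulr -/(rsub a _) (phi_triN _ _ n1).
have -> : normX F d * 'X_ord0 ^+ (n - 2) = 1%:MP * normX F d * lin (ebasis F 0) ^+ (n - 2).
  by rewrite mul1r (lin_ebasis F ord0).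
rewrite rsub_term (normX_rsub ha) lin_rsub mul1r.
by rewrite (eq_lin (vmul_e0l a)).
Qed.

(** Taking y to be the unit in the second equation gives commutation ([nuclear_comm]), so these two
    equations allow z to be moved to any place in a product of two factors. *)
Definition nuclear z := Sd d z /\
  (forall x y, Sd d x -> Sd d y ->
    tmul z (tmul x y) = tmul (tmul z x) y /\ tmul z (tmul x y) = tmul x (tmul z y)).

Lemma nuclear_of_pw z : Sd d z ->
  (forall a b, suppv d a -> suppv d b ->
    tmul z (tmul (pw n a) (pw n b)) = tmul (tmul z (pw n a)) (pw n b) /\
    tmul z (tmul (pw n a) (pw n b)) = tmul (pw n a) (tmul z (pw n b))) ->
  nuclear z.
Proof.
move=> sz h; split=> // x y sx; move: x sx y.
apply: Sd_ind => [y _|x x' hx hx' y sy|c x hx y sy|a ha].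
- by rewrite !(tmul0r, tmulr0).
- by have [e1 e2] := hx y sy; have [e3 e4] := hx' y sy; rewrite !(tmulDl, tmulDr) e1 e3 -e2 -e4 e1 e3.
- by have [e1 e2] := hx y sy; rewrite !(tmul_tscl, tmul_tscr) -e2 e1.
apply: Sd_ind => [|y y' [e1 e2] [e3 e4]|c y [e1 e2]|b hb].
- by rewrite !(tmul0r, tmulr0).
- by rewrite !(tmulDl, tmulDr) e1 e3 -e2 -e4 e1 e3.
- by rewrite !(tmul_tscl, tmul_tscr) -e2 e1.
exact: h.
Qed.

(** On powers of a and b all three products have the symbol |a|^2 |b|^2 N (ab)^(n-2) / d: by
    multiplicativity of the norm in one case, by the similitude property of left or right
    multiplication in the others. *)
Lemma nuclear_triN : (1 < n)%N -> nuclear (triN F n d).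
Proof.
move=> n1; have d0 : (0 < d)%N by case: hd => ->.
have st := Sd_triN F n1 d0; apply: nuclear_of_pw => // a b ha hb.
have sT z : Sd d z -> tsym z by case.
have hab := suppv_vmul hd ha hb.
have pa := pw_Sd n ha; have pb := pw_Sd n hb; have pab := pw_Sd n hab.
have ta := Sd_tmul hd st pa; have tb := Sd_tmul hd st pb.
rewrite tmul_pw; split; apply: phi_inj; try by apply: sT; apply: Sd_tmul.
  rewrite (phi_mulr (tmul _ _)) -/(rsub b _) (phi_triN_pw n1 hab) (phi_triN_pw n1 ha) rsub_term (normX_rsub hb) lin_rsub.
  by rewrite (normvM ha hb) mpolyCM !mulrA.
rewrite (phi_mull (tmul _ _)) -/(lsub a _) (phi_triN_pw n1 hab) (phi_triN_pw n1 hb) lsub_term (normX_lsub ha) lin_lsub.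
by rewrite (normvM ha hb) mpolyCM !mulrA [(normv d b)%:MP * _]mulrC.
Qed.

Lemma tmul_tonel x : tmul (tone F n) x = x.
Proof.
rewrite [x]tens_tbasis tmul_sumr; apply: eq_bigr => I _; rewrite tmul_tscr pure_ebasis.
by rewrite toneE /pw tmul_pure; congr (tsc _ _); apply: eq_pure => p; apply: vmul_e0l.
Qed.
Lemma tmul_toner x : tmul x (tone F n) = x.
Proof.
rewrite [x]tens_tbasis tmul_suml; apply: eq_bigr => I _; rewrite tmul_tscl pure_ebasis.
by rewrite toneE /pw tmul_pure; congr (tsc _ _); apply: eq_pure => p; apply: vmul_e0r.
Qed.

Lemma Sd_tone : Sd d (tone F n).
Proof. by rewrite toneE; apply/pw_Sd/suppv_ebasis; case: hd => ->. Qed.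

Lemma nuclear_tone : nuclear (tone F n).
Proof. by split=> [|x y _ _]; [apply: Sd_tone | rewrite !tmul_tonel]. Qed.
Lemma nuclear0 : nuclear 0.
Proof. by split=> [|x y _ _]; [apply: Sd0 | rewrite !(tmul0r, tmulr0)]. Qed.
Lemma nuclearD z z' : nuclear z -> nuclear z' -> nuclear (z + z').
Proof.
move=> [sz hz] [sz' hz']; split=> [|x y sx sy]; first exact: SdD.
have [e1 e2] := hz x y sx sy; have [e3 e4] := hz' x y sx sy.
by rewrite !(tmulDl, tmulDr) e1 e3 -e2 -e4 e1 e3.
Qed.
Lemma nuclearZ c z : nuclear z -> nuclear (tsc c z).
Proof.
move=> [sz hz]; split=> [|x y sx sy]; first exact: SdZ.
by have [e1 e2] := hz x y sx sy; rewrite !(tmul_tscl, tmul_tscr) -e2 e1.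
Qed.
Lemma nuclear_comm z x : nuclear z -> Sd d x -> tmul z x = tmul x z.
Proof.
move=> [sz hz] sx; have [_] := hz _ _ sx Sd_tone.
by rewrite !tmul_toner.
Qed.
Lemma nuclearM z z' : nuclear z -> nuclear z' -> nuclear (tmul z z').
Proof.
move=> [sz hz] [sz' hz']; split=> [|x y sx sy]; first exact: Sd_tmul.
have S2 (u v : tens F n) : Sd d u -> Sd d v -> Sd d (tmul u v) := Sd_tmul hd (y := v).
rewrite -(hz _ _ sz' (S2 _ _ sx sy)).1 (hz' _ _ sx sy).1.
rewrite (hz _ _ (S2 _ _ sz' sx) sy).1 (hz _ _ sz' sx).1; split=> //.
rewrite -(hz _ _ sz' sx).1 -(hz _ _ (S2 _ _ sz' sx) sy).1 -(hz' _ _ sx sy).1.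
by rewrite (hz' _ _ sx sy).2 (hz _ _ sx (S2 _ _ sz' sy)).2 (hz _ _ sz' sy).1.
Qed.

End Nuclear.

(** * Polynomials in a linear operator *)

Section PolynomialOfOperator.
Variables (F : fieldType) (V : lmodType F) (D : {linear V -> V}).
Implicit Types (p q : {poly F}) (u v : V).

(** The value p(D) v on a module of arbitrary dimension; D will be the normalized N * Delta on the
    whole polynomial ring. *)
Definition evp (p : {poly F}) (v : V) : V := \sum_(i < size p) p`_i *: iter i D v.

Lemma evp_wide k (p : {poly F}) v : (size p <= k)%N -> evp p v = \sum_(i < k) p`_i *: iter i D v.
Proof.
move=> le; rewrite /evp (big_ord_widen k (fun i => p`_i *: iter i D v)) //.
rewrite big_mkcond; apply: eq_bigr => i _; case: ltnP => // h.
by rewrite nth_default // scale0r.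
Qed.

Lemma evpD p q v : evp (p + q) v = evp p v + evp q v.
Proof.
set k := maxn (size p) (size q).
rewrite !(@evp_wide k) ?leq_maxl ?leq_maxr ?size_polyD // -big_split.
by apply: eq_bigr => i _; rewrite coefD scalerDl.
Qed.
Lemma evpZ c p v : evp (c *: p) v = c *: evp p v.
Proof.
rewrite (@evp_wide (size p)) ?size_scale_leq // scaler_sumr.
by apply: eq_bigr => i _; rewrite coefZ scalerA.
Qed.
Lemma evp0 v : evp 0 v = 0.
Proof. by rewrite /evp size_poly0 big_ord0. Qed.
Lemma evpC c v : evp c%:P v = c *: v.
Proof. by rewrite (@evp_wide 1) ?size_polyC_leq1 // big_ord1 coefC. Qed.
Lemma evpMX p v : evp (p * 'X) v = evp p (D v).
Proof.
rewrite (@evp_wide (size p).+1); last first.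
  by have [->|nz] := eqVneq p 0; rewrite ?mul0r ?size_poly0 // size_mulX.
rewrite big_ord_recl coefMX /= scale0r add0r; apply: eq_bigr => i _.
by rewrite coefMX /= -iterSr.
Qed.
Lemma evp_sum (T : Type) (r : seq T) (P : pred T) (f : T -> {poly F}) v :
  evp (\sum_(i <- r | P i) f i) v = \sum_(i <- r | P i) evp (f i) v.
Proof. by apply: (big_morph (evp^~ v)) => [p q|]; rewrite ?evpD ?evp0. Qed.
Lemma evp_op p v : evp p (D v) = D (evp p v).
Proof.
rewrite /evp linear_sum; apply: eq_bigr => i _.
by rewrite -iterSr linearZ.
Qed.
Lemma evp_linear p c u v : evp p (c *: u + v) = c *: evp p u + evp p v.
Proof.
have itl i : iter i D (c *: u + v) = c *: iter i D u + iter i D v.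
  by elim: i => //= i ->; rewrite linearP.
rewrite /evp scaler_sumr -big_split; apply: eq_bigr => i _ /=.
by rewrite itl scalerDr !scalerA mulrC.
Qed.
Lemma evpM p q v : evp (p * q) v = evp p (evp q v).
Proof.
elim/poly_ind: p v => [|p c ih] v; first by rewrite mul0r !evp0.
by rewrite mulrDl evpD mulrAC evpMX ih mul_polyC evpZ evpD evpMX evpC evp_op.
Qed.
Lemma evpXsubC c v : evp ('X - c%:P) v = D v - c *: v.
Proof. by rewrite -polyCN -['X]mul1r evpD evpMX !evpC scale1r scaleNr. Qed.
Lemma evp_r0 p : evp p 0 = 0.
Proof. by have := evp_linear p (-1) 0 0; rewrite !scaleN1r oppr0 addr0 addNr. Qed.
Lemma evp_scale p c v : evp p (c *: v) = c *: evp p v.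
Proof. by have := evp_linear p c v 0; rewrite evp_r0 !addr0. Qed.
Lemma evp_eigen p c v : D v = c *: v -> evp p v = p.[c] *: v.
Proof.
move=> e; elim/poly_ind: p => [|p a ih]; first by rewrite evp0 horner0 scale0r.
by rewrite evpD evpMX e evpC evp_scale ih scalerA hornerMXaddC scalerDl mulrC.
Qed.

End PolynomialOfOperator.

(** * The central element as N * Delta, and its idempotents *)

Section Laplacian.
Variable F : numFieldType.
Local Notation MP := {mpoly F[8]}.
Implicit Types f g : MP.

Definition lap d f : MP := \sum_(i < 8 | (i < d)%N) f^`M(i)^`M(i).
Definition grad d f g : MP := \sum_(i < 8 | (i < d)%N) f^`M(i) * g^`M(i).
Definition eul d f : MP := \sum_(i < 8 | (i < d)%N) 'X_i * f^`M(i).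

Lemma lap_is_linear d : linear (lap d).
Proof.
move=> c f g; rewrite /lap scaler_sumr -big_split.
by apply: eq_bigr => i _ /=; rewrite !mderivD !mderivZ.
Qed.
HB.instance Definition _ d := GRing.isLinear.Build F MP MP *:%R (lap d) (lap_is_linear d).
Lemma eul_is_linear d : linear (eul d).
Proof.
move=> c f g; rewrite /eul scaler_sumr -big_split.
by apply: eq_bigr => i _ /=; rewrite mderivD mderivZ mulrDr -scalerAr.
Qed.
HB.instance Definition _ d := GRing.isLinear.Build F MP MP *:%R (eul d) (eul_is_linear d).

Lemma lapM d f g : lap d (f * g) = f * lap d g + lap d f * g + grad d f g *+ 2.
Proof.
rewrite /lap /grad mulr_suml mulr_sumr -sumrMnl -!big_split.
apply: eq_bigr => i _ /=; rewrite !mderivM !mderivD !mderivM mulr2n.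
set a := f^`M(i)^`M(i); set b := g^`M(i)^`M(i); set c := f^`M(i); set e := g^`M(i).
ring.
Qed.

Lemma mderivXU (i j : 'I_8) : ('X_j : MP)^`M(i) = (i == j)%:R.
Proof.
rewrite mderivX mnm1E eq_sym; case: eqP => [->|_]; last by rewrite scale0r.
by rewrite (_ : U_(j) - U_(j) = 0)%MM ?mpolyX0 ?scale1r //; apply/mnmP => k; rewrite mnmBE mnm0E subnn.
Qed.

Lemma mderivXn i f k : (f ^+ k)^`M(i) = k%:R *: (f ^+ k.-1 * f^`M(i)).
Proof.
elim: k => [|k ih]; first by rewrite expr0 -mpolyC1 mderivC scale0r.
rewrite exprS mderivM ih -scalerAr mulrA /=; case: k {ih} => [|k].
  by rewrite scale0r addr0 expr0 mul1r mulr1 scale1r.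
by rewrite -exprS [in RHS]mulrS [1 + _]addrC scalerDl scale1r addrC mulrC.
Qed.

Lemma mderiv_lin i a : (lin a : MP)^`M(i) = (a i)%:MP.
Proof.
rewrite /lin raddf_sum (bigD1 i) //= mderivZ mderivXU eqxx big1 ?addr0.
  by rewrite -mul_mpolyC mulr1.
by move=> j ne; rewrite mderivZ mderivXU eq_sym (negbTE ne) scaler0.
Qed.

Lemma mderiv_normX d (i : 'I_8) : (i < d)%N -> (normX F d)^`M(i) = 2%:R *: 'X_i.
Proof.
move=> hi; rewrite /normX raddf_sum (bigD1 i) //= mderivXn mderivXU eqxx mulr1 big1 ?addr0 //.
by move=> j /andP[_ ne]; rewrite mderivXn mderivXU eq_sym (negbTE ne) mulr0 scaler0.
Qed.

Lemma lap_normX d : (d <= 8)%N -> lap d (normX F d) = (2 * d)%N%:R%:MP.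
Proof.
move=> hd; rewrite /lap (eq_bigr (fun=> 2%:R%:MP)) => [|i hi]; last first.
  by rewrite mderiv_normX // mderivZ mderivXU eqxx -mul_mpolyC mulr1.
rewrite sumr_const -mpolyCMn -mulrnA; congr (_ %:R%:MP); congr (_ * _)%N.
by rewrite -sum1_card (big_ord_narrow hd) sum1_card card_ord.
Qed.

Lemma grad_normX d f : grad d (normX F d) f = 2%:R *: eul d f.
Proof.
rewrite /grad /eul scaler_sumr; apply: eq_bigr => i hi.
by rewrite mderiv_normX // scalerAl.
Qed.

Lemma lap_normXM d f : (d <= 8)%N ->
  lap d (normX F d * f) = normX F d * lap d f + (2 * d)%N%:R *: f + 4%:R *: eul d f.
Proof.
move=> hd; rewrite lapM lap_normX // grad_normX mul_mpolyC -scaler_nat scalerA.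
by rewrite -natrM.
Qed.

Lemma mderiv_eul d (i : 'I_8) f : (i < d)%N -> (eul d f)^`M(i) = f^`M(i) + eul d f^`M(i).
Proof.
move=> hi; rewrite /eul raddf_sum (bigD1 i) //= [in RHS](bigD1 i) //= mderivM mderivXU eqxx mul1r.
rewrite -!addrA; congr (_ + (_ + _)); apply: eq_bigr => j /andP[_ ne].
by rewrite mderivM mderivXU eq_sym (negbTE ne) mul0r add0r mderiv_comm.
Qed.

Lemma eul_lap d f : lap d (eul d f) = eul d (lap d f) + 2%:R *: lap d f.
Proof.
rewrite /lap (raddf_sum (eul d)) scaler_sumr -big_split; apply: eq_bigr => i hi /=.
rewrite mderiv_eul // mderivD mderiv_eul //.
by rewrite addrA addrC scaler_nat mulr2n.
Qed.

Lemma eul_normXM d f : eul d (normX F d * f) = normX F d * (2%:R *: f + eul d f).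
Proof.
rewrite mulrDr /eul mulr_sumr [normX F d * (2%:R *: f)]mulrC /normX mulr_sumr -big_split.
apply: eq_bigr => i hi /=; rewrite -/(normX F d) mderivM mderiv_normX //.
rewrite -!mul_mpolyC; ring.
Qed.

Lemma lap_linX d a k :
  lap d (lin a ^+ k) = (k * k.-1)%N%:R * normv d a *: lin a ^+ (k - 2).
Proof.
rewrite /lap /normv mulr_sumr scaler_suml; apply: eq_bigr => i _.
rewrite mderivXn mderivZ mderivM mderivXn mderiv_lin mderivC mulr0 addr0.
rewrite (_ : k - 2 = k.-1.-1)%N; last by case: k => [|[|k]] //; rewrite subn2.
rewrite natrM -!mul_mpolyC !mpolyCM; ring.
Qed.

Lemma eul_linX d a k : suppv d a -> eul d (lin a ^+ k) = k%:R *: (lin a ^+ k : MP).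
Proof.
move=> ha; case: k => [|k].
  by rewrite expr0 scale0r /eul big1 // => i _; rewrite -mpolyC1 mderivC mulr0.
rewrite [in RHS]exprSr [X in _ = _ *: (_ * X)]/lin mulr_sumr scaler_sumr [in RHS](bigID (fun i : 'I_8 => (i < d)%N)) /=.
rewrite [X in _ = _ + X]big1 ?addr0 => [|i]; last first.
  by rewrite -leqNgt => /ha ->; rewrite scale0r mulr0 scaler0.
apply: eq_bigr => i _; rewrite mderivXn mderiv_lin /= -!mul_mpolyC; ring.
Qed.

Lemma iter_lap_linX d a k j :
  iter j (lap d) (lin a ^+ k) = (k ^_ (2 * j))%:R * normv d a ^+ j *: lin a ^+ (k - 2 * j).
Proof.
elim: j => [|j ih] /=; first by rewrite muln0 ffactn0 expr0 mulr1 scale1r subn0.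
rewrite ih linearZ /= lap_linX scalerA mulnS addnC -subnDA; congr (_ *: _).
rewrite addn2 !ffactnSr !natrM exprSr; case: (leqP (2 * j) k) => h; last first.
  by rewrite ffact_small // !mul0r.
have -> : (k - 2 * j).-1 = (k - (2 * j).+1)%N by rewrite -subn1 -subnDA addn1.
ring.
Qed.

End Laplacian.

Section HarmonicIdempotents.
Variables (F : numFieldType) (d n : nat).
Hypotheses (hd : d = 4%N \/ d = 8%N) (n0 : (0 < n)%N).
Local Notation MP := {mpoly F[8]}.
Implicit Types (f g : MP) (x y : tens F n).

Let d8 : (d <= 8)%N. Proof. by case: hd => ->. Qed.
Let d2 : (2 <= d)%N. Proof. by case: hd => ->. Qed.

Definition opc : F := (d * n * (n - 1))%N%:R^-1.
Definition opD f : MP := opc *: (normX F d * lap d f).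
Lemma opD_is_linear : linear opD.
Proof. by move=> c f g; rewrite /opD linearP mulrDr scalerDr -scalerAr !scalerA mulrC. Qed.
HB.instance Definition _ := GRing.isLinear.Build F MP MP *:%R opD opD_is_linear.

Lemma opDZ c f : opD (c *: f) = c *: opD f.
Proof. by rewrite /opD [lap d _]linearZ /= -scalerAr !scalerA mulrC. Qed.

(** The eigenvalue of N * Delta on N^a h with h harmonic of degree n - 2a. *)
Definition kap (a : nat) : F := 2 * a%:R * (2 * (n%:R - a%:R) + d%:R - 2).

Lemma beta_kap a : (a <= n)%N -> beta F n d (n - a) = opc * kap a.
Proof.
move=> an; rewrite /beta /opc mulrC subKn //; congr (_ * _).
rewrite -addnBA // natrM natrD !natrM !natrB // /kap; ring.
Qed.

(** [kap] is quadratic in a with vertex (2n + d - 2)/4 > n/2, hence injective on a <= n/2. *)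
Lemma beta_inj a b : (1 < n)%N -> (a.*2 <= n)%N -> (b.*2 <= n)%N -> a != b ->
  beta F n d (n - a) != beta F n d (n - b).
Proof.
move=> n1 ha hb ne; rewrite !beta_kap; try lia.
have nzc : opc != 0.
  by rewrite invr_eq0 pnatr_eq0 !muln_eq0 !negb_or -!lt0n subn_gt0 n1 n0 (leq_trans _ d2).
rewrite (inj_eq (mulfI nzc)) -subr_eq0.
have -> : kap a - kap b = 2 * (a%:R - b%:R) * ((n - a - b).*2 + (d - 2))%N%:R.
  rewrite natrD -mul2n natrM !natrB; try lia.
  by rewrite /kap; ring.
rewrite !mulf_neq0 ?pnatr_eq0 //; first by rewrite subr_eq0 eqr_nat.
by apply/eqP; case: hd; lia.
Qed.

Definition hom f := eul d f = n%:R *: f.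

Lemma phi_hom x : Sd d x -> hom (phi x).
Proof.
move: x; apply: Sd_ind => [|x y hx hy|c x hx|a ha].
- by rewrite /hom phi0 raddf0 scaler0.
- by rewrite /hom phiD raddfD /= hx hy scalerDr.
- by rewrite /hom phi_tsc linearZ /= hx !scalerA mulrC.
by rewrite /hom phi_pw eul_linX.
Qed.

Lemma hom_lap a f : hom f -> eul d (iter a (lap d) f) = (n%:R - 2 * a%:R) *: iter a (lap d) f.
Proof.
move=> hf; elim: a => [|a ih] /=; first by rewrite mulr0 subr0.
have := eul_lap d (iter a (lap d) f); rewrite ih linearZ /= => /esym/eqP.
rewrite eq_sym -subr_eq => /eqP <-; rewrite -scalerBl; congr (_ *: _).
by rewrite -natr1; ring.
Qed.

Lemma hom_opD f : hom f -> hom (opD f).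
Proof.
move=> hf; rewrite /hom /opD linearZ /= eul_normXM (hom_lap 1 hf) -scalerDl -scalerAr !scalerA.
by congr (_ *: _); ring.
Qed.

Lemma hom_sub c f : hom f -> hom (opD f - c *: f).
Proof.
move=> hf; rewrite /hom -scaleNr raddfD /= (hom_opD hf) [eul d (- c *: f)]linearZ /= hf scalerDr.
by congr (_ + _); rewrite !scalerA mulrC.
Qed.

(** Seen through the a-th power of [lap] and modulo the norm form, [opD] is multiplication by the
    scalar [beta (n - a)]. This is what replaces the decomposition into harmonic components. *)
Lemma lap_opD a f : hom f ->
  iter a (lap d) (opD f) =
  opc *: (normX F d * iter a.+1 (lap d) f) + (opc * kap a) *: iter a (lap d) f.
Proof.
move=> hf; elim: a => [|a ih]; first by rewrite /kap mulr0 !mul0r mulr0 scale0r addr0.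
rewrite iterS ih linearD !linearZ /= lap_normXM // -iterS (hom_lap a.+1 hf).
rewrite !scalerDr !scalerA -!addrA -!scalerDl; congr (_ + _ *: _).
by rewrite /kap -natr1 natrM; ring.
Qed.

Lemma iter_lap0 a b f : (a <= b)%N -> iter a (lap d) f = 0 -> iter b (lap d) f = 0.
Proof.
move=> ab e; rewrite -(subnK ab) iterD e.
by elim: (b - a)%N => //= k ->; rewrite raddf0.
Qed.

Lemma phi_lap0 x : Sd d x -> iter (n./2).+1 (lap d) (phi x) = 0.
Proof.
have itl k c f g : iter k (lap d) (c *: f + g) = c *: iter k (lap d) f + iter k (lap d) g.
  by elim: k => //= k ->; rewrite linearP.
have it0 k : iter k (lap d) 0 = 0 by elim: k => //= k ->; rewrite raddf0.
move: x; apply: Sd_ind => [|x y hx hy|c x hx|a ha].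
- by rewrite phi0 it0.
- by rewrite phiD -[phi x]scale1r itl hx hy scaler0 addr0.
- by rewrite phi_tsc -[_ *: _]addr0 itl hx it0 scaler0 addr0.
by rewrite phi_pw iter_lap_linX ffact_small ?mul0r ?scale0r //; lia.
Qed.

Definition topP s : {poly F} := \prod_(n.+1 - s <= m < n.+1) ('X - (beta F n d m)%:P).

(** The hypothesis says that f involves only components N^a h with a < s, that is, labels above n -
    s. In the induction from s to s+1, applying the factor with label n - s leaves a polynomial
    already killed by the s-th power of [lap], by [lap_opD]. *)
Lemma evp_topP s f : (s <= n.+1)%N -> hom f -> iter s (lap d) f = 0 -> evp opD (topP s) f = 0.
Proof.
elim: s f => [|s ih] f hs hf e.
  by rewrite /= in e; rewrite e evp_r0.
rewrite /topP subSS big_ltn 1?ltnS ?leq_subr // mulrC evpM evpXsubC.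
rewrite -subSn // -/(topP s); apply: ih; [exact: ltnW | exact: hom_sub |].
have itl k c g h : iter k (lap d) (g - c *: h) = iter k (lap d) g - c *: iter k (lap d) h.
  by elim: k => //= k ->; rewrite raddfB /= linearZ.
by rewrite itl lap_opD // e mulr0 scaler0 add0r beta_kap // subrr.
Qed.

Definition lagr m : {poly F} :=
  \prod_(uphalf n <= m' < n.+1 | m' != m)
     ((beta F n d m - beta F n d m')^-1 *: ('X - (beta F n d m')%:P)).

Lemma lagrE m : exists c, lagr m =
  c *: \prod_(uphalf n <= m' < n.+1 | m' != m) ('X - (beta F n d m')%:P).
Proof. by rewrite /lagr scaler_prod; eexists. Qed.

(** For m <= n - s every factor of [topP s] occurs in [lagr m]. *)
Lemma evp_lagr_kill m s f : (m + s <= n)%N -> (s <= n./2.+1)%N -> hom f ->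
  iter s (lap d) f = 0 -> evp opD (lagr m) f = 0.
Proof.
move=> ms sn hf e; have [c ->] := lagrE m; rewrite evpZ.
have h1 : (uphalf n <= n.+1 - s)%N by lia.
have tp : \prod_(n.+1 - s <= i < n.+1 | i != m) ('X - (beta F n d i)%:P) = topP s.
  rewrite big_nat_cond [RHS]big_nat; apply: eq_bigl => i.
  by case: (eqVneq i m) => [->|_]; rewrite ?andbT ?andbF //; apply/esym/negbTE; lia.
rewrite (big_cat_nat h1) ?leq_subr //= evpM tp evp_topP //; last by lia.
by rewrite evp_r0 scaler0.
Qed.

Lemma lagr_eigen m f : (uphalf n <= m <= n)%N -> hom f -> iter (n./2).+1 (lap d) f = 0 ->
  opD (evp opD (lagr m) f) = beta F n d m *: evp opD (lagr m) f.
Proof.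
move=> /andP[um mn] hf e; apply/eqP; rewrite -subr_eq0 -evpXsubC -evpM.
have [c ->] := lagrE m; rewrite -scalerAr evpZ.
have hm : m \in index_iota (uphalf n) n.+1 by rewrite mem_index_iota um ltnS.
(* The factor for m, absent from [lagr m], completes the product to [topP (n./2).+1], which
   annihilates f. *)
rewrite -(bigD1_seq m hm (iota_uniq _ _)) /=.
have -> : uphalf n = (n.+1 - (n./2).+1)%N by lia.
by rewrite -/(topP _) evp_topP ?scaler0 //; lia.
Qed.

Lemma betaP m m' : (uphalf n <= m <= n)%N -> (uphalf n <= m' <= n)%N -> m != m' ->
  beta F n d m != beta F n d m'.
Proof.
move=> h h' ne; rewrite -(@subKn m n) -1?(@subKn m' n); try lia.
apply: beta_inj; lia.
Qed.

Lemma lagr_root m m' : (uphalf n <= m' <= n)%N -> m' != m -> (lagr m).[beta F n d m'] = 0.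
Proof.
move=> /andP[um mn] ne; rewrite /lagr.
rewrite -big_filter (bigD1_seq m') ?mem_filter ?filter_uniq ?iota_uniq ?mem_index_iota ?ne ?um //=.
by rewrite hornerM hornerZ hornerXsubC subrr mulr0 mul0r.
Qed.

Lemma lagr_self m : (uphalf n <= m <= n)%N -> (lagr m).[beta F n d m] = 1.
Proof.
move=> hm; rewrite /lagr horner_prod big_nat_cond big1 // => m' /andP[hm' ne].
by rewrite hornerZ hornerXsubC mulVf // subr_eq0 betaP // 1?eq_sym.
Qed.

Lemma sum_lagr : \sum_(uphalf n <= m < n.+1) lagr m = 1.
Proof.
apply/eqP; rewrite -subr_eq0; apply/eqP.
set rs := [seq beta F n d m | m <- index_iota (uphalf n) n.+1].
have szr : size rs = (n.+1 - uphalf n)%N by rewrite size_map size_iota.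
(* The difference has degree smaller than the number of nodes and vanishes at each of them. *)
apply: (@roots_geq_poly_eq0 _ _ rs).
- apply/allP => _ /mapP[m hm ->]; rewrite mem_index_iota in hm.
  rewrite /root hornerD hornerN hornerC horner_sum (bigD1_seq m) ?mem_index_iota ?iota_uniq //=.
  rewrite lagr_self // big_nat_cond big1 ?addr0 ?subrr // => m' /andP[_ ne].
  by rewrite lagr_root // eq_sym.
- rewrite map_inj_in_uniq ?iota_uniq // => m m'; rewrite !mem_index_iota => hm hm' e.
  by apply: contraTeq (erefl true) => ne; have := betaP hm hm' ne; rewrite e eqxx.
rewrite szr; apply: (leq_trans (size_polyD _ _)); rewrite geq_max size_polyN size_poly1.
apply/andP; split; last by lia.
apply: (leq_trans (size_sum _ _ _)); apply/bigmax_leqP_seq => m hm _.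
rewrite mem_index_iota in hm.
have [c ->] := lagrE m; apply: (leq_trans (size_scale_leq _ _)).
rewrite -big_filter size_prod_XsubC size_filter.
have := count_predC (pred1 m) (index_iota (uphalf n) n.+1).
by rewrite size_iota count_uniq_mem ?iota_uniq // mem_index_iota hm add1n => <-.
Qed.

(** Iterated [lap_opD]. The cofactor g is not controlled: the lemma is applied after a
    specialization at which the norm form vanishes. With p = [lagr m] and a = n - m the scalar is
    1. *)
Lemma lap_evp p f a : (a <= n)%N -> hom f -> exists g,
  iter a (lap d) (evp opD p f) =
  p.[beta F n d (n - a)] *: iter a (lap d) f + normX F d * g.
Proof.
move=> an; elim/poly_ind: p f => [|p c ih] f hf.
  exists 0; rewrite evp0 horner0 scale0r mulr0 addr0.
  by elim: a {an} => //= a ->; rewrite raddf0.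
have itl k g h : iter k (lap d) (g + c *: h) = iter k (lap d) g + c *: iter k (lap d) h.
  by elim: k => //= k ->; rewrite raddfD /= linearZ.
have [g eg] := ih _ (hom_opD hf).
exists (p.[beta F n d (n - a)] * opc *: iter a.+1 (lap d) f + g).
rewrite evpD evpMX evpC itl eg lap_opD // -beta_kap // hornerMXaddC scalerDr !scalerA.
rewrite -!mul_mpolyC mpolyCD; ring.
Qed.

(** For n = 1 the constant [opc] is the inverse of 0, that is 0, so the value 0 keeps [phi_tN] valid
    there. *)
Definition tN : tens F n := if (n <= 1)%N then 0 else triN F n d.

Lemma nuclear_tN : nuclear d tN.
Proof. by rewrite /tN; case: leqP => h; [apply: nuclear0 | apply: nuclear_triN]. Qed.

(** On a power a^n both sides are multiples of |a|^2 N a^(n-2): the Laplacian contributes n(n-1),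
    which [opc] cancels down to the 1/d of [triN]. *)
Lemma phi_tN x : Sd d x -> phi (tmul tN x) = opD (phi x).
Proof.
move: x; apply: Sd_ind => [|x y hx hy|c x hx|a ha].
- by rewrite tmulr0 phi0 raddf0.
- by rewrite tmulDr !phiD hx hy raddfD.
- by rewrite (tmul_tscr c tN x) !phi_tsc hx opDZ.
rewrite /tN; case: leqP => h.
  by rewrite tmul0r phi0 /opD /opc (_ : n - 1 = 0)%N ?muln0 ?invr0 ?scale0r //; lia.
rewrite phi_triN_pw // /opD phi_pw lap_linX.
have nz : (n * n.-1)%N%:R != 0 :> F by rewrite pnatr_eq0 muln_eq0 negb_or -!lt0n n0; lia.
have -> : d%:R^-1 = opc * (n * n.-1)%N%:R by rewrite /opc -mulnA natrM subn1 invfM mulfVK.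
rewrite -!mul_mpolyC !mpolyCM; ring.
Qed.

Lemma eidemE m : (uphalf n <= m <= n)%N -> eidem F n d m =
  foldr (fun m' acc => tmul acc
          (tsc (beta F n d m - beta F n d m')^-1 (tN - tsc (beta F n d m') (tone F n))))
        (tone F n) [seq m' <- index_iota (uphalf n) n.+1 | m' != m].
Proof.
move=> hm; rewrite /eidem /tN /index_iota subSn; last by lia.
case: leqP => // h.
have [-> ->] : n = 1 /\ m = 1 by lia.
by [].
Qed.

(** Both halves go through one induction on the list of factors, since nuclearity of the partial
    product is what lets the next factor act on x first. *)
Lemma eidem_spec m : (uphalf n <= m <= n)%N ->
  nuclear d (eidem F n d m) /\
  (forall x, Sd d x -> phi (tmul (eidem F n d m) x) = evp opD (lagr m) (phi x)).
Proof.
move=> hm; rewrite eidemE // /lagr -big_filter.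
elim: [seq m' <- _ | _] => [|m' L [ih1 ih2]] /=.
  split=> [|x _]; first exact: nuclear_tone.
  by rewrite tmul_tonel big_nil -polyC1 evpC scale1r.
set u := tsc _ _; have nu : nuclear d u.
  apply/nuclearZ/nuclearD; first exact: nuclear_tN.
  by rewrite -tscN1; do 2!apply: nuclearZ; apply: nuclear_tone.
split=> [|x sx]; first exact: nuclearM.
rewrite -(ih1.2 _ _ nu.1 sx).1 ih2; last by apply: Sd_tmul; case: nu.
rewrite big_cons mulrC evpM evpZ evpXsubC /u tmul_tscl tmulDl tmulNl tmul_tscl tmul_tonel.
by rewrite phi_tsc phiD phiN phi_tsc phi_tN.
Qed.

Lemma eidem_nuclear m : (uphalf n <= m <= n)%N -> nuclear d (eidem F n d m).
Proof. by case/eidem_spec. Qed.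

Lemma phi_eidemM m x : (uphalf n <= m <= n)%N -> Sd d x ->
  phi (tmul (eidem F n d m) x) = evp opD (lagr m) (phi x).
Proof. by move=> hm; have [_] := eidem_spec hm; apply. Qed.

Lemma eidemM m m' : (uphalf n <= m <= n)%N -> (uphalf n <= m' <= n)%N ->
  tmul (eidem F n d m) (eidem F n d m') = if m == m' then eidem F n d m else 0.
Proof.
move=> hm hm'; have [s1 _] := eidem_nuclear hm; have [s2 _] := eidem_nuclear hm'.
have so := Sd_tone F n hd.
have e (k : nat) : (uphalf n <= k <= n)%N ->
    phi (eidem F n d k) = evp opD (lagr k) (phi (tone F n)).
  by move=> hk; rewrite -phi_eidemM // tmul_toner.
have sT z : Sd d z -> tsym z by case.
apply: phi_inj; first exact/sT/Sd_tmul.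
  by case: ifP => _ //; apply: sT => //; apply: Sd0.
(* The symbol of the second idempotent is an eigenvector for [beta m'], and there [lagr m] takes the
   value 1 or 0. *)
rewrite phi_eidemM // e // (evp_eigen _ (lagr_eigen hm' (phi_hom so) (phi_lap0 so))).
case: eqP => [->|/eqP ne]; first by rewrite lagr_self // scale1r e.
by rewrite lagr_root // 1?eq_sym // scale0r phi0.
Qed.

Lemma sum_eidem : \sum_(uphalf n <= m < n.+1) eidem F n d m = tone F n.
Proof.
have so := Sd_tone F n hd.
rewrite big_nat; apply: phi_inj; first by case: (@Sd_sum F d n _ (index_iota (uphalf n) n.+1) (fun m => (uphalf n <= m < n.+1)%N) (eidem F n d)) => // m hm; case: (eidem_nuclear hm).
  by case: so.
rewrite phi_sum (eq_bigr (fun m => evp opD (lagr m) (phi (tone F n)))) => [|m hm].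
  by rewrite -big_nat -evp_sum sum_lagr -polyC1 evpC scale1r.
by rewrite -phi_eidemM // tmul_toner.
Qed.

End HarmonicIdempotents.

(** Descending induction: once lap^(b+1) f = 0, [lap_opD] gives [beta l] and [beta (n - b)] the same
    effect on lap^b f, which therefore vanishes as long as b > n - l. *)
Lemma eigen_lap0 (F : numFieldType) d n (hd : d = 4%N \/ d = 8%N) (n0 : (0 < n)%N) l (f : {mpoly F[8]}) :
  (uphalf n <= l <= n)%N -> hom d n f -> opD d n f = beta F n d l *: f ->
  iter (n./2).+1 (lap d) f = 0 -> iter (n - l).+1 (lap d) f = 0.
Proof.
move=> hl hf ef e0.
suff h a : (a <= n./2 - (n - l))%N -> iter (n./2 - a).+1 (lap d) f = 0.
  by have := h _ (leqnn _); rewrite subKn //; lia.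
elim: a => [|a ih] ha; first by rewrite subn0.
have {}ih := ih (ltnW ha).
have -> : (n./2 - a.+1).+1 = (n./2 - a)%N by lia.
set b := (n./2 - a)%N in ih *.
have := lap_opD hd b hf; rewrite ih mulr0 scaler0 add0r -beta_kap //; last by lia.
have itl k c g : iter k (lap d) (c *: g) = c *: iter k (lap d) g :> {mpoly F[8]}.
  by elim: k => //= k ->; rewrite linearZ.
rewrite ef itl => /eqP; rewrite -subr_eq0 -scalerBl scaler_eq0 subr_eq0 => /orP[|/eqP //].
by rewrite (negbTE (betaP _ hd _ _ _ _)) //; lia.
Qed.

(** * Weight idempotents *)

Section MatrixUnits.
Variables (F : numFieldType) (ii : F).
Hypothesis ii2 : ii * ii = -1.
Local Notation MP := {mpoly F[8]}.
Local Notation "# i" := (@Ordinal 8 i isT) (at level 0, i at level 0, format "# i").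

(* With a = va and a^c = vc, vu is a e_2 and vw is a^c e_2: up to scalars [fv] lists the four
   matrix units of H, and [isl], [isr] say which of them a fixes from the left and the right. *)
Definition va : ovec F := fun k =>
  if val k == 0%N then 2%:R^-1 else if val k == 1%N then 2%:R^-1 * ii else 0.
Definition vc : ovec F := fun k =>
  if val k == 0%N then 2%:R^-1 else if val k == 1%N then - (2%:R^-1 * ii) else 0.
Definition vu : ovec F := fun k =>
  if val k == 2%N then 2%:R^-1 else if val k == 3%N then 2%:R^-1 * ii else 0.
Definition vw : ovec F := fun k =>
  if val k == 2%N then 2%:R^-1 else if val k == 3%N then - (2%:R^-1 * ii) else 0.
Definition fv (i : 'I_4) : ovec F := nth va [:: va; vc; vu; vw] i.
Definition isl (i : 'I_4) := (val i == 0%N) || (val i == 2%N).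
Definition isr (i : 'I_4) := (val i == 0%N) || (val i == 3%N).

Lemma forall_ord4 (P : 'I_4 -> Prop) :
  P (@Ordinal 4 0 isT) -> P (@Ordinal 4 1 isT) -> P (@Ordinal 4 2 isT) ->
  P (@Ordinal 4 3 isT) -> forall i, P i.
Proof.
move=> h0 h1 h2 h3 [i hi].
by do 4?[case: i hi => [|i] hi; first by rewrite (bool_irrelevance hi isT)].
Qed.

Lemma big_ord4 (V : nmodType) (f : 'I_4 -> V) :
  \sum_i f i = f (@Ordinal 4 0 isT) + f (@Ordinal 4 1 isT)
             + f (@Ordinal 4 2 isT) + f (@Ordinal 4 3 isT).
Proof.
rewrite !big_ord_recl big_ord0 addr0 !addrA.
by do ![congr (_ + _)]; congr f; apply/val_inj.
Qed.

Lemma supp_fv i : suppv 4 (fv i).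
Proof. by move: i; apply: forall_ord4; apply: forall_ord8. Qed.
Lemma supp_va : suppv 4 va. Proof. exact: (supp_fv (@Ordinal 4 0 isT)). Qed.
Lemma supp_vc : suppv 4 vc. Proof. exact: (supp_fv (@Ordinal 4 1 isT)). Qed.
Lemma supp_e2 : suppv 4 (ebasis F 2). Proof. exact: suppv_ebasis. Qed.

Ltac munit := rewrite ?(mulr0, mul0r, mulNr, mulrN, opprK, subr0, sub0r, addr0, add0r, oppr0)
  ?[_ * ii * (_ * ii)]mulrACA ?ii2; try by field.

Lemma vmul_va i : vmul va (fv i) =1 (if isl i then fv i else fun=> 0).
Proof.
move: i; apply: forall_ord4; apply: forall_ord8; rewrite (vmul4E supp_va (supp_fv _)) /fv /= /va /vc /vu /vw /=; munit.
Qed.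
Lemma vmul_vc i : vmul vc (fv i) =1 (if isl i then fun=> 0 else fv i).
Proof.
move: i; apply: forall_ord4; apply: forall_ord8; rewrite (vmul4E supp_vc (supp_fv _)) /fv /= /va /vc /vu /vw /=; munit.
Qed.
Lemma vmulr_va i : vmul (fv i) va =1 (if isr i then fv i else fun=> 0).
Proof.
move: i; apply: forall_ord4; apply: forall_ord8; rewrite (vmul4E (supp_fv _) supp_va) /fv /= /va /vc /vu /vw /=; munit.
Qed.
Lemma vmulr_vc i : vmul (fv i) vc =1 (if isr i then fun=> 0 else fv i).
Proof.
move: i; apply: forall_ord4; apply: forall_ord8; rewrite (vmul4E (supp_fv _) supp_vc) /fv /= /va /vc /vu /vw /=; munit.
Qed.
Lemma vmul_e2va : vmul (ebasis F 2) va =1 vmul vc (ebasis F 2).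
Proof.
by apply: forall_ord8; rewrite (vmul4E supp_e2 supp_va) (vmul4E supp_vc supp_e2) /ebasis /va /vc /=; ring.
Qed.
Lemma vmul_e2vc : vmul (ebasis F 2) vc =1 vmul va (ebasis F 2).
Proof.
by apply: forall_ord8; rewrite (vmul4E supp_e2 supp_vc) (vmul4E supp_va supp_e2) /ebasis /va /vc /=; ring.
Qed.
Lemma vmul_e2e2 : vmul (ebasis F 2) (ebasis F 2) =1 fun k => - ebasis F 0 k.
Proof.
by apply: forall_ord8; rewrite (vmul4E supp_e2 supp_e2) /ebasis /=; ring.
Qed.

Definition Mx (i : 'I_8) (g : 'I_4) : F :=
  nth 0 (nth [::] [:: [:: 1; 1; 0; 0]; [:: - ii; ii; 0; 0]; [:: 0; 0; 1; 1]; [:: 0; 0; - ii; ii]] i) g.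

Lemma ebasis_fv (i : 'I_8) : (i < 4)%N -> ebasis F i =1 fun k => \sum_g Mx i g * fv g k.
Proof.
move: i; apply: forall_ord8 => // _; apply: forall_ord8;
  rewrite big_ord4 /ebasis /Mx /fv /va /vc /vu /vw /= ?(mulNr, mulrN, opprK) ?[ii * (_ * ii)]mulrCA ?ii2; by field.
Qed.

Definition dotv (a b : ovec F) : F := \sum_(i < 8 | (i < 4)%N) a i * b i.

Lemma grad_lin (a b : ovec F) p q :
  grad 4 (lin a ^+ p) (lin b ^+ q) = (p * q)%N%:R * dotv a b *: (lin a ^+ p.-1 * lin b ^+ q.-1).
Proof.
rewrite /grad /dotv mulr_sumr scaler_suml; apply: eq_bigr => i _.
by rewrite !mderivXn !mderiv_lin natrM -!mul_mpolyC !mpolyCM; ring.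
Qed.

Lemma gradMr (f g h : MP) : grad 4 f (g * h) = g * grad 4 f h + grad 4 f g * h.
Proof.
rewrite /grad mulr_sumr mulr_suml -big_split; apply: eq_bigr => i _ /=.
by rewrite mderivM; ring.
Qed.
Lemma gradC (f g : MP) : grad 4 f g = grad 4 g f.
Proof. by apply: eq_bigr => i _; rewrite mulrC. Qed.

Lemma dotvE a b : dotv a b = a #0 * b #0 + a #1 * b #1 + a #2 * b #2 + a #3 * b #3.
Proof. by rewrite /dotv big_mkcond big_ord8 /= !addr0. Qed.

Let PA := lin va. Let PC := lin vc. Let PU := lin vu. Let PW := lin vw.

(** Both vectors are isotropic, so only the cross term of the Laplacian survives; the value 1/2
    absorbs its factor 2. *)
Lemma lap_pair (a b : ovec F) p q : normv 4 a = 0 -> normv 4 b = 0 -> dotv a b = 2^-1 ->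
  lap 4 (lin a ^+ p * lin b ^+ q) = (p * q)%N%:R *: (lin a ^+ p.-1 * lin b ^+ q.-1).
Proof.
move=> na nb ab; rewrite lapM !lap_linX na nb !mulr0 !scale0r mulr0 mul0r !add0r grad_lin ab.
by rewrite -scaler_nat scalerA mulrC mulrAC -mulrA; congr (_ *: _); field.
Qed.

Lemma norm_va : normv 4 va = 0.
Proof. by rewrite normv4E /va /= !expr2; munit. Qed.
Lemma norm_vc : normv 4 vc = 0.
Proof. by rewrite normv4E /vc /= !expr2; munit. Qed.
Lemma norm_vu : normv 4 vu = 0.
Proof. by rewrite normv4E /vu /= !expr2; munit. Qed.
Lemma norm_vw : normv 4 vw = 0.
Proof. by rewrite normv4E /vw /= !expr2; munit. Qed.
Lemma dot_vac : dotv va vc = 2^-1.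
Proof. by rewrite dotvE /va /vc /=; munit. Qed.
Lemma dot_vuw : dotv vu vw = 2^-1.
Proof. by rewrite dotvE /vu /vw /=; munit. Qed.

(** The norm form splits into two orthogonal hyperbolic planes, as the determinant of 2 x 2 matrices
    does. *)
Lemma normX4_units : normX F 4 = 4%:R *: (PA * PC + PU * PW).
Proof.
rewrite normX4E /PA /PC /PU /PW !linE /va /vc /vu /vw /=.
rewrite -mul_mpolyC !mpolyC0 !mul0r !addr0 !add0r mpolyCN mpolyCM.
have e1 : ii%:MP * ii%:MP = -1 :> MP by rewrite -mpolyCM ii2 mpolyCN.
have e2 : 2^-1%:MP * 2%:MP = 1 :> MP by rewrite -mpolyCM mulVf // pnatr_eq0.
set h := (2^-1)%:MP in e2 *; set j := ii%:MP in e1 *.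
transitivity ((h * 2%:MP) ^+ 2 * ('X_#0 ^+ 2 - j * j * 'X_#1 ^+ 2 + ('X_#2 ^+ 2 - j * j * 'X_#3 ^+ 2))).
  by rewrite e2 e1; ring.
have -> : 4%:R%:MP = 2%:MP * 2%:MP :> MP by rewrite -mpolyCM -natrM.
ring.
Qed.

Definition ymon p q s : MP := PA ^+ p * PC ^+ q * (PU ^+ s * PW ^+ s).

Lemma lap_ymon p q s :
  lap 4 (ymon p q s) = (p * q)%N%:R *: ymon p.-1 q.-1 s + (s * s)%N%:R *: ymon p q s.-1.
Proof.
rewrite /ymon lapM (lap_pair _ _ norm_va norm_vc dot_vac) (lap_pair _ _ norm_vu norm_vw dot_vuw).
have -> : grad 4 (PA ^+ p * PC ^+ q) (PU ^+ s * PW ^+ s) = 0.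
  rewrite gradMr ![grad 4 (_ * _) _]gradC !gradMr !grad_lin !dotvE /va /vc /vu /vw /=.
  by rewrite !(mulr0, mul0r, addr0, scale0r).
by rewrite mul0rn addr0 addrC -scalerAl -scalerAr.
Qed.

Lemma iter_lap_AC p q j :
  iter j (lap 4) (PA ^+ p * PC ^+ q) = (p ^_ j * q ^_ j)%N%:R *: (PA ^+ (p - j) * PC ^+ (q - j)).
Proof.
elim: j => [|j ih] /=; first by rewrite !ffactn0 scale1r !subn0.
rewrite ih linearZ /= (lap_pair _ _ norm_va norm_vc dot_vac) scalerA -natrM !ffactnSr -!subnS mulnACA.
by [].
Qed.

End MatrixUnits.

Section WeightIdempotents.
Variables (F : numFieldType) (ii : F) (n : nat).
Hypotheses (ii2 : ii * ii = -1) (n0 : (0 < n)%N).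
Local Notation MP := {mpoly F[8]}.
Local Notation va := (va ii). Local Notation vc := (vc ii).
Local Notation PA := (lin va). Local Notation PC := (lin vc).
Implicit Types (x y : tens F n) (k l : nat).
Let h4 : 4%N = 4%N \/ 4%N = 8%N. Proof. by left. Qed.
Let h8 : 8%N = 4%N \/ 8%N = 8%N. Proof. by right. Qed.
Let sT d x : Sd d x -> tsym x. Proof. by case. Qed.

Lemma pure0 (v : 'I_n -> ovec F) p : v p =1 (fun=> 0) -> pure v = 0.
Proof. by move=> e; apply/ffunP => I; rewrite !ffunE (bigD1 p) //= e mul0r. Qed.

Definition bk k : tens F n :=
  tsc 'C(n, k)%:R (sym (tens_of n (nseq k (vblk va) ++ nseq (n - k) (vblk vc)))).

Lemma sumn_bk k : (k <= n)%N ->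
  sumn [seq b.1 | b <- nseq k (vblk va) ++ nseq (n - k) (vblk vc)] = n.
Proof. by move=> kn; rewrite map_cat sumn_cat !map_nseq !sumn_nseq !mul1n subnKC. Qed.

Lemma Sd_bk k : (k <= n)%N -> Sd 4 (bk k).
Proof.
move=> kn; apply/SdZ/supp_sym/supp_tens_of; first exact: sumn_bk.
by apply: bsupps_cat; apply/bsupps_nseq/bsupp_vblk; [apply: supp_va | apply: supp_vc].
Qed.

Lemma phi_bk k : (k <= n)%N -> phi (bk k) = 'C(n, k)%:R *: (PA ^+ k * PC ^+ (n - k)).
Proof.
move=> kn; rewrite phi_tsc phi_sym phi_tens_of ?sumn_bk // big_cat !big_nseq !phib_vblk.
have it (p : MP) j : iter j ( *%R p) 1 = p ^+ j by elim: j => //= j ->; rewrite exprS.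
by rewrite /= !it.
Qed.

Definition chi (S : {set 'I_n}) : tens F n := pure (fun p => if p \in S then va else vc).

Lemma tsym_chi k : tsym (\sum_(S : {set 'I_n} | #|S| == k) chi S).
Proof.
move=> s; rewrite tperm_sum.
have bij : bijective (fun S : {set 'I_n} => s @^-1: S).
  exists (fun S : {set 'I_n} => [set p | (s^-1)%g p \in S]) => S; apply/setP => p.
    by rewrite !inE permKV.
  by rewrite !inE permK.
rewrite (reindex _ (onW_bij _ bij)) /=; apply: eq_big => [S|S _].
  rewrite -(card_imset (s @^-1: S) (@perm_inj _ s)); congr (#|pred_of_set _| == k).
  apply/setP => p; apply/imsetP/idP => [[q]|h]; first by rewrite inE => h ->.
  by exists (s^-1%g p); rewrite ?inE permKV.
by rewrite tperm_pure; apply: eq_pure => p; rewrite inE permKV.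
Qed.

(** The binomial coefficient in [bk] undoes the averaging: each arrangement of k factors a and n - k
    factors a^c appears exactly once. In this form [bk k] visibly projects onto weight k. *)
Lemma bkE k : (k <= n)%N -> bk k = \sum_(S : {set 'I_n} | #|S| == k) chi S.
Proof.
move=> kn; apply: phi_inj; [exact/sT/Sd_bk | exact: tsym_chi |].
rewrite phi_bk // phi_sum (eq_bigr (fun=> PA ^+ k * PC ^+ (n - k))) => [|S /eqP <-].
  by rewrite sumr_const -cardsE card_draws card_ord scaler_nat.
rewrite phi_pure (bigID (fun p => p \in S)) /= (eq_bigr (fun=> PA)) => [|p ->] //.
rewrite [X in _ * X](eq_bigr (fun=> PC)) => [|p /negbTE ->] //.
rewrite !prodr_const; congr (_ * _ ^+ _).
rewrite -(_ : #|~: S| = (n - #|S|)%N); first by apply: eq_card => p; rewrite !inE.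
by have := cardsC S; rewrite card_ord; lia.
Qed.

Definition fpure (G : {ffun 'I_n -> 'I_4}) : tens F n := pure (fun p => fv ii (G p)).

(** [chi S] fixes [fpure G] if S is the set of positions whose matrix unit a fixes from the left,
    and kills it otherwise; thus at most one summand of [bk k] acts. *)
Lemma bk_fpure k G : (k <= n)%N ->
  tmul (bk k) (fpure G) = if #|[set p | isl (G p)]| == k then fpure G else 0.
Proof.
move=> kn; rewrite bkE // tmul_suml; set S0 := [set p | _].
have off S : S != S0 -> tmul (chi S) (fpure G) = 0.
  move=> ne; have [p hp] : exists p, (p \in S) != isl (G p).
    apply/existsP; apply: contraR ne; rewrite negb_exists => /forallP h.
    by apply/eqP/setP => p; rewrite inE; apply/eqP; have := h p; rewrite negbK.
  rewrite tmul_pure; apply: (@pure0 _ p) => j.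
  by case: (p \in S) hp => /=; case: (boolP (isl (G p))) => // h _; rewrite ?vmul_va ?vmul_vc // ?h ?(negbTE h).
have on : tmul (chi S0) (fpure G) = fpure G.
  rewrite tmul_pure; apply: eq_pure => p j; rewrite inE.
  by case: (boolP (isl (G p))) => h; rewrite ?vmul_va ?vmul_vc // ?h ?(negbTE h).
case: eqP => [<-|/eqP ne]; last first.
  by rewrite big1 // => S /eqP hS; apply: off; apply: contraNneq ne => <-; rewrite hS.
by rewrite (bigD1 S0) //= on big1 ?addr0 // => S /andP[_ /off].
Qed.

Lemma fpure_bk k G : (k <= n)%N ->
  tmul (fpure G) (bk k) = if #|[set p | isr (G p)]| == k then fpure G else 0.
Proof.
move=> kn; rewrite bkE // tmul_sumr; set S0 := [set p | _].
have off S : S != S0 -> tmul (fpure G) (chi S) = 0.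
  move=> ne; have [p hp] : exists p, (p \in S) != isr (G p).
    apply/existsP; apply: contraR ne; rewrite negb_exists => /forallP h.
    by apply/eqP/setP => p; rewrite inE; apply/eqP; have := h p; rewrite negbK.
  rewrite tmul_pure; apply: (@pure0 _ p) => j.
  by case: (p \in S) hp => /=; case: (boolP (isr (G p))) => // h _; rewrite ?vmulr_va ?vmulr_vc // ?h ?(negbTE h).
have on : tmul (fpure G) (chi S0) = fpure G.
  rewrite tmul_pure; apply: eq_pure => p j; rewrite inE.
  by case: (boolP (isr (G p))) => h; rewrite ?vmulr_va ?vmulr_vc // ?h ?(negbTE h).
case: eqP => [<-|/eqP ne]; last first.
  by rewrite big1 // => S /eqP hS; apply: off; apply: contraNneq ne => <-; rewrite hS.
by rewrite (bigD1 S0) //= on big1 ?addr0 // => S /andP[_ /off].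
Qed.

Lemma fpure_ind (P : tens F n -> Prop) :
  P 0 -> (forall x y, P x -> P y -> P (x + y)) -> (forall c x, P x -> P (tsc c x)) ->
  (forall G, P (fpure G)) -> forall x, supp 4 x -> P x.
Proof.
move=> P0 PD PZ PG x hx; rewrite [x]tens_tbasis.
elim/big_rec: _ => [|I y _ Py] //; apply: (PD) => //.
case: (eqVneq (x I) 0) => [->|nz]; first by rewrite tsc0.
have hI p : (I p < 4)%N by rewrite ltnNge; apply: contra nz => h; rewrite (hx _ _ h).
apply: (PZ); rewrite pure_ebasis.
have -> : pure (fun p => ebasis F (I p)) =
    \sum_(G : {ffun 'I_n -> 'I_4}) tsc (\prod_p Mx ii (I p) (G p)) (fpure G).
  apply/ffunP => J; rewrite sum_ffunE ffunE.
  rewrite (eq_bigr (fun p => \sum_g Mx ii (I p) g * fv ii g (J p))) => [|p _].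
    by rewrite bigA_distr_bigA; apply: eq_bigr => G _; rewrite !ffunE big_split.
  exact: ebasis_fv.
by elim/big_rec: _ => [|G z _ Pz] //; apply: (PD) => //; apply: (PZ).
Qed.

(** The left weight counts factors a and u, the right weight factors a and w. Equal weights thus
    force as many u as w, and this common number is s. *)
Lemma phi_fpure (G : {ffun 'I_n -> 'I_4}) k :
  #|[set p | isl (G p)]| = k -> #|[set p | isr (G p)]| = k ->
  exists2 s, (s <= minn k (n - k))%N & phi (fpure G) = ymon ii (k - s) (n - k - s) s.
Proof.
pose c (i : nat) := #|[set p | val (G p) == i]|.
have prodc (V : comRingType) (f : nat -> V) : \prod_p f (val (G p)) = \prod_(i < 4) f i ^+ c i.
  rewrite (partition_big (fun p => G p) xpredT) //=; apply: eq_bigr => i _.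
  rewrite (eq_bigr (fun=> f i)) => [|p /eqP -> //]; rewrite prodr_const; congr (_ ^+ _).
  by apply: eq_card => p; rewrite !inE.
have cl : #|[set p | isl (G p)]| = (c 0 + c 2)%N.
  rewrite -cardsUI (_ : _ :&: _ = set0) ?cards0 ?addn0; last first.
    by apply/setP => p; rewrite !inE; case: eqP => // ->.
  by apply: eq_card => p; rewrite !inE.
have cr : #|[set p | isr (G p)]| = (c 0 + c 3)%N.
  rewrite -cardsUI (_ : _ :&: _ = set0) ?cards0 ?addn0; last first.
    by apply/setP => p; rewrite !inE; case: eqP => // ->.
  by apply: eq_card => p; rewrite !inE.
have ct : (c 0 + c 2 + (c 1 + c 3) = n)%N.
  rewrite -cl -(_ : #|~: [set p | isl (G p)]| = (c 1 + c 3)%N) ?cardsC ?card_ord //.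
  rewrite -cardsUI (_ : _ :&: _ = set0) ?cards0 ?addn0; last first.
    by apply/setP => p; rewrite !inE; case: eqP => // ->.
  apply: eq_card => p; rewrite !inE.
  by move: (G p); apply: forall_ord4.
rewrite phi_pure (prodc _ (fun i => lin (nth va [:: va; vc; vu ii; vw ii] i))).
rewrite !big_ord_recr big_ord0 /= mul1r /ymon cl cr.
move: (c 0%N) (c 1%N) (c 2%N) (c 3%N) ct {cl cr prodc} => c0 c1 c2 c3 ct e1 e2.
exists c2; first by lia.
have -> : (k - c2 = c0)%N by lia.
have -> : (n - k - c2 = c1)%N by lia.
have -> : c3 = c2 by lia.
by rewrite !mulrA.
Qed.

Definition inspan k (f : MP) := exists c : nat -> F,
  f = \sum_(s < (minn k (n - k)).+1) c s *: ymon ii (k - s) (n - k - s) s.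

Lemma bk_mid k x : (k <= n)%N -> supp 4 x -> inspan k (phi (tmul (tmul (bk k) x) (bk k))).
Proof.
move=> kn; move: x.
have span0 : inspan k 0 by exists (fun=> 0); rewrite big1 // => s _; rewrite scale0r.
apply: fpure_ind => [|x y [cx ex] [cy ey]|c x [cx ex]|G].
- by rewrite tmulr0 tmul0r phi0.
- exists (fun s => cx s + cy s); rewrite tmulDr tmulDl phiD ex ey -big_split.
  by apply: eq_bigr => s _; rewrite scalerDl.
- exists (fun s => c * cx s); rewrite tmul_tscr tmul_tscl phi_tsc ex scaler_sumr.
  by apply: eq_bigr => s _; rewrite scalerA.
rewrite bk_fpure //; case: eqP => [el|_]; last by rewrite tmul0r phi0.
rewrite fpure_bk //; case: eqP => [er|_]; last by rewrite phi0.
have [s hs ->] := phi_fpure el er; exists (fun i => (i == s)%:R).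
rewrite (bigD1 (Ordinal (hs : (s < (minn k (n - k)).+1)%N))) //= eqxx scale1r big1 ?addr0 //.
move=> j ne; case: eqP => [e|_]; last by rewrite scale0r.
by case/eqP: ne; apply/val_inj.
Qed.

(** When p or q is 0 the truncated predecessors give the wrong monomial, but its coefficient
    vanishes. *)
Lemma expr_pred2 (R : comRingType) (x y : R) p q :
  (p * q)%N%:R * (x * y * (x ^+ p.-1 * y ^+ q.-1)) = (p * q)%N%:R * (x ^+ p * y ^+ q).
Proof.
case: p => [|p]; first by rewrite !mul0r.
case: q => [|q]; first by rewrite muln0 !mul0r.
by rewrite /= mulrACA -!exprS.
Qed.

Lemma opD_ymon p q t : opD 4 n (ymon ii p q t) = (opc F 4 n * 4) *:
  ((p * q + t * t)%N%:R *: ymon ii p q t + (p * q)%N%:R *: ymon ii p.-1 q.-1 t.+1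
   + (t * t)%N%:R *: ymon ii p.+1 q.+1 t.-1).
Proof.
rewrite /opD (lap_ymon ii2) (normX4_units ii2) -scalerAl scalerA; congr (_ *: _).
rewrite /ymon -!mul_mpolyC !mpolyC_nat natrD !exprS.
move: (lin va) (lin vc) (lin (vu ii)) (lin (vw ii)) => A C U W.
have := expr_pred2 U W t t; have := expr_pred2 A C p q.
move: (p * q)%N%:R (t * t)%N%:R (A ^+ p.-1) (C ^+ q.-1) (U ^+ t.-1) (W ^+ t.-1)
  (A ^+ p) (C ^+ q) (U ^+ t) (W ^+ t) => P T A1 C1 U1 W1 Ap Cq Ut Wt e1 e2.
transitivity (P * (A * C * (A1 * C1)) * (Ut * Wt) + P * (A1 * C1) * (U * W * (Ut * Wt))
  + T * (U * W * (U1 * W1)) * (Ap * Cq) + T * (A * C * (Ap * Cq)) * (U1 * W1)); first by ring.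
by rewrite e1 e2; ring.
Qed.

(* The weight space is cyclic under the operator: each ymon with exponent t.+1 is obtained
   by applying it once more, since the coefficient (k - t)(n - k - t) does not vanish. *)
Lemma ymon_cyclic k s : (s <= minn k (n - k))%N -> exists p : {poly F},
  ymon ii (k - s) (n - k - s) s = evp (@opD F 4 n) p (ymon ii k (n - k) 0).
Proof.
pose Q (v : MP) := exists p : {poly F}, v = evp (@opD F 4 n) p (ymon ii k (n - k) 0).
have QD u v : Q u -> Q v -> Q (u + v) by move=> [p ->] [q ->]; exists (p + q); rewrite evpD.
have QZ c v : Q v -> Q (c *: v) by move=> [p ->]; exists (c *: p); rewrite evpZ.
have QN v : Q v -> Q (- v) by rewrite -scaleN1r; apply: QZ.
have QO v : Q v -> Q (opD 4 n v) by move=> [p ->]; exists ('X * p); rewrite mulrC evpMX evp_op.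
suff h t : (t <= minn k (n - k))%N -> forall s, (s <= t)%N -> Q (ymon ii (k - s) (n - k - s) s).
  by move=> hs; apply: (h s).
elim: t => [|t ih] ht {}s hs.
  have -> : s = 0%N by lia.
  by exists 1%:P; rewrite evpC scale1r !subn0.
have {}ih := ih (ltnW ht).
case: (ltngtP s t.+1) hs => // [hs _|-> _]; first exact: ih.
(* Here t + 1 <= min(k, n - k) forces n >= 2, so [opc] is not the inverse of 0. *)
have nzc : opc F 4 n * 4 != 0.
  rewrite mulf_neq0 ?pnatr_eq0 // invr_eq0 pnatr_eq0 -lt0n !muln_gt0; lia.
set a := (k - t)%N; set b := (n - k - t)%N.
have nzk : (a * b)%N%:R != 0 :> F by rewrite pnatr_eq0 muln_eq0 negb_or -!lt0n; lia.
have -> : ymon ii (k - t.+1) (n - k - t.+1) t.+1 = (a * b)%N%:R^-1 *: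
    ((opc F 4 n * 4)^-1 *: opD 4 n (ymon ii a b t) - (a * b + t * t)%N%:R *: ymon ii a b t
     - (t * t)%N%:R *: ymon ii a.+1 b.+1 t.-1).
  rewrite opD_ymon scalerA mulVf // scale1r !subnS -/a -/b.
  have h (u v w : MP) : u + v + w - u - w = v by ring.
  by rewrite h scalerA mulVf // scale1r.
apply: (QZ); apply: (QD); first by apply: (QD); [apply/QZ/QO/ih | apply/QN/QZ/ih].
apply: QN; case: t @a @b ih ht {nzk} => [|t] a b ih ht.
  by exists 0; rewrite evp0 scale0r.
have -> : a.+1 = (k - t)%N by rewrite /a; lia.
have -> : b.+1 = (n - k - t)%N by rewrite /b; lia.
by apply: QZ; apply: ih.
Qed.

Local Notation eH l := (eidem F n 4 l).
Local Notation eO m := (eidem F n 8 m).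

Lemma phi_bk_ymon k : (k <= n)%N -> phi (bk k) = 'C(n, k)%:R *: ymon ii k (n - k) 0.
Proof. by move=> kn; rewrite phi_bk // /ymon !expr0 !mulr1. Qed.

Lemma phi_mul_eidem d x l : d = 4%N \/ d = 8%N -> (uphalf n <= l <= n)%N -> Sd d x ->
  phi (tmul x (eidem F n d l)) = evp (@opD F d n) (lagr F d n l) (phi x).
Proof.
move=> hd hl sx; have nu := eidem_nuclear F hd n0 hl.
by rewrite -(nuclear_comm hd nu sx) phi_eidemM.
Qed.

Lemma ymon_hom k : (k <= n)%N ->
  hom 4 n (ymon ii k (n - k) 0) /\ iter (n./2).+1 (lap 4) (ymon ii k (n - k) 0) = 0.
Proof.
move=> kn; have nz : 'C(n, k)%:R != 0 :> F by rewrite pnatr_eq0 -lt0n bin_gt0.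
have -> : ymon ii k (n - k) 0 = phi (tsc 'C(n, k)%:R^-1 (bk k)).
  by rewrite phi_tsc phi_bk_ymon // scalerA mulVf // scale1r.
have sb := SdZ 'C(n, k)%:R^-1 (Sd_bk kn).
by split; [apply: phi_hom | apply: (phi_lap0 h4 n0)].
Qed.

(* eH l projects onto an eigenspace of opD, and by cyclicity the projections of all the ymon of
   weight k are multiples of the projection of A^k C^(n-k). *)
Lemma bk_key k l x : (k <= n)%N -> (uphalf n <= l <= n)%N -> Sd 4 x -> exists c,
  tmul (tmul (tmul (bk k) x) (bk k)) (eH l) = tsc c (tmul (bk k) (eH l)).
Proof.
move=> kn hl sx; have sb := Sd_bk kn.
have nz : 'C(n, k)%:R != 0 :> F by rewrite pnatr_eq0 -lt0n bin_gt0.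
have sbxb : Sd 4 (tmul (tmul (bk k) x) (bk k)) by do 2?apply: Sd_tmul.
have [se _] := eidem_nuclear F h4 n0 hl.
set E0 := evp (@opD F 4 n) (lagr F 4 n l) (ymon ii k (n - k) 0).
suff [c ec] : exists c, phi (tmul (tmul (tmul (bk k) x) (bk k)) (eH l)) = c *: E0.
  exists (c / 'C(n, k)%:R); apply: phi_inj; [by apply: (sT (d := 4)); apply: Sd_tmul | by apply: (sT (d := 4)); apply/SdZ/Sd_tmul |].
  by rewrite ec phi_tsc phi_mul_eidem // phi_bk_ymon // evp_scale scalerA divfK.
rewrite phi_mul_eidem //; have [c ->] := bk_mid kn sx.2.
elim/big_rec: _ => [|s y _ [c' ey]]; first by exists 0; rewrite evp_r0 scale0r.
have hs : (s <= minn k (n - k))%N by rewrite -ltnS.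
have [p ep] := ymon_cyclic hs.
exists (c s * p.[beta F n 4 l] + c'); rewrite evp_linear ey ep -evpM mulrC evpM -/E0.
have [hh h0] := ymon_hom kn.
by rewrite (evp_eigen _ (lagr_eigen h4 n0 hl hh h0)) scalerA scalerDl.
Qed.

(** Each [lap] lowers both exponents of A^k C^(n-k), so its power min(k, n-k) + 1 kills this
    monomial. Outside n - l <= k <= l that exponent is at most n - l, and [evp_lagr_kill]
    applies. *)
Lemma bk_eH0 k l : (k <= n)%N -> (uphalf n <= l <= n)%N -> ~~ (n - l <= k <= l)%N ->
  tmul (bk k) (eH l) = 0.
Proof.
move=> kn hl hk; have sb := Sd_bk kn; have [se _] := eidem_nuclear F h4 n0 hl.
have sbe : Sd 4 (tmul (bk k) (eH l)) by apply: Sd_tmul.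
apply: phi_inj0; first exact: sT sbe.
rewrite phi_mul_eidem // phi_bk // evp_scale.
have [hh _] := ymon_hom kn; rewrite /ymon !expr0 !mulr1 in hh.
have h1 : (l + (minn k (n - k)).+1 <= n)%N by lia.
have h2 : ((minn k (n - k)).+1 <= n./2.+1)%N by lia.
rewrite (evp_lagr_kill h4 n0 h1 h2 hh) ?scaler0 //.
rewrite iter_lap_AC //.
have -> : (k ^_ (minn k (n - k)).+1 * (n - k) ^_ (minn k (n - k)).+1)%N = 0%N.
  by apply/eqP; rewrite muln_eq0 !eqn0Ngt !ffact_gt0; lia.
by rewrite scale0r.
Qed.

(** Symbols of quaternionic tensors do not involve the last four variables. This is the bridge
    between the [eH l] and the [eO m]. *)
Lemma iter_lap84 x j : Sd 4 x -> iter j (lap 8) (phi x) = iter j (lap 4) (phi x).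
Proof.
have itl d k c (f g : MP) : iter k (lap d) (c *: f + g) = c *: iter k (lap d) f + iter k (lap d) g.
  by elim: k => //= k ->; rewrite linearP.
have it0 d k : iter k (lap d) (0 : MP) = 0 by elim: k => //= k ->; rewrite raddf0.
move: x; apply: Sd_ind => [|x y hx hy|c x hx|a ha].
- by rewrite phi0 !it0.
- by rewrite phiD -[phi x]scale1r !itl hx hy.
- by rewrite phi_tsc -[_ *: _]addr0 !itl hx !it0.
rewrite phi_pw !iter_lap_linX; congr (_ * _ ^+ _ *: _).
by have [h1 h2 h3 h4'] := suppv4 ha; rewrite normv8E normv4E h1 h2 h3 h4' !expr0n /= !addr0.
Qed.

(** The symbol of [eH l] is killed by the quaternionic lap^(n-l+1), hence by the octonionic one; for
    m < l this power is small enough for [evp_lagr_kill]. *)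
Lemma eH_eO0 l m : (uphalf n <= l <= n)%N -> (uphalf n <= m <= n)%N -> (m < l)%N ->
  tmul (eH l) (eO m) = 0.
Proof.
move=> hl hm ml; have [se _] := eidem_nuclear F h4 n0 hl; have [so _] := eidem_nuclear F h8 n0 hm.
have se8 : Sd 8 (eH l) by apply: Sd_mono se.
apply: phi_inj0; first by apply: (sT (d := 8)); apply: Sd_tmul.
have h1 : (m + (n - l).+1 <= n)%N by lia.
have h2 : ((n - l).+1 <= n./2.+1)%N by lia.
rewrite phi_mul_eidem //; apply: (evp_lagr_kill h8 n0 h1 h2 (phi_hom se8)).
rewrite iter_lap84 //; apply: (eigen_lap0 h4 n0 hl); [exact: phi_hom | | exact: (phi_lap0 h4 n0)].
have st := Sd_tone F n h4.
have := lagr_eigen h4 n0 hl (phi_hom st) (phi_lap0 h4 n0 st).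
by rewrite -phi_mul_eidem // tmul_tonel.
Qed.

(* X_(4+i) |-> ii X_i annihilates the norm form of the octonions. *)
Definition hsub (f : MP) : MP :=
  f \mPo [tuple (if (i < 4)%N then 'X_i else ii *: 'X_(inord (i - 4))) | i < 8].

Lemma hsub_lin (a : ovec F) : suppv 4 a -> hsub (lin a) = lin a.
Proof.
move=> ha; rewrite /hsub /lin raddf_sum; apply: eq_bigr => i _ /=.
rewrite comp_mpolyZ comp_mpolyXU -tnth_nth tnth_mktuple.
by case: ltnP => // h; rewrite ha // !scale0r.
Qed.

Lemma hsub_normX8 : hsub (normX F 8) = 0.
Proof.
have e (i : 'I_8) : hsub ('X_i ^+ 2) = if (i < 4)%N then 'X_i ^+ 2 else - 'X_(inord (i - 4)) ^+ 2.
  rewrite /hsub rmorphXn /= comp_mpolyXU -tnth_nth tnth_mktuple.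
  by case: ifP => // _; rewrite exprZn expr2 ii2 scaleN1r.
have hD f g : hsub (f + g) = hsub f + hsub g by rewrite /hsub raddfD.
rewrite normX8E !hD !e /=.
have o j (hj : (j < 8)%N) : inord j = Ordinal hj by apply/val_inj; rewrite /= inordK.
rewrite !(o 0%N isT, o 1%N isT, o 2%N isT, o 3%N isT).
ring.
Qed.

Lemma hsub_iter_lap x j : Sd 4 x -> hsub (iter j (lap 4) (phi x)) = iter j (lap 4) (phi x).
Proof.
have itl k c (f g : MP) : iter k (lap 4) (c *: f + g) = c *: iter k (lap 4) f + iter k (lap 4) g.
  by elim: k => //= k ->; rewrite linearP.
have it0 k : iter k (lap 4) (0 : MP) = 0 by elim: k => //= k ->; rewrite raddf0.
have hD c f g : hsub (c *: f + g) = c *: hsub f + hsub g.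
  by rewrite /hsub raddfD /= comp_mpolyZ.
have h0 : hsub 0 = 0 by rewrite /hsub raddf0.
move: x; apply: Sd_ind => [|x y hx hy|c x hx|a ha].
- by rewrite phi0 !it0 h0.
- by rewrite phiD -[phi x]scale1r !itl hD hx hy.
- by rewrite phi_tsc -[_ *: _]addr0 !itl hD hx !it0 h0.
rewrite phi_pw !iter_lap_linX -[X in hsub X]addr0 hD h0 addr0; congr (_ *: _).
by rewrite -[in RHS](hsub_lin ha) /hsub rmorphXn.
Qed.

(* Modulo the norm form, lap^(n - m) does not see the projection onto the m-th component;
   hsub and the point below kill the norm forms of the octonions and the quaternions. *)
Lemma bk_eH_eO_neq0 k l m : (uphalf n <= l <= n)%N -> (uphalf n <= m <= n)%N -> (l <= m)%N ->
  (n - l <= k <= l)%N -> tmul (tmul (bk k) (eH l)) (eO m) <> 0.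
Proof.
move=> hl hm lm hk; have kn : (k <= n)%N by lia.
have sb := Sd_bk kn; have [se _] := eidem_nuclear F h4 n0 hl.
have sbe : Sd 4 (tmul (bk k) (eH l)) by apply: Sd_tmul.
have sbe8 : Sd 8 (tmul (bk k) (eH l)) by apply: Sd_mono sbe.
move/(congr1 (@phi F n)); rewrite phi0 phi_mul_eidem // => e.
have mn : (n - m <= n)%N by rewrite leq_subr.
have [g eg] := lap_evp h8 (lagr F 8 n m) mn (phi_hom sbe8).
have it0 d j : iter j (lap d) (0 : MP) = 0 by elim: j => //= j ->; rewrite raddf0.
move: eg; rewrite e it0 subKn ?lagr_self ?scale1r //; last by lia.
rewrite iter_lap84 // => /(congr1 hsub).
have hD f f' : hsub (f + f') = hsub f + hsub f' by rewrite /hsub raddfD.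
have hM f f' : hsub (f * f') = hsub f * hsub f' by rewrite /hsub rmorphM.
rewrite hD hM hsub_normX8 mul0r addr0 hsub_iter_lap // /hsub raddf0 => /esym e4.
(* The vanishing passes to the higher power lap^(n-l), through which [eH l] acts as the identity
   modulo the quaternionic norm form. *)
have jj : (n - m <= n - l)%N by lia.
have {e4} := iter_lap0 jj e4.
have nl : (n - l <= n)%N by rewrite leq_subr.
have [hh _] := ymon_hom kn; rewrite /ymon !expr0 !mulr1 in hh.
have [g' eg'] := lap_evp h4 (lagr F 4 n l) nl hh.
have itl c f : iter (n - l) (lap 4) (c *: f) = c *: iter (n - l) (lap 4) f :> MP.
  by elim: (n - l)%N => //= j ->; rewrite linearZ.
rewrite phi_mul_eidem // phi_bk // evp_scale itl eg' subKn ?lagr_self ?scale1r //; last by lia.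
(* At w the norm form vanishes while A and C take the value 1, so a binomial coefficient times two
   falling factorials remains, all positive because n - l <= k <= l. *)
rewrite iter_lap_AC //; pose w (i : 'I_8) : F := nth 0 [:: 2; 0; 2 * ii] i.
have mX (f : MP) j : (f ^+ j).@[w] = f.@[w] ^+ j by rewrite rmorphXn.
move/(congr1 (meval w)); rewrite meval0 mevalZ mevalD mevalZ !mevalM !mX.
have -> : (normX F 4).@[w] = 0.
  rewrite normX4E !mevalD !mX !mevalXU /w /= !expr2 mulrACA ii2; ring.
have -> : PA.@[w] = 1.
  by rewrite linE !mevalD !mevalM !mevalC !mevalXU /w /va /=; field.
have -> : PC.@[w] = 1.
  by rewrite linE !mevalD !mevalM !mevalC !mevalXU /w /vc /=; field.
rewrite mul0r addr0 !expr1n !mulr1 -natrM => /eqP; rewrite pnatr_eq0.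
by rewrite eqn0Ngt !muln_gt0 bin_gt0 !ffact_gt0; lia.
Qed.

Lemma chi_fpure (S : {set 'I_n}) : chi S = fpure [ffun p => inord (p \notin S)].
Proof.
apply: eq_pure => p j; rewrite ffunE; congr (_ j); rewrite /fv.
by case: (p \in S); rewrite inordK.
Qed.

Lemma bkM k k' : (k <= n)%N -> (k' <= n)%N -> tmul (bk k) (bk k') = if k == k' then bk k else 0.
Proof.
move=> kn kn'; rewrite [bk k']bkE // tmul_sumr.
rewrite (eq_bigr (fun S => if k == k' then chi S else 0)) => [|S /eqP cS].
  by case: eqP => [->|_]; rewrite ?bkE // big1.
rewrite chi_fpure bk_fpure //; set A := [set p | _].
have -> : A = S.
  by apply/setP => p; rewrite !inE ffunE /isl /= !inordK; case: (p \in S).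
by rewrite cS eq_sym.
Qed.

(** On symbols, the binomial theorem for X_0 = A + C. *)
Lemma sum_bk : \sum_(0 <= k < n.+1) bk k = tone F n.
Proof.
have so := Sd_tone F n h4.
rewrite big_nat; apply: phi_inj; [|exact: sT so|].
  apply: (sT (d := 4)); apply: Sd_sum => k /andP[_ hk]; exact: Sd_bk.
rewrite phi_sum (eq_bigr (fun k => 'C(n, k)%:R *: (PA ^+ k * PC ^+ (n - k)))) => [|k /andP[_ hk]]; last exact: phi_bk.
rewrite -big_nat big_mkord phi_tone.
have -> : 'X_ord0 = PC + PA.
  rewrite -(lin_ebasis F ord0) /lin -big_split; apply: eq_bigr => i _ /=.
  rewrite -scalerDl; congr (_ *: _); rewrite /ebasis /va /vc.
  by case: (val i == 0%N) => /=; [field | case: ifP => _; ring].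
by rewrite exprDn; apply: eq_bigr => i _; rewrite scaler_nat mulrC.
Qed.

Definition tJ : tens F n := tens_of n (nseq n (vblk (ebasis F 2))).

Lemma Sd_tJ : Sd 4 tJ.
Proof. by rewrite /tJ tens_of_pw; apply/pw_Sd/supp_e2. Qed.

Lemma tJ_bk k : (k <= n)%N -> tmul tJ (bk k) = tmul (bk (n - k)) tJ.
Proof.
move=> kn; rewrite /tJ tens_of_pw !bkE ?leq_subr // tmul_sumr tmul_suml.
have bij : bijective (fun S : {set 'I_n} => ~: S) by exists (fun S => ~: S) => S; rewrite setCK.
rewrite [RHS](reindex _ (onW_bij _ bij)) /=; apply: eq_big => [S|S _].
  have e : (#|S| + #|~: S| = n)%N by rewrite cardsC card_ord.
  by apply/eqP/eqP; move: e; set a := #|S|; set b := #|~: S|; lia.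
rewrite !tmul_pure; apply: eq_pure => p; rewrite inE.
by case: (p \in S) => j; rewrite ?vmul_e2va ?vmul_e2vc.
Qed.

Lemma tJ2 : tmul tJ tJ = tsc ((-1) ^+ n) (tone F n).
Proof.
rewrite /tJ !tens_of_pw toneE tmul_pw; apply/ffunP => I; rewrite !ffunE.
under eq_bigr do rewrite vmul_e2e2 -mulN1r.
by rewrite big_split prodr_const card_ord.
Qed.

End WeightIdempotents.

(** * The ring of symmetric quaternionic tensors *)

Section SymmetricAlgebra.
Variables (F : numFieldType) (n : nat).
Local Notation T := (tens F n).
Local Notation ix := {ffun 'I_n -> 'I_8}.
Let h4 : 4%N = 4%N \/ 4%N = 8%N. Proof. by left. Qed.

(** The decidable form of [Sd 4] makes Sym^n H a subtype with a ring structure, so that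
    associativity need not be justified factor by factor. *)
Definition symHb : {pred T} := fun x =>
  [forall s, tperm s x == x] && [forall I : ix, forall p, (4 <= I p)%N ==> (x I == 0)].

Lemma symHbP x : reflect (Sd 4 x) (x \in symHb).
Proof.
apply: (iffP andP) => [[/forallP h1 /forallP h2]|[h1 h2]]; split.
- by move=> s; apply/eqP.
- by move=> I p hp; have /forallP/(_ p) := h2 I; rewrite hp => /eqP.
- by apply/forallP => s; rewrite h1.
- by apply/forallP => I; apply/forallP => p; apply/implyP => hp; rewrite (h2 _ _ hp).
Qed.

Lemma symHb_zmod : zmod_closed symHb.
Proof.
split=> [|x y /symHbP sx /symHbP sy]; apply/symHbP; first exact: Sd0.
by apply: SdD => //; apply: SdN.
Qed.
HB.instance Definition _ := GRing.isZmodClosed.Build T symHb symHb_zmod.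

Record symT := SymT { symT_val :> T; _ : symT_val \in symHb }.
HB.instance Definition _ := [isSub for symT_val].
HB.instance Definition _ := [Choice of symT by <:].
HB.instance Definition _ := [SubChoice_isSubZmodule of symT by <:].

Lemma symT_Sd (x : symT) : Sd 4 (val x).
Proof. exact/symHbP/(valP x). Qed.

Lemma tmul_symT (x y : symT) : tmul (val x) (val y) \in symHb.
Proof. by apply/symHbP; apply: (Sd_tmul h4); apply: symT_Sd. Qed.
Lemma tsc_symT c (x : symT) : tsc c (val x) \in symHb.
Proof. by apply/symHbP; apply/SdZ/symT_Sd. Qed.
Lemma tone_symT : tone F n \in symHb.
Proof. exact/symHbP/(Sd_tone F n h4). Qed.

Definition symT_mul (x y : symT) : symT := SymT (tmul_symT x y).
Definition symT_one : symT := SymT tone_symT.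
Definition symT_scale c (x : symT) : symT := SymT (tsc_symT c x).

Lemma tmulA4 (x y z : T) : Sd 4 x -> Sd 4 y -> Sd 4 z -> tmul x (tmul y z) = tmul (tmul x y) z.
Proof.
move=> sx sy sz; move: x sx y sy z sz.
apply: Sd_ind => [|x x' hx hx'|c x hx|a ha].
- by move=> *; rewrite !tmul0r.
- by move=> y sy z sz; rewrite !tmulDl hx // hx'.
- by move=> y sy z sz; rewrite !tmul_tscl hx.
apply: Sd_ind => [|x x' hx hx'|c x hx|b hb].
- by move=> *; rewrite ?(tmul0r, tmulr0).
- by move=> z sz; rewrite tmulDl !tmulDr tmulDl hx // hx'.
- by move=> z sz; rewrite tmul_tscl !tmul_tscr tmul_tscl hx.
apply: Sd_ind => [|x x' hx hx'|c x hx|e he].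
- by rewrite !tmulr0.
- by rewrite !tmulDr hx hx'.
- by rewrite !tmul_tscr hx.
by rewrite !tmul_pw; apply: eq_pw; apply: vmul_assoc4.
Qed.

Lemma symT_mulA : associative symT_mul.
Proof. by move=> x y z; apply/val_inj; apply: tmulA4; apply: symT_Sd. Qed.
Lemma symT_mul1r : left_id symT_one symT_mul.
Proof. by move=> x; apply/val_inj; apply: tmul_tonel. Qed.
Lemma symT_mulr1 : right_id symT_one symT_mul.
Proof. by move=> x; apply/val_inj; apply: tmul_toner. Qed.
Lemma symT_mulDl : left_distributive symT_mul +%R.
Proof. by move=> x y z; apply/val_inj; apply: tmulDl. Qed.
Lemma symT_mulDr : right_distributive symT_mul +%R.
Proof. by move=> x y z; apply/val_inj; apply: tmulDr. Qed.
HB.instance Definition _ := GRing.Zmodule_isPzRing.Build symT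
  symT_mulA symT_mul1r symT_mulr1 symT_mulDl symT_mulDr.

Lemma symT_scaleA a b x : symT_scale a (symT_scale b x) = symT_scale (a * b) x.
Proof. by apply/val_inj; apply: tscA. Qed.
Lemma symT_scale1 : left_id 1 symT_scale.
Proof. by move=> x; apply/val_inj; apply: tsc1. Qed.
Lemma symT_scaleDr : right_distributive symT_scale +%R.
Proof. by move=> c x y; apply/val_inj; apply: tscDr. Qed.
Lemma symT_scaleDl x : {morph symT_scale^~ x : a b / a + b}.
Proof. by move=> a b; apply/val_inj; apply: tscDl. Qed.
HB.instance Definition _ := GRing.Zmodule_isLmodule.Build F symT
  symT_scaleA symT_scale1 symT_scaleDr symT_scaleDl.

Lemma val_symM (x y : symT) : val (x * y) = tmul (val x) (val y).
Proof. by []. Qed.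
Lemma val_symZ c (x : symT) : val (c *: x) = tsc c (val x).
Proof. by []. Qed.
Lemma val_sym1 : val (1 : symT) = tone F n.
Proof. by []. Qed.
Lemma symZAl c (x y : symT) : c *: (x * y) = (c *: x) * y.
Proof. by apply/val_inj; rewrite val_symM !val_symZ tmul_tscl. Qed.
Lemma symZAr c (x y : symT) : c *: (x * y) = x * (c *: y).
Proof. by apply/val_inj; rewrite val_symM !val_symZ tmul_tscr. Qed.
Lemma val_sym_sum (I : Type) (r : seq I) (P : pred I) (f : I -> symT) :
  val (\sum_(i <- r | P i) f i) = \sum_(i <- r | P i) val (f i).
Proof. exact: raddf_sum. Qed.

Definition symI (x : T) : symT := insubd 0 x.
Lemma val_symI x : Sd 4 x -> val (symI x) = x.
Proof. by move/symHbP => h; rewrite val_insubd h. Qed.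

End SymmetricAlgebra.

(** * Projection to an octonionic component, and a criterion for primitivity *)

Section OctonionicProjection.
Variables (F : numFieldType) (n m : nat).
Hypotheses (n0 : (0 < n)%N) (hm : (uphalf n <= m <= n)%N).
Local Notation R := (symT F n).
Let h8 : 8%N = 4%N \/ 8%N = 8%N. Proof. by right. Qed.
Let nuc := eidem_nuclear F h8 n0 hm.

Definition piO (x : R) : tens F n := tmul (val x) (eO F n m).

Lemma Sd8 (x : R) : Sd 8 (val x).
Proof. exact: Sd_mono (symT_Sd x). Qed.

Lemma piOD x y : piO (x + y) = piO x + piO y.
Proof. exact: tmulDl. Qed.
Lemma piO0 : piO 0 = 0.
Proof. exact: tmul0r. Qed.
Lemma piOZ c x : piO (c *: x) = tsc c (piO x).
Proof. exact: tmul_tscl. Qed.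
Lemma piO_sum (I : Type) (r : seq I) (P : pred I) (f : I -> R) :
  piO (\sum_(i <- r | P i) f i) = \sum_(i <- r | P i) piO (f i).
Proof. by apply: (big_morph piO) => [x y|]; rewrite ?piOD ?piO0. Qed.
Lemma piO1 : piO 1 = eO F n m.
Proof. exact: tmul_tonel. Qed.

(** x, y and [eO m] meet only in Sym^n O, where nuclearity of [eO m] takes the place of
    associativity. *)
Lemma piOM x y : tmul (piO x) (piO y) = piO (x * y).
Proof.
rewrite /piO /eO val_symM; have [sx sy] := (Sd8 x, Sd8 y).
have [se he] := nuc; have sxy := Sd_tmul h8 sx sy.
have cx := nuclear_comm h8 nuc sx; have cy := nuclear_comm h8 nuc sy.
have cxy := nuclear_comm h8 nuc sxy.
have ee : tmul (eidem F n 8 m) (eidem F n 8 m) = eidem F n 8 m by rewrite (eidemM _ h8) // eqxx.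
have sye : Sd 8 (tmul (eidem F n 8 m) y) by apply: Sd_tmul.
rewrite -cx -cy -cxy -(he _ _ sx sye).1 -(he _ _ sx sy).2.
by rewrite (he _ _ se sxy).1 ee.
Qed.

Lemma algA_piO x : algA m x <-> exists r : R, x = piO r.
Proof.
split=> [[r [/symH_Sd sr ->]]|[r ->]].
  by exists (symI r); rewrite /piO val_symI.
by exists (val r); split => //; apply/symH_Sd/symT_Sd.
Qed.

(** The image of the corner gRg under [piO] has no zero divisors. *)
Definition domain_at (g : R) :=
  forall r s : R, piO (g * r * g * s * g) = 0 -> piO (g * r * g) = 0 \/ piO (g * s * g) = 0.

(** If the image of g is y + z with orthogonal idempotents y and z, both lie in the image of the
    corner and their product is 0. *)
Lemma primitive_piO (g : R) : g * g = g -> piO g <> 0 -> domain_at g ->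
  primitive_in (@algA F n m) (piO g).
Proof.
move=> gg nz dg; split; first by rewrite /idem piOM gg.
split=> // -[y [z [[/algA_piO[r ey] /algA_piO[s ez] iy iz] [ny nz' [oyz ozy] e]]]].
have ery : piO (g * r * g) = y.
  rewrite -!piOM -ey e tmulDl iy ozy addr0 tmulDr iy oyz addr0 //.
have esz : piO (g * s * g) = z.
  rewrite -!piOM -ez e tmulDl iz oyz add0r tmulDr iz ozy add0r //.
case: (dg r s); rewrite ?ery ?esz //.
have -> : g * r * g * s * g = (g * r * g) * (g * s * g) by rewrite !mulrA -[_ * g * g]mulrA gg.
by rewrite -piOM ery esz.
Qed.

Lemma complete_poi_piO (I : eqType) (idx : seq I) (g : I -> R) :
  uniq idx -> {in idx, forall i, g i * g i = g i} ->
  {in idx &, forall i j, i != j -> g i * g j = 0} ->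
  {in idx, forall i, piO (g i) <> 0} -> {in idx, forall i, domain_at (g i)} ->
  \sum_(i <- idx) piO (g i) = eO F n m ->
  complete_poi (@algA F n m) (eO F n m) (size idx) [seq piO (g i) | i <- idx].
Proof.
move=> ui id_g or_g nz_g dom_g sum_g.
split; rewrite ?size_map ?big_map //.
(* Two equal images at distinct indices would be idempotent and orthogonal to each other, hence
   0. *)
- rewrite map_inj_in_uniq // => i j hi hj e; apply/eqP; apply: contraT => ne.
  by case: (nz_g i hi); rewrite -(id_g i hi) -piOM [X in tmul _ X]e piOM or_g // piO0.
- move=> _ /mapP[i hi ->]; split; first by apply/algA_piO; exists (g i).
  by apply: primitive_piO; [apply: id_g | apply: nz_g | apply: dom_g].
move=> i j hi hj /eqP ne; case: idx ui id_g or_g nz_g dom_g sum_g hi hj => [|i0 idx'] // ui _ or_g _ _ _ hi hj.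
rewrite !(nth_map i0) //; set a := nth _ _ i; set b := nth _ _ j.
have ha : a \in i0 :: idx' by apply: mem_nth.
have hb : b \in i0 :: idx' by apply: mem_nth.
have nab : a != b by rewrite nth_uniq.
by split; rewrite piOM or_g ?piO0 // eq_sym.
Qed.

Lemma domain_scalar (g : R) : piO g <> 0 ->
  (forall r : R, exists c, piO (g * r * g) = tsc c (piO g)) -> g * g = g -> domain_at g.
Proof.
move=> nz h gg r s; have [c ec] := h r; have [c' ec'] := h s.
have -> : g * r * g * s * g = (g * r * g) * (g * s * g) by rewrite !mulrA -[_ * g * g]mulrA gg.
rewrite -piOM ec ec' tmul_tscl tmul_tscr tscA piOM gg => e.
case: (eqVneq c 0) => [->|nc]; first by left; rewrite tsc0.
right; case: (eqVneq c' 0) => [->|nc']; first by rewrite tsc0.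
case: nz; have := congr1 (tsc (c * c')^-1) e.
by rewrite tscA mulVf ?mulf_neq0 // tsc1 tscr0.
Qed.

End OctonionicProjection.

(** * Extension of scalars *)

Section ScalarExtension.
Variables (K L : numFieldType) (f : {rmorphism K -> L}).

(** Used both for the inclusion of R in C and for complex conjugation. *)
Definition tmap n (x : tens K n) : tens L n := [ffun I : {ffun 'I_n -> 'I_8} => f (x I)].

Section Arity.
Variable n : nat.
Implicit Types x y : tens K n.

Lemma tmapD x y : tmap (x + y) = tmap x + tmap y.
Proof. by apply/ffunP => I; rewrite !ffunE rmorphD. Qed.
Lemma tmap0 : tmap (0 : tens K n) = 0.
Proof. by apply/ffunP => I; rewrite !ffunE rmorph0. Qed.
Lemma tmap_tsc c x : tmap (tsc c x) = tsc (f c) (tmap x).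
Proof. by apply/ffunP => I; rewrite !ffunE rmorphM. Qed.
Lemma tmapN x : tmap (- x) = - tmap x.
Proof. by rewrite -!tscN1 tmap_tsc rmorphN1. Qed.
Lemma tmap_sum (T : Type) (r : seq T) (P : pred T) (g : T -> tens K n) :
  tmap (\sum_(i <- r | P i) g i) = \sum_(i <- r | P i) tmap (g i).
Proof. by apply: (big_morph (@tmap n)) => [x y|]; rewrite ?tmapD ?tmap0. Qed.
Lemma tmap_inj : injective (@tmap n).
Proof.
move=> x y /ffunP e; apply/ffunP => I; have := e I.
by rewrite !ffunE => /fmorph_inj.
Qed.

Lemma ebasis_morph i k : f (ebasis K i k) = ebasis L i k.
Proof. by rewrite /ebasis rmorph_nat. Qed.

Lemma vmul_morph (a b : ovec K) : (fun k => f (vmul a b k)) =1 vmul (f \o a) (f \o b).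
Proof.
by apply: forall_ord8; rewrite !vmulE /= !(rmorphB, rmorphD, rmorphM, rmorphN).
Qed.

Lemma gam_morph i j k : f (gam K i j k) = gam L i j k.
Proof.
rewrite !gam_vmul (vmul_morph (ebasis K i) (ebasis K j) k) /vmul.
by apply: eq_bigr => i' _; apply: eq_bigr => j' _; rewrite /= !ebasis_morph.
Qed.

Lemma tmap_tmul x y : tmap (tmul x y) = tmul (tmap x) (tmap y).
Proof.
apply/ffunP => J; rewrite !ffunE rmorph_sum; apply: eq_bigr => I _.
rewrite rmorph_sum; apply: eq_bigr => I' _; rewrite !ffunE !rmorphM rmorph_prod.
by congr (_ * _); apply: eq_bigr => p _; rewrite gam_morph.
Qed.

Lemma tmap_tperm s x : tmap (tperm s x) = tperm s (tmap x).
Proof. by apply/ffunP => I; rewrite !ffunE. Qed.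

Lemma tmap_pure (v : 'I_n -> ovec K) : tmap (pure v) = pure (fun p => f \o v p).
Proof. by apply/ffunP => I; rewrite !ffunE rmorph_prod. Qed.

Lemma tmap_tone : tmap (tone K n) = tone L n.
Proof.
rewrite !toneE /pw tmap_pure; apply: eq_pure => p k /=; exact: ebasis_morph.
Qed.

Lemma tmap_Sd d x : Sd d x -> Sd d (tmap x).
Proof.
move=> [sx hx]; split=> [s|I p h]; first by rewrite -tmap_tperm sx.
by rewrite ffunE (hx _ _ h) rmorph0.
Qed.

Lemma phi_tmap x : phi (tmap x) = map_mpoly f (phi x).
Proof.
rewrite /phi rmorph_sum; apply: eq_bigr => I _ /=.
rewrite ffunE map_mpolyZ rmorph_prod; congr (_ *: _); apply: eq_bigr => p _ /=.
by rewrite map_mpolyX.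
Qed.

Lemma map_normX d : map_mpoly f (normX K d) = normX L d.
Proof. by rewrite /normX rmorph_sum; apply: eq_bigr => i _ /=; rewrite rmorphXn /= map_mpolyX. Qed.

Lemma tmap_triN d : (0 < d)%N -> (1 < n)%N -> tmap (triN K n d) = triN L n d.
Proof.
move=> d0 n1; have [s1 _] := tmap_Sd (Sd_triN K n1 d0); have [s2 _] := Sd_triN L n1 d0.
apply: phi_inj => //; rewrite phi_tmap !phi_triN // map_mpolyZ fmorphV rmorph_nat.
by rewrite rmorphM /= map_normX rmorphXn /= map_mpolyX.
Qed.

Lemma beta_morph d m : f (beta K n d m) = beta L n d m.
Proof. by rewrite /beta rmorphM /= fmorphV !rmorph_nat. Qed.

Lemma tmap_eidem d m : (0 < d)%N -> tmap (eidem K n d m) = eidem L n d m.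
Proof.
move=> d0; rewrite /eidem; case: leqP => h; first exact: tmap_tone.
elim: [seq m' <- _ | _] => [|m' r ih] /=; first exact: tmap_tone.
rewrite tmap_tmul ih tmap_tsc tmapD tmapN tmap_tsc tmap_tone.
by rewrite fmorphV rmorphB /= !beta_morph tmap_triN.
Qed.

Definition symX (x : symT K n) : symT L n := symI (tmap (val x)).

Lemma val_symX (x : symT K n) : val (symX x) = tmap (val x).
Proof. exact/val_symI/tmap_Sd/symT_Sd. Qed.
Lemma symXM (x y : symT K n) : symX (x * y) = symX x * symX y.
Proof. by apply/val_inj; rewrite val_symM !val_symX val_symM tmap_tmul. Qed.
Lemma symXD (x y : symT K n) : symX (x + y) = symX x + symX y.
Proof. by apply/val_inj; rewrite raddfD /= !val_symX raddfD /= tmapD. Qed.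
Lemma symXZ c (x : symT K n) : symX (c *: x) = f c *: symX x.
Proof. by apply/val_inj; rewrite val_symZ !val_symX val_symZ tmap_tsc. Qed.
Lemma symX1 : symX 1 = 1.
Proof. by apply/val_inj; rewrite val_symX !val_sym1 tmap_tone. Qed.
Lemma symX0 : symX 0 = 0.
Proof. by apply/val_inj; rewrite val_symX tmap0. Qed.
Lemma symX_inj : injective symX.
Proof. by move=> x y /(congr1 val); rewrite !val_symX => /tmap_inj/val_inj. Qed.

Lemma tmap_piO m (x : symT K n) : tmap (piO m x) = piO m (symX x).
Proof. by rewrite /piO tmap_tmul /eO tmap_eidem // val_symX. Qed.

End Arity.
End ScalarExtension.

(** * The real families *)

Section GirardWaring.
Variables (F : numFieldType) (V : comAlgType F).

Definition waring (N i : nat) : F := (-1) ^+ i * N%:R * 'C(N - i, i)%:R / (N - i)%N%:R.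

Definition wterm (x y : V) N i : V := waring N i *: ((x + y) ^+ (N - 2 * i) * (x * y) ^+ i).

(** The coefficientwise form of p_(N+2) = (x+y) p_(N+1) - xy p_N for the power sums p_N = x^N + y^N.
    The case N = 0 is excluded because p_0 = 2 while [waring 0 0] is 0; hence the induction in
    [girard_waring] starts from N = 1 and N = 2. *)
Lemma waring_rec N i : (0 < N)%N -> (i.*2 <= N)%N ->
  waring N.+2 i.+1 = waring N.+1 i.+1 - waring N i.
Proof.
move=> N0 hi; rewrite /waring; pose M := (N - i)%N.
have -> : (N.+2 - i.+1 = M.+1)%N by lia.
have -> : (N.+1 - i.+1 = M)%N by lia.
have eN : N%:R = M%:R + i%:R :> F by rewrite -natrD; congr _%:R; lia.
have M0 : M%:R != 0 :> F by rewrite pnatr_eq0; lia.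
have i0 : 1 + i%:R != 0 :> F by rewrite addrC natr1 pnatr_eq0.
have M1 : 1 + M%:R != 0 :> F by rewrite addrC natr1 pnatr_eq0.
have eb : 'C(M, i.+1)%:R = (M%:R - i%:R) * 'C(M, i)%:R / (1 + i%:R) :> F.
  apply: (canRL (mulfK i0)); rewrite mulrC addrC natr1 -natrM mul_bin_left natrM natrB //; lia.
rewrite -/M binS natrD eb -!natr1 eN exprS; field.
by rewrite M0 i0 [M%:R + 1]addrC M1.
Qed.

Lemma waring0 N : (0 < N)%N -> waring N 0 = 1.
Proof. by move=> N0; rewrite /waring expr0 mul1r subn0 bin0 mulr1 divff // pnatr_eq0 -lt0n. Qed.

Lemma waring_small N i : (N < i.*2)%N -> waring N i = 0.
Proof. by move=> h; rewrite /waring bin_small ?mulr0 ?mul0r //; lia. Qed.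

Lemma wterm_wide (x y : V) N k : (N./2 < k)%N ->
  \sum_(0 <= i < k) wterm x y N i = \sum_(0 <= i < (N./2).+1) wterm x y N i.
Proof.
move=> hk; rewrite (@big_cat_nat _ _ _ (N./2).+1) //= -[RHS]addr0; congr (_ + _).
rewrite big_nat big1 //; by move=> i /andP[hi _]; rewrite /wterm waring_small ?scale0r //; lia.
Qed.

Lemma girard_waring (x y : V) N : (0 < N)%N ->
  \sum_(0 <= i < (N./2).+1) wterm x y N i = x ^+ N + y ^+ N.
Proof.
elim/ltn_ind: N => -[|[|[|N]]] // ih _.
- by rewrite /= big_nat1 /wterm waring0 // scale1r mulr1.
- rewrite /= big_nat_recr //= big_nat1 /wterm waring0 // scale1r /= expr0 mul1r mulr1.
  rewrite (_ : waring 2 1 = -2) ?scaleNr ?scaler_nat; last by rewrite /waring binn expr1 divr1 mulr1 mulN1r.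
  by rewrite expr1 sqrrD; ring.
have e1 := ih N.+2 (ltnSn _) isT; have {ih} e2 := ih N.+1 (leqnSn _) isT.
have -> : x ^+ N.+3 + y ^+ N.+3 = (x + y) * (x ^+ N.+2 + y ^+ N.+2) - x * y * (x ^+ N.+1 + y ^+ N.+1).
  by rewrite !exprS; ring.
rewrite -e1 -e2 -(@wterm_wide x y N.+2 (N.+3./2).+1); last by lia.
rewrite !mulr_sumr big_nat_recl // [X in _ = X - _]big_nat_recl // /wterm !waring0 //.
rewrite !scale1r !muln0 !subn0 !expr0 !mulr1 -exprS -addrA -sumrB; congr (_ + _).
apply: eq_big_nat => i hi.
rewrite waring_rec //; last by lia.
rewrite scalerBl -!scalerAr; congr (_ - _); last first.
  by congr (_ *: _); rewrite mulrCA -exprS; congr (_ ^+ _ * _); lia.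
case: (leqP (i.+1.*2) N.+2) => h; last by rewrite waring_small // !scale0r.
by congr (_ *: _); rewrite mulrA -exprS; congr (_ ^+ _ * _); lia.
Qed.

End GirardWaring.

Section RealTensors.
Variables (F : numFieldType) (n : nat).
Local Notation MP := {mpoly F[8]}.
Local Notation "# i" := (@Ordinal 8 i isT) (at level 0, i at level 0, format "# i").

(** The tensors of (b) and (c), stripped of their idempotent factors and over any field: the
    comparison with [bk] takes place only where a square root of -1 exists. *)
Definition tB k : tens F n := tsc (('C(n, k) * (n - 2 * k))%N%:R / (2 ^ k)%N%:R)
  (\sum_(0 <= i < ((n.-1)./2 - k).+1)
     tsc ((- 2%:R^-1) ^+ i * 'C(n - 2 * k - i, i)%:R / (n - 2 * k - i)%N%:R)
     (sym (tens_of n (nseq (n - 2 * k - 2 * i) (vblk (ebasis F 0))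
                      ++ nseq (k + i) (blk_of (sqr F)))))).
Definition tC0 : tens F n :=
  tsc ((2%:R^-1) ^+ (n./2) * 'C(n, n./2)%:R) (sym (tens_of n (nseq n./2 (blk_of (sqr F))))).
Definition tC k : tens F n := tsc (('C(n, k) * (n./2 - k))%N%:R / (2 ^ k)%N%:R)
  (\sum_(0 <= i < ((n./2 - k)./2).+1)
     tsc ((- 4%:R^-1) ^+ i * 'C(n./2 - k - i, i)%:R / (n./2 - k - i)%N%:R)
     (sym (tens_of n (nseq (k + 2 * i) (blk_of (sqr F))
               ++ nseq (n./2 - k - 2 * i)
                    (blk_of (tbasis F [ffun _ : 'I_2 => 0] - sqr F)))))).

Lemma ord8_0 : 0 = #0. Proof. exact/val_inj. Qed.
Lemma ord8_1 : 1 = #1. Proof. exact/val_inj. Qed.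

Definition Xsq : MP := 2%:R^-1 *: ('X_#0 ^+ 2 + 'X_#1 ^+ 2).
Definition Xsqc : MP := 2%:R^-1 *: ('X_#0 ^+ 2 - 'X_#1 ^+ 2).

Lemma phi_sqr : phi (sqr F) = Xsq.
Proof. by rewrite phi_tsc phiD !phi_tbasis2 ord8_0 ord8_1. Qed.
Lemma phi_sqrc : phi (tbasis F [ffun _ : 'I_2 => 0] - sqr F) = Xsqc.
Proof.
rewrite phiD phiN phi_sqr phi_tbasis2 ord8_0 /Xsq /Xsqc.
have -> : 'X_#0 ^+ 2 = 2%:R^-1 *: ('X_#0 ^+ 2 + 'X_#0 ^+ 2) :> MP.
  by rewrite -mulr2n -scaler_nat scalerA mulVf ?scale1r // pnatr_eq0.
rewrite -scalerBr; congr (_ *: _).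
have -> : 2%:R^-1 *: ('X_#0 ^+ 2 + 'X_#0 ^+ 2) = 'X_#0 ^+ 2 :> MP.
  by rewrite -mulr2n -scaler_nat scalerA mulVf ?scale1r // pnatr_eq0.
by rewrite opprD addrA addrK.
Qed.

Lemma supp_sqr : supp 4 (sqr F).
Proof.
move=> I p hp; rewrite !ffunE.
have h0 := @supp_tbasis2 F 4 0 isT I p hp; have h1 := @supp_tbasis2 F 4 1 isT I p hp.
by rewrite !ffunE in h0 h1; rewrite h0 h1 addr0 mulr0.
Qed.
Lemma supp_sqrc : supp 4 (tbasis F [ffun _ : 'I_2 => 0] - sqr F).
Proof.
move=> I p hp; rewrite ffunE (@supp_tbasis2 F 4 0 isT I p hp) add0r ffunE (supp_sqr hp) oppr0 //.
Qed.

Lemma sumn_nseq_blk (b b' : blk F) j j' :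
  sumn [seq c.1 | c <- nseq j b ++ nseq j' b'] = (b.1 * j + b'.1 * j')%N.
Proof. by rewrite map_cat sumn_cat !map_nseq !sumn_nseq. Qed.

Lemma sym_blocks (b b' : blk F) j j' : (b.1 * j + b'.1 * j' = n)%N -> bsupp 4 b -> bsupp 4 b' ->
  Sd 4 (sym (tens_of n (nseq j b ++ nseq j' b'))) /\
  phi (sym (tens_of n (nseq j b ++ nseq j' b'))) = phib b ^+ j * phib b' ^+ j'.
Proof.
move=> e hb hb'; rewrite -sumn_nseq_blk in e; split.
  by apply: supp_sym; apply: supp_tens_of => //; apply: bsupps_cat; apply: bsupps_nseq.
rewrite phi_sym phi_tens_of // big_cat !big_nseq.
have it (p : MP) i : iter i ( *%R p) 1 = p ^+ i by elim: i => //= i ->; rewrite exprS.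
by rewrite /= !it.
Qed.

Lemma be0 : bsupp 4 (vblk (ebasis F 0)). Proof. exact/bsupp_vblk/suppv_ebasis. Qed.
Lemma bsq : bsupp 4 (blk_of (sqr F)). Proof. exact/bsupp_blk_of/supp_sqr. Qed.
Lemma bsqc : bsupp 4 (blk_of (tbasis F [ffun _ : 'I_2 => 0] - sqr F)).
Proof. exact/bsupp_blk_of/supp_sqrc. Qed.

Lemma tB_spec k : odd n -> (k <= (n.-1)./2)%N -> Sd 4 (tB k) /\
  phi (tB k) = (('C(n, k) * (n - 2 * k))%N%:R / (2 ^ k)%N%:R) *:
  \sum_(0 <= i < ((n.-1)./2 - k).+1)
   ((- 2%:R^-1) ^+ i * 'C(n - 2 * k - i, i)%:R / (n - 2 * k - i)%N%:R) *:
   ('X_#0 ^+ (n - 2 * k - 2 * i) * Xsq ^+ (k + i)).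
Proof.
move=> on hk.
have h i : (i < ((n.-1)./2 - k).+1)%N -> (1 * (n - 2 * k - 2 * i) + 2 * (k + i) = n)%N by lia.
split.
  apply: SdZ; rewrite big_nat; apply: Sd_sum => i /andP[_ /h hi]; apply: SdZ.
  by case: (sym_blocks (b := vblk (ebasis F 0)) (b' := blk_of (sqr F)) hi be0 bsq).
rewrite phi_tsc phi_sum; congr (_ *: _); apply: eq_big_nat => i /andP[_ /h hi].
have [_ e] := sym_blocks (b := vblk (ebasis F 0)) (b' := blk_of (sqr F)) hi be0 bsq.
by rewrite phi_tsc e phib_vblk (lin_ebasis F #0) phib_blk_of phi_sqr.
Qed.

Lemma tC0_spec : ~~ odd n -> Sd 4 tC0 /\
  phi tC0 = ((2%:R^-1) ^+ (n./2) * 'C(n, n./2)%:R) *: Xsq ^+ n./2.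
Proof.
move=> en; have h : (2 * n./2 + 1 * 0 = n)%N by lia.
have [s e] := sym_blocks (b := blk_of (sqr F)) (b' := vblk (ebasis F 0)) h bsq be0.
rewrite cats0 in s e; split; first exact: SdZ.
by rewrite phi_tsc e mulr1 phib_blk_of phi_sqr.
Qed.

Lemma tC_spec k : ~~ odd n -> (k < n./2)%N -> Sd 4 (tC k) /\
  phi (tC k) = (('C(n, k) * (n./2 - k))%N%:R / (2 ^ k)%N%:R) *:
  \sum_(0 <= i < ((n./2 - k)./2).+1)
   ((- 4%:R^-1) ^+ i * 'C(n./2 - k - i, i)%:R / (n./2 - k - i)%N%:R) *:
   (Xsq ^+ (k + 2 * i) * Xsqc ^+ (n./2 - k - 2 * i)).
Proof.
move=> en hk.
have h i : (i < ((n./2 - k)./2).+1)%N -> (2 * (k + 2 * i) + 2 * (n./2 - k - 2 * i) = n)%N by lia.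
split.
  apply: SdZ; rewrite big_nat; apply: Sd_sum => i /andP[_ /h hi]; apply: SdZ.
  by case: (sym_blocks (b := blk_of (sqr F)) (b' := blk_of (tbasis F [ffun _ : 'I_2 => 0] - sqr F)) hi bsq bsqc).
rewrite phi_tsc phi_sum; congr (_ *: _); apply: eq_big_nat => i /andP[_ /h hi].
have [_ e] := sym_blocks (b := blk_of (sqr F)) (b' := blk_of (tbasis F [ffun _ : 'I_2 => 0] - sqr F)) hi bsq bsqc.
by rewrite phi_tsc e !phib_blk_of phi_sqr phi_sqrc.
Qed.

Section Split.
Variable ii : F.
Hypothesis ii2 : ii * ii = -1.
Local Notation PA := (lin (va ii)). Local Notation PC := (lin (vc ii)).

Lemma X0_split : 'X_#0 = PA + PC.
Proof.
rewrite !linE /va /vc /= !mpolyC0 mpolyCN.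
transitivity ((2^-1 + 2^-1 : F)%:MP * 'X_#0 : MP); last by rewrite mpolyCD; ring.
by rewrite (_ : 2^-1 + 2^-1 = 1 :> F) ?mpolyC1 ?mul1r //; field.
Qed.
Lemma Xsq_split : Xsq = 2%:R *: (PA * PC).
Proof.
rewrite /Xsq !linE /va /vc /= !mpolyC0 !mpolyCN !mul0r !addr0 -!mul_mpolyC mpolyCM.
have e1 : ii%:MP * ii%:MP = -1 :> MP by rewrite -mpolyCM ii2 mpolyCN.
have e2 : 2%:MP * 2^-1%:MP = 1 :> MP by rewrite -mpolyCM mulfV // pnatr_eq0.
move: (2^-1)%:MP (2%:R)%:MP ii%:MP e1 e2 => h t j e1 e2.
transitivity (t * h * h * ('X_#0 ^+ 2 - j * j * 'X_#1 ^+ 2)); last by ring.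
by rewrite e1 e2; ring.
Qed.
Lemma Xsqc_split : Xsqc = PA ^+ 2 + PC ^+ 2.
Proof.
rewrite /Xsqc !linE /va /vc /= !mpolyC0 !mpolyCN !mul0r !addr0 -!mul_mpolyC mpolyCM.
have e1 : ii%:MP * ii%:MP = -1 :> MP by rewrite -mpolyCM ii2 mpolyCN.
have e2 : 2%:R * 2^-1%:MP = 1 :> MP by rewrite -mpolyC_nat -mpolyCM mulfV // pnatr_eq0.
move: (2^-1)%:MP ii%:MP e1 e2 => h j e1 e2.
transitivity (2%:R * h * h * ('X_#0 ^+ 2 + j * j * 'X_#1 ^+ 2)); last by ring.
by rewrite e1 e2; ring.
Qed.

Let sT d (x : tens F n) : Sd d x -> tsym x. Proof. by case. Qed.

(** The symbol of the right side is (AC)^k (A^N + C^N) with N = n - 2k, up to a binomial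
    coefficient. Since A + C = X_0 and AC is half the symbol of the square tensor, Girard-Waring
    produces the powers of 1/2 in the family. *)
Lemma tB_bk k : odd n -> (k <= (n.-1)./2)%N -> tB k = bk ii n k + bk ii n (n - k).
Proof.
move=> on hk; have kn : (k <= n)%N by lia.
have [s e] := tB_spec on hk.
apply: phi_inj; [exact: sT s | by apply: (sT (d := 4)); apply: SdD; apply: Sd_bk; lia |].
rewrite e phiD !phi_bk ?leq_subr // subKn // bin_sub // -scalerDr.
pose N := (n - 2 * k)%N; have N0 : (0 < N)%N by rewrite /N; lia.
have := girard_waring PC PA N0.
have -> : PA ^+ k * PC ^+ (n - k) + PA ^+ (n - k) * PC ^+ k = (PA * PC) ^+ k * (PC ^+ N + PA ^+ N).
  have -> : (n - k = k + N)%N by rewrite /N; lia.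
  by rewrite !exprD exprMn; ring.
move=> <-; have -> : (N./2 = (n.-1)./2 - k)%N by rewrite /N; lia.
rewrite mulr_sumr !scaler_sumr; apply: eq_big_nat => i hi.
rewrite X0_split Xsq_split /wterm exprZn addrC -scalerAr -!scalerAr !scalerA [PC * PA]mulrC.
rewrite [(PA * PC) ^+ k * _]mulrCA -[(PA * PC) ^+ k * _]exprD; congr (_ *: _); rewrite /waring -/N.
have nz : (N - i)%N%:R != 0 :> F by rewrite pnatr_eq0; lia.
rewrite natrM natrX [(- 2%:R^-1) ^+ i]exprNn exprVn exprD.
have h2 j : (2 : F) ^+ j != 0 by rewrite expf_neq0 // pnatr_eq0.
field.
by rewrite nz !h2.
Qed.

Lemma tC0_bk : ~~ odd n -> tC0 = bk ii n n./2.
Proof.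
move=> en; have kn : (n./2 <= n)%N by lia.
have [s e] := tC0_spec en.
apply: phi_inj; [exact: sT s | by apply: (sT (d := 4)); apply: Sd_bk |].
rewrite e phi_bk // Xsq_split exprZn exprMn scalerA.
have -> : 2%:R^-1 ^+ n./2 * 'C(n, n./2)%:R * 2%:R ^+ n./2 = 'C(n, n./2)%:R :> F.
  by rewrite mulrAC -exprMn mulVf ?expr1n ?mul1r // pnatr_eq0.
by congr (_ *: (_ * _ ^+ _)); lia.
Qed.

(** For even n Girard-Waring is applied to A^2 and C^2 with N = n/2 - k: their sum is the symbol of
    [1 - sqr] and their product is a quarter of the square of the symbol of [sqr], whence the powers
    of 1/4. *)
Lemma tC_bk k : ~~ odd n -> (k < n./2)%N -> tC k = bk ii n k + bk ii n (n - k).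
Proof.
move=> en hk; have kn : (k <= n)%N by lia.
have [s e] := tC_spec en hk.
apply: phi_inj; [exact: sT s | by apply: (sT (d := 4)); apply: SdD; apply: Sd_bk; lia |].
rewrite e phiD !phi_bk ?leq_subr // subKn // bin_sub // -scalerDr.
pose N := (n./2 - k)%N; have N0 : (0 < N)%N by rewrite /N; lia.
have := girard_waring (PC ^+ 2) (PA ^+ 2) N0.
have -> : PA ^+ k * PC ^+ (n - k) + PA ^+ (n - k) * PC ^+ k =
    (PA * PC) ^+ k * ((PC ^+ 2) ^+ N + (PA ^+ 2) ^+ N).
  have -> : (n - k = k + 2 * N)%N by rewrite /N; lia.
  by rewrite -!exprM !exprD exprMn; ring.
move=> <-; rewrite -/N mulr_sumr !scaler_sumr; apply: eq_big_nat => i hi.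
rewrite Xsqc_split Xsq_split /wterm exprZn [PA ^+ 2 + _]addrC -!scalerAl -!scalerAr !scalerA.
rewrite -exprMn [PC * PA]mulrC -[((PA * PC) ^+ 2) ^+ i]exprM [(PA * PC) ^+ k * _]mulrCA -[(PA * PC) ^+ k * _]exprD.
rewrite [(PA * PC) ^+ _ * _]mulrC; congr (_ *: (_ * _)).
have nz : (N - i)%N%:R != 0 :> F by rewrite pnatr_eq0; lia.
rewrite /waring -/N natrM natrX [(- 4%:R^-1) ^+ i]exprNn exprVn exprD exprM.
have h2 j : (2 : F) ^+ j != 0 by rewrite expf_neq0 // pnatr_eq0.
have h4 : (4 : F) ^+ i = (2 ^+ 2) ^+ i by congr (_ ^+ _); ring.
rewrite h4; have h22 : ((2 : F) ^+ 2) ^+ i != 0 by rewrite -exprM.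
field.
by rewrite nz h2 h22.
Qed.

End Split.
End RealTensors.

Section RealTensorsMap.
Variables (K L : numFieldType) (f : {rmorphism K -> L}) (n : nat).

Lemma map_Xsq : map_mpoly f (Xsq K) = Xsq L.
Proof. by rewrite /Xsq map_mpolyZ fmorphV rmorph_nat rmorphD !rmorphXn /= !map_mpolyX. Qed.
Lemma map_Xsqc : map_mpoly f (Xsqc K) = Xsqc L.
Proof. by rewrite /Xsqc map_mpolyZ fmorphV rmorph_nat rmorphB !rmorphXn /= !map_mpolyX. Qed.

Lemma tmap_tB k : odd n -> (k <= (n.-1)./2)%N -> tmap f (tB K n k) = tB L n k.
Proof.
move=> on hk; have [sK eK] := tB_spec K on hk; have [sL eL] := tB_spec L on hk.
apply: phi_inj; [by case: (tmap_Sd f sK) | by case: sL |].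
rewrite phi_tmap eK eL map_mpolyZ rmorphM fmorphV !rmorph_nat; congr (_ *: _).
rewrite rmorph_sum; apply: eq_bigr => i _.
rewrite /= map_mpolyZ !rmorphM fmorphV !rmorph_nat !rmorphXn /= rmorphN fmorphV rmorph_nat.
by rewrite map_Xsq map_mpolyX.
Qed.

Lemma tmap_tC0 : ~~ odd n -> tmap f (tC0 K n) = tC0 L n.
Proof.
move=> en; have [sK eK] := tC0_spec K en; have [sL eL] := tC0_spec L en.
apply: phi_inj; [by case: (tmap_Sd f sK) | by case: sL |].
rewrite phi_tmap eK eL map_mpolyZ rmorphM !rmorphXn fmorphV !rmorph_nat /=.
by rewrite map_Xsq.
Qed.

Lemma tmap_tC k : ~~ odd n -> (k < n./2)%N -> tmap f (tC K n k) = tC L n k.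
Proof.
move=> en hk; have [sK eK] := tC_spec K en hk; have [sL eL] := tC_spec L en hk.
apply: phi_inj; [by case: (tmap_Sd f sK) | by case: sL |].
rewrite phi_tmap eK eL map_mpolyZ rmorphM fmorphV !rmorph_nat; congr (_ *: _).
rewrite rmorph_sum; apply: eq_bigr => i _.
rewrite /= map_mpolyZ !rmorphM fmorphV !rmorph_nat !rmorphXn /= rmorphN fmorphV rmorph_nat.
by rewrite map_Xsq map_Xsqc.
Qed.

Lemma tmap_tJ : tmap f (tJ K n) = tJ L n.
Proof.
rewrite /tJ !tens_of_pw /pw tmap_pure; apply: eq_pure => p k /=; exact: ebasis_morph.
Qed.

End RealTensorsMap.

(** * Primitive idempotents in the split case *)

Section SplitAlgebra.
Variables (F : numFieldType) (ii : F) (n m : nat).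
Hypotheses (ii2 : ii * ii = -1) (n0 : (0 < n)%N) (hm : (uphalf n <= m <= n)%N).
Local Notation R := (symT F n).
Let h4 : 4%N = 4%N \/ 4%N = 8%N. Proof. by left. Qed.

Definition sB k : R := symI (bk ii n k).
Definition sE l : R := symI (eidem F n 4 l).
Definition sJ : R := symI (tJ F n).
Local Notation inr l := (uphalf n <= l <= n)%N.

Lemma val_sB k : (k <= n)%N -> val (sB k) = bk ii n k.
Proof. by move=> kn; apply/val_symI/Sd_bk. Qed.
Lemma val_sE l : inr l -> val (sE l) = eidem F n 4 l.
Proof. by move=> hl; apply: val_symI; case: (eidem_nuclear F h4 n0 hl). Qed.
Lemma val_sJ : val sJ = tJ F n.
Proof. exact/val_symI/Sd_tJ. Qed.

Lemma sBB k k' : (k <= n)%N -> (k' <= n)%N -> sB k * sB k' = if k == k' then sB k else 0.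
Proof.
move=> kn kn'; apply/val_inj; rewrite val_symM !val_sB // bkM //.
by case: eqP; rewrite ?val_sB.
Qed.
Lemma sEE l l' : inr l -> inr l' -> sE l * sE l' = if l == l' then sE l else 0.
Proof.
move=> hl hl'; apply/val_inj; rewrite val_symM !val_sE // (eidemM _ h4) //.
by case: eqP; rewrite ?val_sE.
Qed.
Lemma sEC l (x : R) : inr l -> sE l * x = x * sE l.
Proof.
move=> hl; apply/val_inj; rewrite !val_symM val_sE //.
exact: (nuclear_comm h4 (eidem_nuclear F h4 n0 hl) (symT_Sd x)).
Qed.
Lemma sum_sB : \sum_(0 <= k < n.+1) sB k = 1.
Proof.
apply/val_inj; rewrite val_sym_sum val_sym1 -(sum_bk ii n).
by apply: eq_big_nat => k /andP[_ hk]; rewrite val_sB.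
Qed.
Lemma sum_sE : \sum_(uphalf n <= l < n.+1) sE l = 1.
Proof.
apply/val_inj; rewrite val_sym_sum val_sym1 -(sum_eidem F h4 n0).
by apply: eq_big_nat => l hl; rewrite val_sE.
Qed.
Lemma sB_mid k l (x : R) : (k <= n)%N -> inr l ->
  exists c, sB k * x * sB k * sE l = c *: (sB k * sE l).
Proof.
move=> kn hl; have [c e] := bk_key ii2 n0 kn hl (symT_Sd x).
by exists c; apply/val_inj; rewrite val_symZ !val_symM val_sB // val_sE.
Qed.
Lemma sJB k : (k <= n)%N -> sJ * sB k = sB (n - k) * sJ.
Proof.
by move=> kn; apply/val_inj; rewrite !val_symM val_sJ !val_sB ?leq_subr // tJ_bk.
Qed.
Lemma sJJ : sJ * sJ = (-1) ^+ n *: (1 : R) :> R.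
Proof. by apply/val_inj; rewrite val_symM val_symZ val_sym1 val_sJ tJ2. Qed.

Lemma sB_sE0 k l : (k <= n)%N -> inr l -> ~~ (n - l <= k <= l)%N -> sB k * sE l = 0.
Proof.
by move=> kn hl h; apply/val_inj; rewrite val_symM val_sB // val_sE // bk_eH0.
Qed.

Lemma piO_neq0 k l : inr l -> (l <= m)%N -> (n - l <= k <= l)%N -> piO m (sB k * sE l) <> 0.
Proof.
move=> hl lm hk; rewrite /piO val_symM val_sB ?val_sE //; last by lia.
exact: bk_eH_eO_neq0.
Qed.

Lemma sE_sum l : inr l -> \sum_(n - l <= k < l.+1) sB k * sE l = sE l.
Proof.
move=> hl; rewrite -[RHS]mul1r -sum_sB mulr_suml.
rewrite [RHS](@big_cat_nat _ _ _ (n - l)) //=; last by lia.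
rewrite [X in _ = X + _]big_nat [X in _ = X + _]big1 ?add0r => [|k hk]; last by rewrite sB_sE0 //; lia.
rewrite [RHS](@big_cat_nat _ _ _ l.+1) //=; try lia.
rewrite [X in _ = _ + X]big_nat [X in _ = _ + X]big1 ?addr0 // => k hk.
by rewrite sB_sE0 //; lia.
Qed.

(** By [eH_eO0] the summands with l > m vanish, which is why l stops at m in all families. *)
Lemma sum_piO_sE : \sum_(uphalf n <= l < m.+1) piO m (sE l) = eO F n m.
Proof.
rewrite -[RHS]piO1 -sum_sE piO_sum [RHS](@big_cat_nat _ _ _ m.+1) //=; try lia.
rewrite [X in _ = _ + X]big_nat [X in _ = _ + X]big1 ?addr0 // => l hl.
rewrite /piO val_sE; last by lia.
by apply: eH_eO0 => //; lia.
Qed.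

Section Corner.
Variables (k l : nat).
Hypotheses (hl : inr l) (lm : (l <= m)%N) (hk : (n - l <= k <= l)%N).
Let kn : (k <= n)%N. Proof. by clear -hl hk; lia. Qed.
Let p := sB k * sE l.

Lemma pp : p * p = p.
Proof. by rewrite /p -mulrA [sE l * _]mulrA sEC // -mulrA sEE // eqxx mulrA sBB // eqxx. Qed.

Lemma p_mid (x : R) : exists c, p * x * p = c *: p.
Proof.
have [c e] := sB_mid x kn hl; exists c.
rewrite -e /p -!mulrA; congr (_ * _); rewrite sEC // -!mulrA; congr (_ * (_ * _)).
by rewrite sEE // eqxx.
Qed.

Lemma domain_p : domain_at m p.
Proof.
apply: (domain_scalar n0 hm); [exact: piO_neq0 | | exact: pp].
by move=> r; have [c ->] := p_mid r; exists c; rewrite piOZ.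
Qed.

End Corner.

Theorem split_complete : complete_poi (@algA F n m) (eO F n m)
  (size [seq (l, k) | l <- iota (uphalf n) (m - uphalf n).+1, k <- iota (n - l) (l - (n - l)).+1])
  [seq piO m (sB k * sE l) | l <- iota (uphalf n) (m - uphalf n).+1,
                             k <- iota (n - l) (l - (n - l)).+1].
Proof.
set idx := [seq (l, k) | l <- _, k <- _].
have -> : [seq piO m (sB k * sE l) | l <- iota (uphalf n) (m - uphalf n).+1,
            k <- iota (n - l) (l - (n - l)).+1] = [seq piO m (sB i.2 * sE i.1) | i <- idx].
  by rewrite map_allpairs.
have idxP i : i \in idx -> [/\ inr i.1, (i.1 <= m)%N & (n - i.1 <= i.2 <= i.1)%N].
  by move/allpairsPdep => [l [k [hl hk ->]]] /=; rewrite !mem_iota in hl hk *; split; lia.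
apply: (complete_poi_piO n0 hm).
- apply: allpairs_uniq_dep => [|l hl|[l k] [l' k'] _ _ /= [-> ->]] //; exact: iota_uniq.
- by move=> i /idxP[h1 h2 h3]; apply: pp.
- move=> [l k] [l' k'] /idxP[/= h1 h2 h3] /idxP[/= h1' h2' h3'] ne.
  rewrite -mulrA [sE l * _]mulrA sEC // -mulrA sEE // mulrA sBB; try lia.
  by move: ne; rewrite xpair_eqE; do 2![case: eqP => _]; rewrite //= ?mulr0 ?mul0r.
- by move=> i /idxP[h1 h2 h3]; apply: piO_neq0.
- by move=> i /idxP[h1 h2 h3]; apply: domain_p.
rewrite -[RHS]sum_piO_sE big_allpairs_dep /index_iota subSn; last by lia.
rewrite !big_seq; apply: eq_bigr => l; rewrite mem_iota => hl.
have hl' : inr l by lia.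
by rewrite -piO_sum -[in RHS](sE_sum hl') /index_iota subSn //; lia.
Qed.

End SplitAlgebra.

(** * Real forms of the corners *)

Section AbstractCorner.
Variables (F : numFieldType) (n : nat).
Local Notation R := (symT F n).
Variables (p q J : R) (sgn : F).
Hypotheses (pp : p * p = p) (qq : q * q = q) (pq : p * q = 0) (qp : q * p = 0).
Hypotheses (Jp : J * p = q * J) (Jq : J * q = p * J).
Hypotheses (JJ : J * J = sgn *: (1 : R) :> R) (sgn2 : sgn * sgn = 1).
Hypotheses (mid_p : forall x : R, exists c, p * x * p = c *: p).
Hypotheses (mid_q : forall x : R, exists c, q * x * q = c *: q).

Lemma mulJJ (x : R) : x * J * J = sgn *: x.
Proof. by rewrite -mulrA JJ -symZAr mulr1. Qed.

(** J is invertible and exchanges p and q, so the off-diagonal part pRq equals pRp J and is spanned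
    by pJ. *)
Lemma mid_pq (x : R) : exists c, p * x * q = c *: (p * J).
Proof.
have [c e] := mid_p (x * J).
exists (sgn * c); rewrite -scalerA symZAl -e symZAr.
have -> : q = sgn *: (J * (p * J)) by rewrite mulrA Jp mulJJ scalerA sgn2 scale1r.
by rewrite -!symZAr !mulrA.
Qed.
Lemma mid_qp (x : R) : exists c, q * x * p = c *: (q * J).
Proof.
have [c e] := mid_q (x * J).
exists (sgn * c); rewrite -scalerA symZAl -e symZAr.
have -> : p = sgn *: (J * (q * J)) by rewrite mulrA Jq mulJJ scalerA sgn2 scale1r.
by rewrite -!symZAr !mulrA.
Qed.

Lemma corner_sum_idem : (p + q) * (p + q) = p + q.
Proof. by rewrite mulrDl !mulrDr pp qq pq qp addr0 add0r. Qed.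

Section Even.
Variables (dlt : F) (h : R).
Hypotheses (sgn1 : sgn = 1) (dlt2 : dlt * dlt = 1).
Hypothesis hE : h = 2^-1 *: (1 + dlt *: J).

Lemma even_Jh : J * h = dlt *: h.
Proof.
rewrite hE -symZAr mulrDr mulr1 -symZAr JJ sgn1 scale1r !scalerA [dlt * _]mulrC -scalerA.
by congr (_ *: _); rewrite scalerDr scalerA dlt2 scale1r addrC.
Qed.

Lemma even_hh : h * h = h.
Proof.
rewrite {1}hE -symZAl mulrDl mul1r -symZAl even_Jh scalerA dlt2 scale1r -mulr2n -scaler_nat scalerA.
by rewrite mulVf ?scale1r // pnatr_eq0.
Qed.

Lemma even_comm (x : R) : J * x = x * J -> h * x = x * h.
Proof.
by move=> c; rewrite hE -symZAl -symZAr mulrDl mulrDr mul1r mulr1 -symZAl -symZAr c.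
Qed.

Lemma even_hg : h * (p + q) = (p + q) * h.
Proof. by apply: even_comm; rewrite mulrDr mulrDl Jp Jq addrC. Qed.

Lemma even_idem : (p + q) * h * ((p + q) * h) = (p + q) * h.
Proof. by rewrite -even_hg mulrA -[h * _ * h]mulrA -even_hg [h * (h * _)]mulrA even_hh -mulrA corner_sum_idem. Qed.

Lemma even_hph : h * p * h = 2^-1 *: ((p + q) * h).
Proof.
rewrite {1}hE -!symZAl; congr (_ *: _).
by rewrite mulrDl mul1r -symZAl Jp mulrDl -symZAl -mulrA even_Jh -symZAr scalerA dlt2 scale1r mulrDl.
Qed.
Lemma even_hqh : h * q * h = 2^-1 *: ((p + q) * h).
Proof.
rewrite {1}hE -!symZAl; congr (_ *: _).
by rewrite mulrDl mul1r -symZAl Jq mulrDl -symZAl -mulrA even_Jh -symZAr scalerA dlt2 scale1r mulrDl addrC.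
Qed.

(** The corner of p + q is spanned by p, q, pJ and qJ. Between two factors h, J becomes the scalar
    [dlt] and p and q each become half of (p + q)h. *)
Lemma even_mid (x : R) : exists c, (p + q) * h * x * ((p + q) * h) = c *: ((p + q) * h).
Proof.
have [a ea] := mid_p x; have [b eb] := mid_q x.
have [c ec] := mid_pq x; have [e ee] := mid_qp x.
exists ((a + b + c * dlt + e * dlt) * 2^-1).
have -> : (p + q) * h * x * ((p + q) * h) = h * ((p + q) * x * (p + q)) * h.
  by rewrite -{1}even_hg !mulrA.
have -> : (p + q) * x * (p + q) = a *: p + b *: q + (c *: (p * J) + e *: (q * J)).
  rewrite !mulrDl !mulrDr ea eb ec ee -!addrA; congr (_ + _).
  by rewrite [in RHS]addrC -!addrA.
move: even_hph even_hqh; set G := (p + q) * h => hp hq.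
rewrite !mulrDr !mulrDl -!symZAr -!symZAl hp hq.
rewrite [h * (p * J)]mulrA [h * (q * J)]mulrA -![_ * J * h]mulrA even_Jh -!symZAr.
by rewrite hp hq !scalerA -!scalerDl; congr (_ *: _); ring.
Qed.

(** Serves to show non-vanishing: a ring map that kills (p + q)h also kills p. *)
Lemma even_php : p * ((p + q) * h) * p = 2^-1 *: p.
Proof.
rewrite mulrA mulrDr pp pq addr0 hE -symZAr -symZAl; congr (_ *: _).
rewrite mulrDr mulr1 mulrDl pp -symZAr -symZAl -mulrA Jp mulrA pq mul0r.
by rewrite scaler0 addr0.
Qed.

End Even.

Section Odd.
Variable cj : {rmorphism F -> F}.
Hypothesis sgnN : sgn = -1.
Hypotheses (cjp : symX cj p = q) (cjq : symX cj q = p) (cjJ : symX cj J = J).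

(* The corner is a quaternion algebra; y is the conjugate of the corner element and
   the scalar is its norm. *)
Lemma odd_norm (x : R) : symX cj x = x -> exists a c y,
  y * ((p + q) * x * (p + q)) = (a * cj a + c * cj c) *: (p + q) /\
  (a = 0 -> c = 0 -> (p + q) * x * (p + q) = 0).
Proof.
move=> cx; have [a ea] := mid_p x; have [c ec] := mid_pq x.
have eb : q * x * q = cj a *: q.
  by have := congr1 (@symX _ _ cj n) ea; rewrite symXZ !symXM cjp cx.
have ee : q * x * p = cj c *: (q * J).
  by have := congr1 (@symX _ _ cj n) ec; rewrite symXZ !symXM cjp cjq cjJ cx.
exists a, c, (cj a *: p - c *: (p * J) + (a *: q - cj c *: (q * J))).
have -> : (p + q) * x * (p + q) = a *: p + c *: (p * J) + (cj a *: q + cj c *: (q * J)).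
  by rewrite !mulrDl !mulrDr ea eb ec ee [cj c *: _ + _]addrC.
split=> [|-> ->]; last by rewrite !rmorph0 !scale0r !addr0.
have Jpp : p * J * p = 0 by rewrite -mulrA Jp mulrA pq mul0r.
have Jqq : q * J * q = 0 by rewrite -mulrA Jq mulrA qp mul0r.
have Jpq : p * J * q = p * J by rewrite -mulrA Jq mulrA pp.
have Jqp : q * J * p = q * J by rewrite -mulrA Jp mulrA qq.
have e1 : (cj a *: p - c *: (p * J)) * (a *: p + c *: (p * J)) =
    (a * cj a) *: p + (cj a * c) *: (p * J).
  rewrite mulrBl !mulrDr -!symZAl -!symZAr !mulrA pp Jpp mul0r !scaler0 addr0 subr0 !scalerA.
  by rewrite [cj a * a]mulrC.
have e2 : (cj a *: p - c *: (p * J)) * (cj a *: q + cj c *: (q * J)) =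
    (c * cj c) *: p - (cj a * c) *: (p * J).
  rewrite mulrBl !mulrDr -!symZAl -!symZAr !mulrA pq Jpq mul0r !scaler0 addr0 add0r !scalerA.
  by rewrite mulJJ sgnN scaleN1r scalerN opprD opprK addrC [c * cj a]mulrC.
have e3 : (a *: q - cj c *: (q * J)) * (a *: p + c *: (p * J)) =
    (c * cj c) *: q - (a * cj c) *: (q * J).
  rewrite mulrBl !mulrDr -!symZAl -!symZAr !mulrA qp Jqp mul0r !scaler0 addr0 add0r !scalerA.
  by rewrite mulJJ sgnN scaleN1r scalerN opprD opprK addrC [cj c * a]mulrC [cj c * c]mulrC.
have e4 : (a *: q - cj c *: (q * J)) * (cj a *: q + cj c *: (q * J)) =
    (a * cj a) *: q + (a * cj c) *: (q * J).
  by rewrite mulrBl !mulrDr -!symZAl -!symZAr !mulrA qq Jqq mul0r !scaler0 addr0 subr0 !scalerA.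
rewrite mulrDl [X in X + _ = _]mulrDr [X in _ + X = _]mulrDr e1 e2 e3 e4 scalerDr !scalerDl.
set A := (a * cj a) *: p; set C := (c * cj c) *: p; set A' := (a * cj a) *: q.
set C' := (c * cj c) *: q; set X := (cj a * c) *: _; set Y := (a * cj c) *: _.
by rewrite [A + X + _]addrACA subrr addr0 [C' - Y + _]addrACA addNr addr0 [C' + A']addrC.
Qed.

End Odd.
End AbstractCorner.

(** If the norm of gxg is not 0, multiplying by the conjugate y inverts gxg up to a nonzero scalar
    and exposes gzg. *)
Lemma domain_quaternion (F : numFieldType) n m (n0 : (0 < n)%N) (hm : (uphalf n <= m <= n)%N)
    (cj : {rmorphism F -> F}) (g x z : symT F n) :
  (forall a b : F, a * cj a + b * cj b = 0 -> a = 0 /\ b = 0) ->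
  g * g = g ->
  (exists a c y, y * (g * x * g) = (a * cj a + c * cj c) *: g /\ (a = 0 -> c = 0 -> g * x * g = 0)) ->
  piO m (g * x * g * z * g) = 0 -> piO m (g * x * g) = 0 \/ piO m (g * z * g) = 0.
Proof.
move=> cjpos gg [a [c [y [e e0]]]] h.
have [eN|nN] := eqVneq (a * cj a + c * cj c) 0.
  by left; have [a0 c0] := cjpos _ _ eN; rewrite e0 // piO0.
right; have : piO m (y * (g * x * g * z * g)) = 0 by rewrite -(piOM n0 hm) h tmulr0.
rewrite !mulrA; have -> : y * g * x * g * z * g = y * (g * x * g) * z * g by rewrite !mulrA.
rewrite e -!symZAl piOZ => /(congr1 (tsc (a * cj a + c * cj c)^-1)).
by rewrite tscA mulVf // tsc1 tscr0.
Qed.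

Lemma mulr_comm_mid (R : pzRingType) (x y e e' : R) :
  e * y = y * e -> x * e * (y * e') = x * y * (e * e').
Proof. by move=> c; rewrite -mulrA [e * _]mulrA c !mulrA. Qed.

(** * Descent of idempotents to the real form *)

Section RealForm.
Variables (K L : numFieldType) (f : {rmorphism K -> L}) (cj : {rmorphism L -> L}) (ii : L).
Variables (n m : nat).
Hypotheses (ii2 : ii * ii = -1) (cj_ii : cj ii = - ii) (cj_f : forall a, cj (f a) = f a).
Hypothesis cj_pos : forall a b : L, a * cj a + b * cj b = 0 -> a = 0 /\ b = 0.
Hypotheses (n0 : (0 < n)%N) (hm : (uphalf n <= m <= n)%N).
Local Notation B := (sB ii n). Local Notation E := (sE L n). Local Notation J := (sJ L n).

Lemma symX_inv (x : symT K n) : symX cj (symX f x) = symX f x.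
Proof. by apply/val_inj; rewrite !val_symX; apply/ffunP => I; rewrite !ffunE cj_f. Qed.

Lemma symX_sE (K' L' : numFieldType) (g : {rmorphism K' -> L'}) l :
  (uphalf n <= l <= n)%N -> symX g (sE K' n l) = sE L' n l.
Proof. by move=> hl; apply/val_inj; rewrite val_symX !val_sE // tmap_eidem. Qed.

Lemma symX_sJ (K' L' : numFieldType) (g : {rmorphism K' -> L'}) : symX g (sJ K' n) = sJ L' n.
Proof. by apply/val_inj; rewrite val_symX !val_sJ tmap_tJ. Qed.

(** Conjugation exchanges a and a^c. Hence the weights pair off as {k, n - k}, and only a middle
    weight n/2 is real by itself. *)
Lemma symX_sB k : (k <= n)%N -> symX cj (B k) = B (n - k).
Proof.
move=> kn; apply/val_inj; rewrite val_symX !val_sB ?leq_subr // !bkE ?leq_subr // tmap_sum.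
have bij : bijective (fun S : {set 'I_n} => ~: S) by exists (fun S => ~: S) => S; rewrite setCK.
rewrite [RHS](reindex _ (onW_bij _ bij)) /=; apply: eq_big => [S|S _].
  have e : (#|S| + #|~: S| = n)%N by rewrite cardsC card_ord.
  by apply/eqP/eqP; move: e; set a := #|S|; set b := #|~: S|; lia.
rewrite /chi tmap_pure; apply: eq_pure => p j; rewrite inE /=.
by case: (p \in S); rewrite /= /va /vc; do 2?case: ifP => _;
  rewrite ?rmorph0 ?fmorphV ?rmorph_nat // ?rmorphN rmorphM fmorphV rmorph_nat cj_ii mulrN ?opprK.
Qed.

(** Extension to L is injective, so all conditions may be tested there. The one on zero divisors is
    asked only of elements coming from K, since over L it can fail. *)
Lemma complete_descend (I : eqType) (idx : seq I) (g : I -> symT K n) :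
  let G i := symX f (g i) in
  uniq idx -> {in idx, forall i, G i * G i = G i} ->
  {in idx &, forall i j, i != j -> G i * G j = 0} ->
  {in idx, forall i, piO m (G i) <> 0} ->
  {in idx, forall i, forall r s : symT K n,
     piO m (G i * symX f r * G i * symX f s * G i) = 0 ->
     piO m (G i * symX f r * G i) = 0 \/ piO m (G i * symX f s * G i) = 0} ->
  \sum_(i <- idx) piO m (G i) = eO L n m ->
  complete_poi (@algA K n m) (eO K n m) (size idx) [seq piO m (g i) | i <- idx].
Proof.
move=> G ui id_g or_g nz_g dom_g sum_g.
have pi0 (x : symT K n) : piO m (symX f x) = 0 <-> piO m x = 0.
  by rewrite -tmap_piO; split=> [e|->]; [apply: (@tmap_inj _ _ f); rewrite e tmap0 | rewrite tmap0].
apply: (complete_poi_piO n0 hm) => //.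
- by move=> i hi; apply: (@symX_inj _ _ f); rewrite symXM id_g.
- by move=> i j hi hj ne; apply: (@symX_inj _ _ f); rewrite symXM or_g // symX0.
- by move=> i hi e; apply: (nz_g i hi); apply/pi0.
- move=> i hi r s /pi0; rewrite !symXM => /(dom_g i hi)[e|e]; [left | right];
    by apply/pi0; rewrite !symXM.
apply: (@tmap_inj _ _ f); rewrite tmap_sum /eO tmap_eidem // -/(eO L n m) -sum_g.
by apply: eq_bigr => i _; rewrite tmap_piO.
Qed.

Lemma sum_reflect (V : nmodType) (X : nat -> V) a b N : (a <= b)%N -> (b <= N.+1)%N ->
  \sum_(a <= k < b) X (N - k)%N = \sum_(N.+1 - b <= k < N.+1 - a) X k.
Proof.
elim: b => [|b ih] ab bN; first by rewrite !big_geq //; lia.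
case: (ltngtP a b.+1) ab => // [ab _|-> _]; last by rewrite !big_geq //; lia.
rewrite big_nat_recr //= ih //; last by lia.
rewrite subSS [RHS]big_ltn; last by lia.
by rewrite addrC subSn //; lia.
Qed.

Section Pair.
Variables (k l : nat).
Hypotheses (hl : (uphalf n <= l <= n)%N) (hk : (n - l <= k <= l)%N) (kk : k != (n - k)%N).
Let kn : (k <= n)%N. Proof. by clear -hl hk; lia. Qed.
Let hk' : (n - l <= n - k <= l)%N. Proof. by clear -hl hk; lia. Qed.

Lemma pair_mulE (x y : symT L n) : x * E l * (y * E l) = x * y * E l.
Proof. by rewrite -mulrA [E l * _]mulrA sEC // -[y * _ * _]mulrA sEE // eqxx !mulrA. Qed.
Lemma pair_pq : B k * E l * (B (n - k) * E l) = 0.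
Proof. by rewrite pair_mulE sBB ?leq_subr // (negbTE kk) mul0r. Qed.
Lemma pair_qp : B (n - k) * E l * (B k * E l) = 0.
Proof. by rewrite pair_mulE sBB ?leq_subr // eq_sym (negbTE kk) mul0r. Qed.
Lemma pair_Jp : J * (B k * E l) = B (n - k) * E l * J.
Proof. by rewrite mulrA sJB // -!mulrA sEC. Qed.
Lemma pair_Jq : J * (B (n - k) * E l) = B k * E l * J.
Proof. by rewrite mulrA sJB ?leq_subr // subKn // -!mulrA sEC. Qed.
Lemma pair_sgn : ((-1) ^+ n : L) * (-1) ^+ n = 1.
Proof. by rewrite -exprD -signr_odd oddD addbb. Qed.

Definition pair_pp := pp ii2 n0 hl hk.
Definition pair_qq := pp ii2 n0 hl hk'.
Definition pair_mp := p_mid ii2 n0 hl hk.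
Definition pair_mq := p_mid ii2 n0 hl hk'.
Definition pair_idem := corner_sum_idem pair_pp pair_qq pair_pq pair_qp.

(** [cj_pos] makes the norm anisotropic on elements coming from K, although over L the corner
    contains the orthogonal idempotents [B k * E l] and [B (n - k) * E l]. *)
Lemma odd_pair_domain (r s : symT K n) : odd n ->
  let g := B k * E l + B (n - k) * E l in
  piO m (g * symX f r * g * symX f s * g) = 0 ->
  piO m (g * symX f r * g) = 0 \/ piO m (g * symX f s * g) = 0.
Proof.
move=> on g; apply: (domain_quaternion n0 hm cj_pos); first exact: pair_idem.
have sgnN : (-1) ^+ n = -1 :> L by rewrite -signr_odd on.
apply: (odd_norm pair_pp pair_qq pair_pq pair_qp pair_Jp pair_Jq (sJJ L n) pair_sgn pair_mp sgnN).
- by rewrite symXM symX_sB // symX_sE.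
- by rewrite symXM symX_sB ?leq_subr // subKn // symX_sE.
- exact: symX_sJ.
exact: symX_inv.
Qed.

End Pair.

Lemma symX_symI (x : tens K n) : Sd 4 x -> symX f (symI x) = symI (tmap f x).
Proof.
move=> sx; apply/val_inj; rewrite val_symX !val_symI //; exact: tmap_Sd.
Qed.

Lemma symI_bkD k : (k <= n)%N -> symI (bk ii n k + bk ii n (n - k)) = B k + B (n - k).
Proof.
move=> kn; have [s1 s2] := (Sd_bk ii kn, Sd_bk ii (leq_subr k n)).
by apply/val_inj; rewrite val_symI ?raddfD /= ?val_sB ?leq_subr //; apply: SdD.
Qed.

Lemma sBB0 a b : (a <= n)%N -> (b <= n)%N -> (a == b) = false -> B a * B b = 0.
Proof. by move=> ha hb e; rewrite (sBB ii2 n0 ha hb) e. Qed.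

Theorem odd_complete : odd n ->
  let Ls := iota n.+1./2 (m - n.+1./2).+1 in
  let Ks l := iota (n - l) ((n.-1)./2 - (n - l)).+1 in
  complete_poi (@algA K n m) (eO K n m) (size [seq (l, k) | l <- Ls, k <- Ks l])
    [seq piO m (symI (tB K n k) * sE K n l) | l <- Ls, k <- Ks l].
Proof.
move=> on Ls Ks; set idx := [seq (l, k) | l <- _, k <- _].
have -> : [seq piO m (symI (tB K n k) * sE K n l) | l <- Ls, k <- Ks l] =
    [seq piO m (symI (tB K n i.2) * sE K n i.1) | i <- idx] by rewrite map_allpairs.
have idxP i : i \in idx -> [/\ (uphalf n <= i.1 <= n)%N, (i.1 <= m)%N,
    (n - i.1 <= i.2 <= i.1)%N, (i.2 <= (n.-1)./2)%N & i.2 != (n - i.2)%N].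
  by move/allpairsPdep => [l [k [hl hk ->]]] /=; rewrite !mem_iota in hl hk *; split; lia.
have GE i : i \in idx -> symX f (symI (tB K n i.2) * sE K n i.1) =
    B i.2 * E i.1 + B (n - i.2) * E i.1.
  move=> /idxP[h1 h2 h3 h4' h5]; have [sK _] := tB_spec K on h4'.
  rewrite symXM symX_sE // symX_symI // tmap_tB // (tB_bk ii2 on h4') symI_bkD ?mulrDl //; lia.
apply: complete_descend.
- apply: allpairs_uniq_dep => [|l hl|[l k] [l' k'] _ _ /= [-> ->]] //; exact: iota_uniq.
- by move=> i hi; rewrite GE //; have [h1 h2 h3 h4' h5] := idxP i hi; apply: pair_idem.
- move=> i j hi hj; rewrite !GE //; case: i j hi hj => [l k] [l' k'] /idxP[/= h1 h2 h3 h5 h6].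
  move=> /idxP[/= h1' h2' h3' h5' h6'] ne.
  rewrite -!mulrDl (mulr_comm_mid _ _ (sEC n0 _ h1)) (sEE L n0 h1 h1').
  case: (eqVneq l l') ne => [<-|_] ne; last by rewrite mulr0.
  have {}ne : k != k' by apply: contraNneq ne => ->.
  have kn : (k <= n)%N by lia.
  have kn' : (k' <= n)%N by lia.
  rewrite mulrDl !mulrDr.
  rewrite (sBB0 kn kn'); last by apply/negbTE.
  rewrite (sBB0 kn (leq_subr k' n)); last by apply/eqP; lia.
  rewrite (sBB0 (leq_subr k n) kn'); last by apply/eqP; lia.
  rewrite (sBB0 (leq_subr k n) (leq_subr k' n)); last by apply/eqP; lia.
  by rewrite !addr0 mul0r.
- move=> i hi; rewrite GE // => e; have [h1 h2 h3 h4' h5] := idxP i hi.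
  apply: (@piO_neq0 L ii n m ii2 n0 hm i.2 i.1) => //.
  have : piO m (B i.2 * E i.1 * (B i.2 * E i.1 + B (n - i.2) * E i.1)) = 0.
    by rewrite -(piOM n0 hm) e tmulr0.
  by rewrite mulrDr (pair_pq h1 h3 h5) (pair_pp h1 h3) addr0.
- by move=> i hi r s; rewrite GE //; have [h1 h2 h3 h4' h5] := idxP i hi; apply: odd_pair_domain.
rewrite (eq_big_seq (fun i => piO m (B i.2 * E i.1 + B (n - i.2) * E i.1))) => [|i hi]; last by rewrite GE.
rewrite -[RHS](sum_piO_sE L n0 hm) big_allpairs_dep /index_iota subSn; last by lia.
rewrite (_ : uphalf n = n.+1./2) // !big_seq; apply: eq_bigr => l; rewrite mem_iota => hl.
have hl' : (uphalf n <= l <= n)%N by lia.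
rewrite -piO_sum -[in RHS](sE_sum ii2 n0 hl') //; apply: (congr1 (@piO L n m)) => /=.
rewrite [RHS](@big_cat_nat _ _ _ (n.-1)./2.+1) /=; try lia.
have -> : Ks l = index_iota (n - l) (n.-1)./2.+1 by rewrite /Ks /index_iota subSn //; lia.
rewrite big_split /=; congr (_ + _).
(* Reflected by k -> n - k, the second summands run through the upper half of the weights n - l,
   ..., l. *)
rewrite (sum_reflect (fun k => B k * E l)); try lia.
by congr (\sum_(_ <= _ < _) _); lia.
Qed.

Section Even.
Hypothesis en : ~~ odd n.
Let N := n./2.
Let sgn1 : (-1) ^+ n = 1 :> L. Proof. by rewrite -signr_odd (negbTE en). Qed.

Definition dlt (F : numFieldType) (b : bool) : F := if b then 1 else -1.
Definition hJ (F : numFieldType) (b : bool) : symT F n := 2^-1 *: (1 + dlt F b *: sJ F n).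

Lemma dlt2 b : dlt L b * dlt L b = 1.
Proof. by case: b; rewrite /dlt ?mulr1 ?mulrNN ?mulr1. Qed.

Lemma hJM b b' : hJ L b * hJ L b' = if b == b' then hJ L b else 0.
Proof.
case: eqP => [<-|ne]; first exact: (even_hh (sJJ L n) sgn1 (dlt2 b) (erefl _)).
have -> : b' = ~~ b by case: b b' ne => [] [].
rewrite {1}/hJ -symZAl mulrDl mul1r -symZAl (even_Jh (sJJ L n) sgn1 (dlt2 (~~ b)) (erefl _)) scalerA.
by case: b {ne}; rewrite /dlt /= ?mul1r ?mulr1 scaleN1r subrr scaler0.
Qed.

Lemma hJ_sum : hJ L false + hJ L true = 1.
Proof.
rewrite /hJ -scalerDr addrACA -scalerDl /dlt addNr scale0r addr0 -mulr2n -scaler_nat scalerA.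
by rewrite mulVf ?scale1r // pnatr_eq0.
Qed.

Definition sP k : symT L n := B k + B (n - k).

Lemma sJP k : (k <= n)%N -> J * sP k = sP k * J.
Proof.
move=> kn; have e1 := sJB ii n0 kn; have e2 := sJB ii n0 (leq_subr k n).
by rewrite (subKn kn) in e2; rewrite /sP mulrDr mulrDl e1 e2 [LHS]addrC.
Qed.
Lemma hJP b k : (k <= n)%N -> hJ L b * sP k = sP k * hJ L b.
Proof. by move=> kn; apply: (even_comm (erefl _)); apply: sJP. Qed.
Lemma sPP k k' : (k < N)%N -> (k' < N)%N -> sP k * sP k' = if k == k' then sP k else 0.
Proof.
rewrite /N => h h'; rewrite /sP mulrDl !mulrDr.
have kn : (k <= n)%N by lia.
have kn' : (k' <= n)%N by lia.
rewrite (@sBB0 k (n - k') kn (leq_subr _ _)); last by apply/eqP; lia.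
rewrite (@sBB0 (n - k) k' (leq_subr _ _) kn'); last by apply/eqP; lia.
rewrite (sBB ii2 n0 kn kn') (sBB ii2 n0 (leq_subr k n) (leq_subr k' n)) addr0 add0r.
rewrite (_ : (n - k == n - k')%N = (k == k')); last by apply/eqP/eqP; lia.
by case: (k == k'); rewrite ?addr0.
Qed.
Lemma sP_mid0 k : (k < N)%N -> B N * sP k = 0 /\ sP k * B N = 0.
Proof.
rewrite /N => h; rewrite /sP mulrDl mulrDr.
have kn : (k <= n)%N by lia.
have Nn : (n./2 <= n)%N by lia.
rewrite (@sBB0 _ _ Nn kn); last by apply/eqP; lia.
rewrite (@sBB0 _ _ Nn (leq_subr k n)); last by apply/eqP; lia.
rewrite (@sBB0 _ _ kn Nn); last by apply/eqP; lia.
rewrite (@sBB0 _ _ (leq_subr k n) Nn); last by apply/eqP; lia.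
by rewrite addr0.
Qed.

(** [inl l] is the middle weight n/2; in [inr (l, (k, b))] the Boolean encodes the sign delta. The
    nesting reproduces the order of the list in (c). *)
Definition gC (i : nat + nat * (nat * bool)) : symT K n :=
  match i with
  | inl l => symI (tC0 K n) * sE K n l
  | inr (l, (k, b)) => symI (tC K n k) * hJ K b * sE K n l
  end.
Definition GC (i : nat + nat * (nat * bool)) : symT L n :=
  match i with
  | inl l => B N * E l
  | inr (l, (k, b)) => sP k * hJ L b * E l
  end.

Lemma sum_GC :
  let Ls := iota n./2 (m - n./2).+1 in
  let Ks l := iota (n - l) (n./2 - (n - l)) in
  \sum_(i <- [seq inl l | l <- Ls] ++
    [seq inr i | i <- [seq (l, i) | l <- Ls, i <- [seq (k, b) | k <- Ks l, b <- [:: false; true]]]])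
    piO m (GC i) = eO L n m.
Proof.
move=> Ls Ks; rewrite big_cat !big_map big_allpairs_dep -[RHS](sum_piO_sE L n0 hm).
rewrite /index_iota subSn; last by lia.
rewrite (_ : uphalf n = n./2); last by lia.
transitivity (\sum_(l <- Ls) (piO m (GC (inl l)) +
    \sum_(i <- [seq (k, b) | k <- Ks l, b <- [:: false; true]]) piO m (GC (inr (l, i))))).
  by rewrite big_split.
rewrite !big_seq; apply: eq_bigr => l; rewrite mem_iota => hl.
have hl' : (uphalf n <= l <= n)%N by lia.
rewrite big_allpairs /= (eq_bigr (fun k => piO m (sP k * E l))) => [|k _]; last first.
  by rewrite !big_cons big_nil /= addr0 -piOD -!mulrDl -mulrDr hJ_sum mulr1.
rewrite -piO_sum -piOD -[in RHS](sE_sum ii2 n0 hl') //; apply: (congr1 (@piO L n m)) => /=.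
rewrite [RHS](@big_cat_nat _ _ _ N) /=; try (rewrite /N; lia).
rewrite [X in _ = _ + X]big_ltn; last by rewrite /N; lia.
have -> : Ks l = index_iota (n - l) N by [].
rewrite (eq_bigr (fun k => B k * E l + B (n - k) * E l)) => [|k _]; last by rewrite mulrDl.
rewrite big_split /= [LHS]addrCA; congr (_ + (_ + _)).
rewrite (sum_reflect (fun k => B k * E l)); try (rewrite /N; lia).
by congr (\sum_(_ <= _ < _) _); rewrite /N; lia.
Qed.

Theorem even_complete :
  let Ls := iota n./2 (m - n./2).+1 in
  let Ks l := iota (n - l) (n./2 - (n - l)) in
  let idx := [seq inl l | l <- Ls] ++
    [seq inr i | i <- [seq (l, i) | l <- Ls, i <- [seq (k, b) | k <- Ks l, b <- [:: false; true]]]] in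
  complete_poi (@algA K n m) (eO K n m) (size idx) [seq piO m (gC i) | i <- idx].
Proof.
move=> Ls Ks idx.
have idx2P l k b : inr (l, (k, b)) \in idx -> [/\ (uphalf n <= l <= n)%N, (l <= m)%N,
    (n - l <= k <= l)%N, (k < N)%N & k != (n - k)%N].
  rewrite mem_cat => /orP[/mapP[//]|/mapP[[l' [k' b']]]].
  move=> /allpairsPdep[l1 [[k1 b1] [hl /allpairsPdep[k2 [b2 [hk _ [-> ->]]]] [-> -> ->]]]] [-> -> _].
  by rewrite !mem_iota in hl hk; rewrite /N; split; lia.
have idx1P l : inl l \in idx -> [/\ (uphalf n <= l <= n)%N, (l <= m)%N & (n - l <= N <= l)%N].
  rewrite mem_cat => /orP[/mapP[l' hl [->]]|/mapP[//]].
  by rewrite mem_iota in hl; rewrite /N; split; lia.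
have Nn : (N <= n)%N by rewrite /N; lia.
have GE i : i \in idx -> symX f (gC i) = GC i.
  case: i => [l|[l [k b]]] hi /=.
    have [h1 h2 h3] := idx1P l hi; have [sK _] := tC0_spec K en.
    by rewrite symXM (symX_sE _ h1) (symX_symI sK) (tmap_tC0 _ en) (tC0_bk ii2 en).
  have [h1 h2 h3 h4' h5] := idx2P l k b hi; have [sK _] := tC_spec K en h4'.
  have kn : (k <= n)%N by lia.
  rewrite !symXM (symX_sE _ h1) (symX_symI sK) (tmap_tC _ en h4') (tC_bk ii2 en h4') (symI_bkD kn).
  have ed : f (dlt K b) = dlt L b by rewrite /dlt; case: (b); rewrite ?rmorphN1 ?rmorph1.
  by rewrite /hJ symXZ symXD symXZ symX1 symX_sJ fmorphV rmorph_nat ed.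
have GC2 l k b : (uphalf n <= l <= n)%N -> GC (inr (l, (k, b))) = (B k * E l + B (n - k) * E l) * hJ L b.
  by move=> hl; rewrite /GC /sP -[LHS]mulrA -(sEC n0 (hJ L b) hl) [LHS]mulrA mulrDl.
have gm l k b l' k' b' : (uphalf n <= l <= n)%N -> (k' <= n)%N ->
    sP k * hJ L b * E l * (sP k' * hJ L b' * E l') = sP k * sP k' * (hJ L b * hJ L b') * (E l * E l').
  move=> hl hk'; rewrite (mulr_comm_mid _ _ (sEC n0 _ hl)); congr (_ * _).
  exact: (mulr_comm_mid _ _ (hJP b hk')).
have nz2 l k b : inr (l, (k, b)) \in idx -> piO m (GC (inr (l, (k, b)))) <> 0.
  move=> hi e; have [h1 h2 h3 h4' h5] := idx2P l k b hi.
  apply: (@piO_neq0 L ii n m ii2 n0 hm k l) => //.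
  (* If this idempotent died under [piO], so would half of [B k * E l], contrary to [piO_neq0]. *)
  have e1 := even_php (pair_pp h1 h3) (pair_pq h1 h3 h5) (pair_Jp h1 h3) (erefl (hJ L b)).
  have := congr1 (piO m) e1; rewrite -(piOM n0 hm) -(piOM n0 hm) -GC2 // e tmulr0 tmul0r piOZ.
  move=> /esym/(congr1 (tsc 2)); rewrite tscA tscr0 mulfV ?tsc1 //.
  by rewrite pnatr_eq0.
have id2 l k b : inr (l, (k, b)) \in idx -> GC (inr (l, (k, b))) * GC (inr (l, (k, b))) = GC (inr (l, (k, b))).
  move=> hi; have [h1 h2 h3 h4' h5] := idx2P l k b hi; rewrite GC2 //.
  exact: (even_idem (pair_pp h1 h3) (pair_qq h1 h3) (pair_pq h1 h3 h5) (pair_qp h1 h3 h5)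
    (pair_Jp h1 h3) (pair_Jq h1 h3) (sJJ L n) sgn1 (dlt2 b) (erefl _)).
apply: complete_descend.
- rewrite cat_uniq; apply/and3P; split.
  + by rewrite map_inj_uniq ?iota_uniq // => x y [].
  + by apply/hasPn => x /mapP[i _ ->]; apply/negP => /mapP[? _ //].
  rewrite map_inj_uniq => [|x y [->] //].
  apply: allpairs_uniq_dep => [|l _|[l a] [l' a'] _ _ /= [-> ->] //]; first exact: iota_uniq.
  by apply: allpairs_uniq => [||[a b] [c e] _ _ /= [-> ->] //]; [exact: iota_uniq | by []].
- move=> i hi; rewrite GE //; case: i hi => [l|[l [k b]]] hi; last exact: id2.
  by have [h1 h2 h3] := idx1P l hi; apply: (pair_pp h1 h3).
- move=> i j hi hj; rewrite !GE //; case: i hi => [l|[l [k b]]] hi; case: j hj => [l'|[l' [k' b']]] hj ne /=.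
  + have [h1 h2 h3] := idx1P l hi; have [h1' h2' h3'] := idx1P l' hj.
    rewrite (mulr_comm_mid _ _ (sEC n0 _ h1)) (sEE L n0 h1 h1').
    case: (eqVneq l l') ne => [->|_ _]; first by rewrite eqxx.
    exact: mulr0.
  + have [h1 h2 h3] := idx1P l hi; have [h1' h2' h3' h4' h5'] := idx2P l' k' b' hj.
    rewrite (mulr_comm_mid _ _ (sEC n0 _ h1)) [B N * _]mulrA (sP_mid0 h4').1.
    by rewrite [0 * hJ L b']mul0r [LHS]mul0r.
  + have [h1 h2 h3 h4' h5] := idx2P l k b hi; have [h1' h2' h3'] := idx1P l' hj.
    have kn : (k <= n)%N by lia.
    rewrite (mulr_comm_mid _ _ (sEC n0 _ h1)) -(hJP b kn) -[X in X * _]mulrA (sP_mid0 h4').2.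
    by rewrite [hJ L b * 0]mulr0 [LHS]mul0r.
  have [h1 h2 h3 h4' h5] := idx2P l k b hi; have [h1' h2' h3' h4'' h5'] := idx2P l' k' b' hj.
  have kn' : (k' <= n)%N by lia.
  rewrite (gm _ _ _ _ _ _ h1 kn') (sPP h4' h4'') hJM (sEE L n0 h1 h1'); case: (eqVneq l l') ne => [->|_ _]; last by rewrite mulr0.
  case: (eqVneq k k') => [->|_ _]; last by rewrite !mul0r.
  by case: (eqVneq b b') => [->|_ _]; rewrite ?eqxx // mulr0 mul0r.
- move=> i hi; rewrite GE //; case: i hi => [l|[l [k b]]] hi; last exact: nz2.
  by have [h1 h2 h3] := idx1P l hi; apply: (@piO_neq0 L ii n m ii2 n0 hm N l).
- move=> i hi r s; rewrite !GE //; case: i hi => [l|[l [k b]]] hi.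
    by have [h1 h2 h3] := idx1P l hi; apply: (domain_p ii2 n0 hm h1 h2 h3).
  have [h1 h2 h3 h4' h5] := idx2P l k b hi.
  apply: (domain_scalar n0 hm (nz2 l k b hi) _ (id2 l k b hi)) => x.
  have [c ec] := even_mid (pair_Jp h1 h3) (pair_Jq h1 h3) (sJJ L n) pair_sgn
    (pair_mp h1 h3) (pair_mq h1 h3) sgn1 (dlt2 b) (erefl (hJ L b)) x.
  by exists c; rewrite GC2 // ec piOZ.
by rewrite (eq_big_seq (fun i => piO m (GC i))) => [|i hi]; [exact: sum_GC | rewrite GE].
Qed.

End Even.
End RealForm.

(** * Counting the idempotents and matching the stated families *)

Lemma sumn_affine (g : nat -> nat) u t a b :
  (forall j, (j < t)%N -> g (u + j)%N = (a * j + b)%N) ->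
  (2 * sumn [seq g l | l <- iota u t] + a * t = a * t * t + 2 * b * t)%N.
Proof.
elim: t => [|t ih] hg; first by rewrite /= !muln0.
rewrite -(addn1 t) iotaD map_cat sumn_cat /= addn0 hg //.
have {}ih := ih (fun j hj => hg j (ltnW hj)).
move: (sumn _) ih => S; nia.
Qed.

Lemma eq_allpairs_dep (T U W : eqType) (g h : T -> U -> W) s (t : T -> seq U) :
  {in s, forall x, {in t x, g x =1 h x}} ->
  [seq g x y | x <- s, y <- t x] = [seq h x y | x <- s, y <- t x].
Proof. by move=> e; congr flatten; apply/eq_in_map => x hx; apply/eq_in_map => y; apply: e. Qed.

Lemma famA_piO n m k l : (0 < n)%N -> (uphalf n <= l <= n)%N -> (k <= n)%N ->
  famA n m k l = piO m (sB ('i%C : CC) n k * sE CC n l).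
Proof. by move=> n0 hl kn; rewrite /piO val_symM val_sB // val_sE. Qed.

Lemma famB_piO n m k l : (0 < n)%N -> (uphalf n <= l <= n)%N -> odd n -> (k <= (n.-1)./2)%N ->
  famB n m k l = piO m (symI (tB RR n k) * sE RR n l).
Proof.
move=> n0 hl on hk; have [sK _] := tB_spec RR on hk.
by rewrite /piO val_symM (val_symI sK) val_sE.
Qed.

Lemma famC0_piO n m l : (0 < n)%N -> (uphalf n <= l <= n)%N -> ~~ odd n ->
  famC0 n m l = piO m (gC RR n (inl l)).
Proof.
move=> n0 hl en; have [sK _] := tC0_spec RR en.
by rewrite /gC /piO val_symM (val_symI sK) val_sE.
Qed.

Lemma famC_piO n m k l b : (0 < n)%N -> (uphalf n <= l <= n)%N -> ~~ odd n -> (k < n./2)%N ->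
  famC n m k l (dlt RR b) = piO m (gC RR n (inr (l, (k, b)))).
Proof.
move=> n0 hl en hk; have [sK _] := tC_spec RR en hk.
rewrite /gC /piO val_symM val_symM (val_symI sK) val_sE // /hJ val_symZ.
have -> : val (1 + dlt RR b *: sJ RR n) = val (1 : symT RR n) + val (dlt RR b *: sJ RR n).
  exact: raddfD.
by rewrite val_symZ val_sym1 val_sJ.
Qed.

Lemma sum_normc_eq0 (a b : CC) : a * conjc a + b * conjc b = 0 -> a = 0 /\ b = 0.
Proof.
move=> /eqP; rewrite paddr_eq0 ?mulcJ_ge0 // !mulf_eq0 !conjc_eq0 !orbb.
by case/andP => /eqP-> /eqP->.
Qed.

Theorem theoremC (n m : nat) :
  (0 < n)%N -> (uphalf n <= m <= n)%N ->
  (* (a) *)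
  complete_poi (@algA CC n m) (eO CC n m)
    (if odd n then ((2 * m - n + 1) * (2 * m - n + 3)) %/ 4
     else (2 * m - n + 2) ^ 2 %/ 4)%N
    [seq famA n m k l | l <- iota (uphalf n) (m - uphalf n).+1,
                        k <- iota (n - l) (l - (n - l)).+1]
  /\
  (* (b) *)
  (odd n ->
   complete_poi (@algA RR n m) (eO RR n m)
     (((2 * m - n + 1) * (2 * m - n + 3)) %/ 8)%N
     [seq famB n m k l | l <- iota n.+1./2 (m - n.+1./2).+1,
                         k <- iota (n - l) ((n.-1)./2 - (n - l)).+1])
  /\
  (* (c) *)
  (~~ odd n ->
   complete_poi (@algA RR n m) (eO RR n m)
     ((2 * m - n + 2) ^ 2 %/ 4)%N
     ([seq famC0 n m l | l <- iota n./2 (m - n./2).+1] ++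
      flatten [seq [seq famC n m k l dlt | k <- iota (n - l) (n./2 - (n - l)),
                                           dlt <- [:: -1; 1]]
              | l <- iota n./2 (m - n./2).+1])).
Proof.
move=> n0 hm.
have ii2 : 'i%C * 'i%C = -1 :> CC by rewrite -expr2 sqr_i.
have cj_ii : conjc ('i%C : CC) = - 'i%C by apply/eqP; rewrite eq_complex /= oppr0 !eqxx.
have cj_f (a : RR) : conjc (real_complex RR a) = real_complex RR a by exact: conjc_real.
split; [|split].
- rewrite (_ : (if odd n then _ else _) = size [seq (l, k)
    | l <- iota (uphalf n) (m - uphalf n).+1, k <- iota (n - l) (l - (n - l)).+1]).
    rewrite (@eq_allpairs_dep _ _ _ _ (fun l k => piO m (sB ('i%C : CC) n k * sE CC n l))).
      exact: (split_complete ii2 n0 hm).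
    by move=> l hl k hk; rewrite !mem_iota in hl hk; apply: famA_piO => //; lia.
  rewrite size_allpairs_dep; under eq_map => l do rewrite size_iota.
  (* For l = uphalf n + j there are 2j + 1 + odd n weights; over t values of l this adds up to
     t(t+1) or t^2. [sumn_affine] is doubled and rearranged so that neither division nor truncated
     subtraction enters. *)
  have /(@sumn_affine (fun l => (l - (n - l)).+1) (uphalf n) (m - uphalf n).+1 2 (1 + odd n)) : forall j, (j < (m - uphalf n).+1)%N ->
      ((fun l => (l - (n - l)).+1) ((uphalf n) + j) = 2 * j + (1 + odd n))%N by move=> j hj /=; lia.
  set S := sumn _; set t := (m - uphalf n).+1 => e; case: (boolP (odd n)) => on.
    have -> : ((2 * m - n + 1) = 2 * t)%N by rewrite /t; lia.
    have -> : ((2 * m - n + 3) = 2 * t.+1)%N by rewrite /t; lia.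
    rewrite (_ : (2 * t * (2 * t.+1) = t * t.+1 * 4)%N) ?mulnK //; last by lia.
    by move: e; rewrite on; move: (S) (t) => S' t'; clear; nia.
  have -> : ((2 * m - n + 2) = 2 * t)%N by rewrite /t; lia.
  rewrite (_ : ((2 * t) ^ 2 = t * t * 4)%N) ?mulnK //; last by rewrite expnMn; lia.
  by move: e; rewrite (negbTE on); move: (S) (t) => S' t'; clear; nia.
- move=> on.
  rewrite (_ : (_ %/ 8)%N = size [seq (l, k)
    | l <- iota n.+1./2 (m - n.+1./2).+1, k <- iota (n - l) ((n.-1)./2 - (n - l)).+1]).
    rewrite (@eq_allpairs_dep _ _ _ _ (fun l k => piO m (symI (tB RR n k) * sE RR n l))).
      exact: (@odd_complete _ _ _ _ _ _ _ ii2 cj_ii cj_f sum_normc_eq0 n0 hm on).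
    by move=> l hl k hk; rewrite !mem_iota in hl hk; apply: famB_piO => //; lia.
  rewrite size_allpairs_dep; under eq_map => l do rewrite size_iota.
  have /(@sumn_affine (fun l => ((n.-1)./2 - (n - l)).+1) n.+1./2 (m - n.+1./2).+1 1 1) : forall j, (j < (m - n.+1./2).+1)%N ->
      ((fun l => ((n.-1)./2 - (n - l)).+1) (n.+1./2 + j) = 1 * j + 1)%N by move=> j hj /=; lia.
  set S := sumn _; set t := (m - n.+1./2).+1 => e.
  have -> : ((2 * m - n + 1) = 2 * t)%N by rewrite /t; lia.
  have -> : ((2 * m - n + 3) = 2 * t.+1)%N by rewrite /t; lia.
  rewrite (_ : (2 * t * (2 * t.+1) = S * 8)%N) ?mulnK //.
  by move: e; move: (S) (t) => S' t'; clear; nia.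
move=> en.
have := even_complete (real_complex RR) ii2 n0 hm en; cbv zeta.
set idx2 := [seq inr i | i <- _]; rewrite map_cat.
rewrite (_ : [seq piO m (gC RR n i) | i <- [seq inl l | l <- _]] =
    [seq famC0 n m l | l <- iota n./2 (m - n./2).+1]); last first.
  rewrite -map_comp; apply/eq_in_map => l; rewrite mem_iota => hl /=.
  by rewrite famC0_piO //; lia.
rewrite (_ : [seq piO m (gC RR n i) | i <- idx2] = flatten [seq [seq famC n m k l dlt |
    k <- iota (n - l) (n./2 - (n - l)), dlt <- [:: -1; 1]] | l <- iota n./2 (m - n./2).+1]); last first.
  rewrite /idx2 -map_comp map_allpairs; congr flatten; apply/eq_in_map => l; rewrite mem_iota => hl.
  rewrite map_allpairs; congr flatten; apply/eq_in_map => k; rewrite mem_iota => hk /=.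
  by rewrite -!famC_piO //; lia.
rewrite (_ : size _ = ((2 * m - n + 2) ^ 2 %/ 4)%N) //.
rewrite size_cat !size_map size_iota size_allpairs_dep.
under eq_map => l do rewrite size_allpairs size_iota /=.
(* With t values of l there are t(t-1) signed idempotents, and the t middle ones complete them to
   t^2. *)
have /(@sumn_affine (fun l => (n./2 - (n - l)) * 2)%N n./2 (m - n./2).+1 2 0) : forall j, (j < (m - n./2).+1)%N ->
    ((fun l => (n./2 - (n - l)) * 2) (n./2 + j) = 2 * j + 0)%N by move=> j hj /=; lia.
set S := sumn _; set t := (m - n./2).+1 => e.
have -> : ((2 * m - n + 2) = 2 * t)%N by rewrite /t; lia.
rewrite (_ : ((2 * t) ^ 2 = t * t * 4)%N) ?mulnK //; last by rewrite expnMn; lia.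
by move: e; move: (S) (t) => S' t'; clear; nia.
Qed.
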